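(* Let $\Sigma$ be a finite set of letters and let $\mathbf{UCF}$ be the two-sorted algebra of unordered forests and one-hole contexts over $\Sigma$. Then the functionality problem (given a bottom-up register automaton with values in $\mathbf{UCF}$, decide whether it is functional) is decidable, and the equivalence problem for functional automata (given two functional bottom-up register automata with values in $\mathbf{UCF}$ over the same input signature, decide whether they define the same partial function) is decidable.
   Context: Unordered forests. An unordered tree over $\Sigma$ is an unranked $\Sigma$-labelled finite tree in which the children of each node form a multiset (no order). An unordered forest is a finite multiset of unordered trees; $\emptyset$ is the empty forest. Operations on forests: $+$ is multiset union, and for $a\in\Sigma$, $\mathrm{root}_a(t_1+\dots+t_n)$ is the tree $a(t_1,\dots,t_n)$ with root labelled $a$ and children $t_1,\dots,t_n$. $\mathbf{UCF}$. Let $\circ$ be a hole symbol that may be used as a leaf, in place of a tree. $\mathbf{UCF}$ is the two-sorted algebra whose elements of type $0$ are unordered forests (no occurrence of $\circ$) and whose elements of type $1$ are unordered forests with exactly one occurrence of $\circ$ (contexts). Its operations are $+$ (on pairs of types $(0,0),(0,1),(1,0)$, so that at most one hole occurs in the result), $\mathrm{root}_a$ for $a\in\Sigma$ (on each type), and substitution $h[\circ:=g]$, replacing the hole (if any) of $h$ by $g$ (on every pair of types). An operation defined on several combinations of types is regarded as one typed operation for each combination. Polynomial functions. For an algebra with universe $A$, a polynomial function $A^k\to A$ is a function induced by a term built from variables, elements of $A$ as constants, and the operations of the algebra; a polynomial function $A^k\to A^m$ is an $m$-tuple of such functions. In a multi-sorted algebra, terms and polynomial functions are required to be well typed. Register automata.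 A ranked signature $\Gamma$ is a finite set of symbols, each with a finite rank; ranked trees are terms over $\Gamma$. A bottom-up register automaton with values in an algebra with universe $A$ is a tuple $M=(\Gamma,n,Q,\delta,F)$ where $\Gamma$ is a ranked signature, $n$ is the number of registers, $Q$ is a finite set of states, $\delta$ is a finite set of rules $a(q_1,\dots,q_k)\to q,f$ with $a\in\Gamma$ of rank $k$, $q,q_1,\dots,q_k\in Q$, and $f:A^{n\times k}\to A^n$ a polynomial function, and $F$ is a partial function associating to some states $q$ a polynomial function $f_q:A^n\to A$. In the multi-sorted case each state has a fixed tuple of types for its registers, and all functions are typed accordingly. Inductively, $a(t_1,\dots,t_k)\to(q,f(\bar r_1,\dots,\bar r_k))$ whenever $a(q_1,\dots,q_k)\to q,f$ is in $\delta$ and $t_i\to(q_i,\bar r_i)$ for all $i$. The relation $[\![M]\!]$ relates a tree $t$ to each value $f_q(\bar r)$ such that $t\to(q,\bar r)$ and $F(q)=f_q$ is defined. $M$ is functional if $[\![M]\!]$ is a (partial) function. *)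

(* Defs.v *)
From Stdlib Require List.
From HB Require Import structures.
From mathcomp Require Import all_boot.

Set Implicit Arguments.
Unset Strict Implicit.
Unset Printing Implicit Defensive.

Local Open Scope quotient_scope.

(* Ordered trees, in which the hole may be used as a leaf.  Unordered forests
   are the quotient [uforest] of [seq (otree Sigma)]. *)

Inductive otree (Sigma : Type) : Type :=
| Hole
| Node of Sigma & seq (otree Sigma).

Arguments Hole {Sigma}.

Section Induction.

Variables (Sigma : Type) (P : otree Sigma -> Prop).

Fixpoint All (s : seq (otree Sigma)) : Prop :=
  if s is t :: s' then P t /\ All s' else True.

Hypotheses (PHole : P Hole) (PNode : forall a s, All s -> P (Node a s)).

Fixpoint otree_nested_ind t : P t :=
  match t with
  | Hole => PHole
  | Node a s =>
    PNode a ((fix all_P s : All s :=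
      if s is t :: s' then conj (otree_nested_ind t) (all_P s') else I) s)
  end.

End Induction.

Section OTreeCount.

Variable Sigma : Type.

Fixpoint gentree_of (t : otree Sigma) : GenTree.tree Sigma :=
  match t with
  | Hole => GenTree.Node 0 [::]
  | Node a s => GenTree.Node 1 (GenTree.Leaf a :: map gentree_of s)
  end.

Fixpoint otree_of (g : GenTree.tree Sigma) : option (otree Sigma) :=
  match g with
  | GenTree.Node 1 (GenTree.Leaf a :: s) => Some (Node a (pmap otree_of s))
  | _ => Some Hole
  end.

Lemma gentree_ofK : pcancel gentree_of otree_of.
Proof.
elim/otree_nested_ind => //= a s IHs; congr (Some (Node a _)).
by elim: s IHs => //= t s IHs [-> /IHs ->].
Qed.

End OTreeCount.

HB.instance Definition _ (Sigma : countType) :=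
  Countable.copy (otree Sigma) (pcan_type (@gentree_ofK Sigma)).

Section Eqv.

Variable Sigma : countType.
Implicit Types (t u : otree Sigma) (s : seq (otree Sigma)).

(* [matching ps us]: the items of [us] can be paired off with the predicates
   of [ps]. The choice is greedy, which is harmless when the predicates are
   classes of an equivalence; see [tree_eqv_nodeP] and [forest_eqvP]. *)
Fixpoint matching (T : Type) (ps : seq (pred T)) (us : seq T) : bool :=
  if ps is p :: ps' then
    let i := find p us in
    (i < size us) && matching ps' (take i us ++ drop i.+1 us)
  else nilp us.

Fixpoint tree_eqv t u : bool :=
  match t, u with
  | Hole, Hole => true
  | Node a ts, Node b us => (a == b) && matching (map tree_eqv ts) us
  | _, _ => false
  end.

Definition forest_eqv (ts us : seq (otree Sigma)) : bool :=
  matching (map tree_eqv ts) us.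

(* Sorting the children at every node, for an arbitrary order on trees, gives
   a complete invariant of [tree_eqv]; it is used in proofs only. *)
Definition leT : rel (otree Sigma) := relpre pickle leq.

Fixpoint canon t : otree Sigma :=
  if t is Node a s then Node a (sort leT (map canon s)) else Hole.

Lemma perm_sort_leT s1 s2 : (sort leT s1 == sort leT s2) = perm_eq s1 s2.
Proof.
apply/eqP/idP => [eq_s | /perm_sortP-> //].
- by rewrite -(perm_sort leT s1) eq_s perm_sort.
- by move=> x y; apply: leq_total.
- by move=> y x z; apply: leq_trans.
- move=> x y /anti_leq/(pcan_inj pickleK); exact.
Qed.

Lemma matchingE (T : Type) (c : T -> otree Sigma) (e : T -> pred T) ts us :
  (forall y, foldr (fun x b => (e x y = (c x == c y)) /\ b) True ts) ->
  matching (map e ts) us = perm_eq (map c ts) (map c us).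
Proof.
elim: ts us => [|x ts IHts] us /= e_c.
  by case: us => //= y us; apply/esym/negP => /perm_size.
rewrite -has_find; set i := find _ _.
have Ex : e x =1 (fun y => c x == c y) by move=> y; case: (e_c y).
have hasE : has (e x) us = (c x \in map c us).
  by rewrite -has_pred1 has_map; apply: eq_has => y; rewrite Ex /= eq_sym.
rewrite IHts; last by move=> y; case: (e_c y).
have [x_us | x_us] := boolP (has _ _); last first.
  apply/esym/negP => /perm_mem/(_ (c x)).
  by rewrite inE eqxx -hasE (negPf x_us).
have i_us : i < size us by rewrite -has_find.
have us_gt0 : 0 < size us by apply: leq_trans i_us.
have y0 : T by case: us {i hasE i_us x_us} us_gt0.
have cnth : c (nth y0 us i) = c x.
  by apply/esym/eqP; rewrite -Ex; apply: nth_find.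
have us_split : perm_eq (map c us) (c x :: map c (take i us ++ drop i.+1 us)).
  rewrite -{1}(cat_take_drop i us) (drop_nth y0) // !map_cat /= cnth.
  by rewrite -cat1s perm_catCA.
by rewrite (permPr us_split) perm_cons.
Qed.

Lemma tree_eqvE t u : tree_eqv t u = (canon t == canon u).
Proof.
elim/otree_nested_ind: t u => [[]|a ts IHts [|b us]] //=.
have -> : matching (map tree_eqv ts) us = perm_eq (map canon ts) (map canon us).
  apply: matchingE => y; elim: ts IHts => //= t ts IHts [IHt /IHts].
  by split.
by rewrite -perm_sort_leT; apply/andP/eqP => [[/eqP-> /eqP->]|[-> ->]].
Qed.

Lemma forest_eqvE ts us :
  forest_eqv ts us = perm_eq (map canon ts) (map canon us).
Proof.
by apply: matchingE => y; elim: ts => //= t ts IHts; rewrite tree_eqvE.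
Qed.

Lemma forest_eqvP ts us :
  reflect (exists2 vs, perm_eq vs us & all2 tree_eqv ts vs) (forest_eqv ts us).
Proof.
rewrite forest_eqvE; apply: (iffP idP) => [eq_tu | [vs /(perm_map canon)]].
  elim: ts us eq_tu => [|t ts IHts] us /= eq_tu.
    by exists [::] => //; case: us eq_tu => // u us /perm_size.
  have /mapP[u u_us tu] : canon t \in map canon us.
    by rewrite -(perm_mem eq_tu) mem_head.
  have us_split := perm_to_rem u_us.
  have := perm_trans eq_tu (perm_map canon us_split).
  rewrite /= tu perm_cons => /IHts[vs vs_us ts_vs].
  exists (u :: vs); last by rewrite /= tree_eqvE tu eqxx.
  by rewrite (permPr us_split) perm_cons.
move=> vs_us ts_vs; rewrite -(permPr vs_us); apply/permP => p; congr (count p _).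
by elim: ts vs ts_vs {vs_us} => [|t ts IHts] [|v vs] //= /andP[];
  rewrite tree_eqvE => /eqP-> /IHts->.
Qed.

Lemma tree_eqv_nodeP a b ts us :
  reflect (a = b /\ exists2 vs, perm_eq vs us & all2 tree_eqv ts vs)
          (tree_eqv (Node a ts) (Node b us)).
Proof. by apply: (iffP andP) => -[/eqP-> /forest_eqvP]. Qed.

Lemma forest_eqv_refl : reflexive forest_eqv.
Proof. by move=> s; rewrite forest_eqvE. Qed.

Lemma forest_eqv_sym : symmetric forest_eqv.
Proof. by move=> s1 s2; rewrite !forest_eqvE perm_sym. Qed.

Lemma forest_eqv_trans : transitive forest_eqv.
Proof. by move=> s2 s1 s3; rewrite !forest_eqvE; apply: perm_trans. Qed.

Fixpoint tree_holes t : nat :=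
  if t is Node _ s then sumn (map tree_holes s) else 1.

Definition forest_holes s : nat := sumn (map tree_holes s).

Fixpoint tree_subst (g : seq (otree Sigma)) t : seq (otree Sigma) :=
  if t is Node a s then [:: Node a (flatten (map (tree_subst g) s))] else g.

Definition forest_subst (h g : seq (otree Sigma)) : seq (otree Sigma) :=
  flatten (map (tree_subst g) h).

Lemma perm_sumn_map (f : otree Sigma -> nat) s1 s2 :
  perm_eq s1 s2 -> sumn (map f s1) = sumn (map f s2).
Proof. by move=> s12; rewrite (perm_sumn (perm_map f s12)). Qed.

Lemma tree_holes_canon t : tree_holes (canon t) = tree_holes t.
Proof.
elim/otree_nested_ind: t => //= a s IHs.
rewrite (@perm_sumn_map _ _ (map canon s)) ?perm_sort // -map_comp.
by elim: s IHs => //= t s IHs [-> /IHs ->].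
Qed.

Lemma forest_holes_eqv s1 s2 :
  forest_eqv s1 s2 -> forest_holes s1 = forest_holes s2.
Proof.
rewrite forest_eqvE => /(@perm_sumn_map tree_holes); rewrite -!map_comp.
by rewrite !(eq_map (tree_holes_canon : _ \o _ =1 _)).
Qed.

Lemma forest_holes_cat s1 s2 :
  forest_holes (s1 ++ s2) = forest_holes s1 + forest_holes s2.
Proof. by rewrite /forest_holes map_cat sumn_cat. Qed.

Lemma forest_holes_subst h g :
  forest_holes (forest_subst h g) = forest_holes h * forest_holes g.
Proof.
have Hflat s : All (fun t =>
    forest_holes (tree_subst g t) = tree_holes t * forest_holes g) s ->
    forest_holes (forest_subst s g) = forest_holes s * forest_holes g.
  rewrite /forest_subst; elim: s => //= t s IHs [IHt /IHs{}IHs].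
  by rewrite forest_holes_cat IHt IHs -mulnDl.
apply: (Hflat); have Htree t :
    forest_holes (tree_subst g t) = tree_holes t * forest_holes g.
  elim/otree_nested_ind: t => [|a s /Hflat IHs]; first by rewrite mul1n.
  by rewrite /forest_holes /= addn0.
by elim: h.
Qed.

Lemma perm_flatten (T : eqType) (ss1 ss2 : seq (seq T)) :
  perm_eq ss1 ss2 -> perm_eq (flatten ss1) (flatten ss2).
Proof.
move=> ss12; apply/permP => p; rewrite !count_flatten.
exact: perm_sumn (perm_map _ ss12).
Qed.

Lemma tree_subst_canon g1 g2 t : forest_eqv g1 g2 ->
  forest_eqv (tree_subst g1 t) (tree_subst g2 (canon t)).
Proof.
rewrite forest_eqvE => g12; elim/otree_nested_ind: t => [|a s IHs] /=.
  by rewrite forest_eqvE.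
rewrite forest_eqvE /=; set s1 := flatten _; set s2 := flatten _.
suff /eqP-> : sort leT (map canon s1) == sort leT (map canon s2) by [].
rewrite perm_sort_leT {}/s1 {}/s2.
have /permPr-> : perm_eq
    (map canon (flatten (map (tree_subst g2) (sort leT (map canon s)))))
    (map canon (flatten (map (tree_subst g2) (map canon s)))).
  by apply/perm_map/perm_flatten/perm_map; rewrite perm_sort.
elim: s IHs => //= t s IHs [IHt /IHs{}IHs].
by rewrite !map_cat perm_cat // -forest_eqvE.
Qed.

Lemma forest_subst_eqv h1 h2 g1 g2 : forest_eqv h1 h2 -> forest_eqv g1 g2 ->
  forest_eqv (forest_subst h1 g1) (forest_subst h2 g2).
Proof.
rewrite {1}forest_eqvE => h12 g12.
have canon_subst g h :
    forest_eqv (forest_subst h g) (forest_subst (map canon h) g).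
  rewrite /forest_subst forest_eqvE; elim: h => //= t h IHh.
  rewrite !map_cat perm_cat // -forest_eqvE.
  by apply: tree_subst_canon; apply: forest_eqv_refl.
apply: forest_eqv_trans (_ : forest_eqv (forest_subst h1 g2) _); last first.
  apply: forest_eqv_trans (canon_subst _ _) _.
  rewrite forest_eqv_sym; apply: forest_eqv_trans (canon_subst _ _) _.
  rewrite forest_eqvE perm_sym; apply/perm_map/perm_flatten/perm_map.
  exact: h12.
rewrite /forest_subst forest_eqvE; elim: h1 {h12} => //= t h IHh.
rewrite !map_cat perm_cat // -forest_eqvE.
apply: forest_eqv_trans (tree_subst_canon _ g12) _.
rewrite forest_eqv_sym; apply: tree_subst_canon; exact: forest_eqv_refl.
Qed.

End Eqv.

Canonical forest_equivRel (Sigma : countType) :=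
  EquivRel (@forest_eqv Sigma) (@forest_eqv_refl Sigma)
    (@forest_eqv_sym Sigma) (@forest_eqv_trans Sigma).

(* Unordered forests, with any number of holes. *)
Definition uforest (Sigma : countType) : Type := {eq_quot @forest_eqv Sigma}.
HB.instance Definition _ (Sigma : countType) := EqQuotient.on (uforest Sigma).
HB.instance Definition _ (Sigma : countType) := Choice.on (uforest Sigma).

Section UForest.

Variable Sigma : countType.
Local Notation piF := (\pi_(uforest Sigma)).
Implicit Types (x y g h : uforest Sigma) (s : seq (otree Sigma)).

Definition holes x : nat := forest_holes (repr x).
Definition uadd x y : uforest Sigma := piF (repr x ++ repr y).
Definition uroot (a : Sigma) x : uforest Sigma := piF [:: Node a (repr x)].
Definition usubst h g : uforest Sigma := piF (forest_subst (repr h) (repr g)).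

Lemma pi_eqv s1 s2 :
  piF s1 = piF s2 <-> forest_eqv s1 s2.
Proof. by split=> /eqmodP. Qed.

Lemma repr_eqv s : forest_eqv (repr (piF s)) s.
Proof. by apply/pi_eqv; rewrite reprK. Qed.

Lemma holes_pi s : holes (piF s) = forest_holes s.
Proof. exact/forest_holes_eqv/repr_eqv. Qed.

Lemma uadd_pi s1 s2 : uadd (piF s1) (piF s2) = piF (s1 ++ s2).
Proof.
apply/pi_eqv; rewrite forest_eqvE !map_cat.
by apply: perm_cat; rewrite -forest_eqvE repr_eqv.
Qed.

Lemma uroot_pi a s : uroot a (piF s) = piF [:: Node a s].
Proof.
apply/pi_eqv; rewrite forest_eqvE /=; have := repr_eqv s.
by rewrite forest_eqvE -perm_sort_leT => /eqP->.
Qed.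

Lemma usubst_pi s1 s2 : usubst (piF s1) (piF s2) = piF (forest_subst s1 s2).
Proof. by apply/pi_eqv/forest_subst_eqv; apply: repr_eqv. Qed.

Lemma holes_add x y : holes (uadd x y) = holes x + holes y.
Proof. by rewrite holes_pi forest_holes_cat. Qed.

Lemma holes_root a x : holes (uroot a x) = holes x.
Proof. by rewrite holes_pi /forest_holes /= addn0. Qed.

Lemma holes_subst h g : holes (usubst h g) = holes h * holes g.
Proof. by rewrite holes_pi forest_holes_subst. Qed.

End UForest.

(* The two-sorted algebra UCF; sorts are booleans: [false] is the sort of
   forests (type 0), [true] the sort of one-hole contexts (type 1). *)
Definition UCF (Sigma : countType) (b : bool) : Type :=
  {x : uforest Sigma | holes x == b}.

Section UCFOps.

Variable Sigma : countType.

Fact ucf_add_proof b c (bc : ~~ (b && c)) (x : UCF Sigma b) (y : UCF Sigma c) :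
  holes (uadd (val x) (val y)) == (b || c).
Proof.
rewrite holes_add (eqP (valP x)) (eqP (valP y)).
by case: b c bc {x y} => [] [].
Qed.

Fact ucf_root_proof a b (x : UCF Sigma b) : holes (uroot a (val x)) == b.
Proof. by rewrite holes_root (valP x). Qed.

Fact ucf_subst_proof b c (h : UCF Sigma b) (g : UCF Sigma c) :
  holes (usubst (val h) (val g)) == (b && c).
Proof. by rewrite holes_subst (eqP (valP h)) (eqP (valP g)) mulnb. Qed.

Definition ucf_add b c (bc : ~~ (b && c)) (x : UCF Sigma b) (y : UCF Sigma c) :
    UCF Sigma (b || c) :=
  exist _ (uadd (val x) (val y)) (ucf_add_proof bc x y).

Definition ucf_root a b (x : UCF Sigma b) : UCF Sigma b :=
  exist _ (uroot a (val x)) (ucf_root_proof a x).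

(* If [h] has no hole then [h[o := g]] is [h], of sort [false && c = false]. *)
Definition ucf_subst b c (h : UCF Sigma b) (g : UCF Sigma c) :
    UCF Sigma (b && c) :=
  exist _ (usubst (val h) (val g)) (ucf_subst_proof h g).

End UCFOps.

(* Well-typed terms over UCF, presenting the polynomial functions; the
   variables are the elements of [X], and [x : X] has sort [ty x]. *)
Inductive term (Sigma : countType) (X : Type) (ty : X -> bool) : bool -> Type :=
| Var x : term Sigma ty (ty x)
| Cst b of UCF Sigma b : term Sigma ty b
| Add b c of ~~ (b && c) & term Sigma ty b & term Sigma ty c :
    term Sigma ty (b || c)
| Root b of Sigma & term Sigma ty b : term Sigma ty b
| Subst b c of term Sigma ty b & term Sigma ty c : term Sigma ty (b && c).

Fixpoint eval (Sigma : countType) (X : Type) (ty : X -> bool)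
    (env : forall x, UCF Sigma (ty x)) (b : bool) (p : term Sigma ty b) :
    UCF Sigma b :=
  match p with
  | Var x => env x
  | Cst _ c => c
  | Add _ _ bc p1 p2 => ucf_add bc (eval env p1) (eval env p2)
  | Root _ a p1 => ucf_root a (eval env p1)
  | Subst _ _ p1 p2 => ucf_subst (eval env p1) (eval env p2)
  end.

Record signature := Signature { symbol :> finType; rank : symbol -> nat }.

Inductive ranked_tree (Gamma : signature) : Type :=
| RNode (a : Gamma) of 'I_(rank a) -> ranked_tree Gamma.

(* A rule [a(q_1, ..., q_k) -> q, f], with [f] presented by terms. The
   variable [(i, j)] of [f] stands for register [j] of child [i]. *)
Record rule (Sigma : countType) (Gamma : signature) (n : nat) (Q : finType)
    (ty : Q -> 'I_n -> bool) := Rule {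
  rule_symbol : Gamma;
  rule_source : 'I_(rank rule_symbol) -> Q;
  rule_target : Q;
  rule_update : forall j : 'I_n,
    @term Sigma ('I_(rank rule_symbol) * 'I_n)
      (fun x => ty (rule_source x.1) x.2) (ty rule_target j) }.

Arguments rule_source {Sigma Gamma n Q ty} r i.
Arguments rule_update {Sigma Gamma n Q ty} r j.

Record automaton (Sigma : countType) (Gamma : signature) := Automaton {
  nreg : nat;
  state : finType;
  reg_sort : state -> 'I_nreg -> bool;
  rules : seq (rule Sigma Gamma reg_sort);
  final : forall q : state, option {b : bool & term Sigma (reg_sort q) b} }.

Section Semantics.

Variables (Sigma : countType) (Gamma : signature).

Inductive run (M : automaton Sigma Gamma) :
    ranked_tree Gamma ->
    forall q : state M, (forall j, UCF Sigma (reg_sort q j)) -> Prop :=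
| Run (r : rule Sigma Gamma (@reg_sort _ _ M)) of List.In r (rules M) :
    forall (ts : 'I_(rank (rule_symbol r)) -> ranked_tree Gamma)
           (rs : forall i j, UCF Sigma (reg_sort (rule_source r i) j)),
    (forall i, run (ts i) (rs i)) ->
    run (RNode ts) (fun j => eval (fun x => rs x.1 x.2) (rule_update r j)).

(* The relation [[M]]; a value is an element of UCF tagged with its sort. *)
Definition semantics (M : automaton Sigma Gamma) (t : ranked_tree Gamma)
    (v : {b : bool & UCF Sigma b}) : Prop :=
  exists (q : state M) (rs : forall j, UCF Sigma (reg_sort q j))
         (b : bool) (f : term Sigma (reg_sort q) b),
  [/\ run t rs, final q = Some (existT _ b f) & v = existT _ b (eval rs f)].

Definition functional (M : automaton Sigma Gamma) : Prop :=
  forall t v v', semantics M t v -> semantics M t v' -> v = v'.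

Definition equivalent (M1 M2 : automaton Sigma Gamma) : Prop :=
  forall t v, semantics M1 t v <-> semantics M2 t v.

End Semantics.

(* Total recursive functions of several natural number arguments: the least
   class containing zero, successor and the projections, and closed under
   composition, primitive recursion and minimization of regular functions
   (those [g] such that for all [x] there is a [y] with [g (y, x) = 0]). *)
Inductive recursive : forall k, (k.-tuple nat -> nat) -> Prop :=
| rec_zero k (f : k.-tuple nat -> nat) :
    (forall x, f x = 0) -> recursive f
| rec_succ (f : 1.-tuple nat -> nat) :
    (forall x, f x = (thead x).+1) -> recursive f
| rec_proj k (i : 'I_k) (f : k.-tuple nat -> nat) :
    (forall x, f x = tnth x i) -> recursive f
| rec_comp k m (g : m.-tuple nat -> nat) (h : 'I_m -> k.-tuple nat -> nat)
    (f : k.-tuple nat -> nat) :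
    recursive g -> (forall i, recursive (h i)) ->
    (forall x, f x = g [tuple h i x | i < m]) -> recursive f
| rec_prim k (g : k.-tuple nat -> nat) (h : k.+2.-tuple nat -> nat)
    (f : k.+1.-tuple nat -> nat) :
    recursive g -> recursive h ->
    (forall x : k.-tuple nat, f [tuple of 0 :: x] = g x) ->
    (forall y (x : k.-tuple nat),
                 f [tuple of y.+1 :: x] =
                 h [tuple of y :: f [tuple of y :: x] :: x]) ->
    recursive f
| rec_min k (g : k.+1.-tuple nat -> nat) (f : k.-tuple nat -> nat) :
    recursive g ->
    (forall x : k.-tuple nat, g [tuple of f x :: x] = 0) ->
    (forall (x : k.-tuple nat) y, y < f x -> g [tuple of y :: x] <> 0) ->
    recursive f.

(* [n] is the truth value of [P], as computed by a decision procedure. *)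
Definition decides (n : nat) (P : Prop) : Prop :=
  (P -> n = 1) /\ (~ P -> n = 0).

(* Goedel numbering of automata. [CodeSeq.code] is a bijection from [seq nat]
   to [nat]; the elements of finite types are numbered by [enum_rank]. *)

Section Encoding.

Variable Sigma : finType.

Local Notation code := CodeSeq.code.
Local Notation number x := (nat_of_ord (enum_rank x)).

Fixpoint encode_otree (t : otree Sigma) : nat :=
  match t with
  | Hole => code [::]
  | Node a s => code (number a :: map encode_otree s)
  end.

(* A constant is given by an ordered representative; which one is immaterial. *)
Definition encode_ucf b (x : UCF Sigma b) : nat :=
  code (map encode_otree (repr (val x))).

Fixpoint encode_term (X : Type) (ty : X -> bool) (encode_var : X -> nat)
    (b : bool) (p : term Sigma ty b) : nat :=
  match p with
  | Var x => code [:: 0; encode_var x]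
  | Cst _ c => code [:: 1; encode_ucf c]
  | Add _ _ _ p1 p2 =>
      code [:: 2; encode_term encode_var p1; encode_term encode_var p2]
  | Root _ a p1 => code [:: 3; number a; encode_term encode_var p1]
  | Subst _ _ p1 p2 =>
      code [:: 4; encode_term encode_var p1; encode_term encode_var p2]
  end.

Definition encode_rule (Gamma : signature) n (Q : finType)
    (ty : Q -> 'I_n -> bool) (r : rule Sigma Gamma ty) : nat :=
  code
    [:: number (rule_symbol r);
        code [seq number (rule_source r i)
             | i <- enum 'I_(rank (rule_symbol r))];
        number (rule_target r);
        code [seq encode_term (fun x => code [:: val x.1; val x.2])
                              (rule_update r j) | j <- enum 'I_n]].

Definition encode_final n (ty : 'I_n -> bool)
    (f : option {b : bool & term Sigma ty b}) : nat :=
  code (if f is Some p then [:: encode_term (@nat_of_ord n) (projT2 p)]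
        else [::]).

Definition encode_signature (Gamma : signature) : nat :=
  code [seq rank a | a <- enum Gamma].

Definition encode (Gamma : signature) (M : automaton Sigma Gamma) : nat :=
  code
    [:: encode_signature Gamma;
        nreg M;
        code [seq code [seq nat_of_bool (reg_sort q j) | j <- enum 'I_(nreg M)]
             | q <- enum (state M)];
        code (map (@encode_rule _ _ _ _) (rules M));
        code [seq encode_final (final q) | q <- enum (state M)]].

End Encoding.

(* Main.v *)
(* Interpret a forest as a polynomial in x: the sum of forests becomes the product
   and root_a(f) becomes x f + c_a, where c_a is a multiple of a fixed prime.  By
   Eisenstein's criterion trees become irreducible polynomials, so that, by
   unique factorization, the interpretation is injective.  A context becomes an
   affine function of its hole, and all the operations become polynomial
   operations on the coefficients.  A register automaton thus turns into a
   system of polynomial updates, and both problems into the question whether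
   given equations hold at all the reachable register values.  For equality of
   domains, one automaton is determinized, its set of states being stored in
   registers that hold truth values.

   That question is decided by searching in parallel for a run that violates an
   equation and for an inductive invariant, i.e. finitely many polynomial
   equations for each state such that every rule preserves them.  If no
   equation is violated, such an invariant exists: take, by Hilbert's basis
   theorem, generators of the ideals of all polynomials that vanish on the
   reachable values.  A polynomial vanishing on a product of sets belongs, up to
   a nonzero factor in x, to the sum of the ideals of the factors, hence
   invariance of the equations is an identity between polynomials, which is
   checked at one Kronecker point. *)

(* Hilbert's theorem and classical choice only show that the search ends. What is computed is a test
   on codes, under a minimization for which mere existence of a witness is enough. The test stays
   within the natural numbers: x ranges over nat, register values are polynomials in x with
   coefficients in nat, and an integer polynomial u - v is kept as the pair of u and v. Hence all
   identities to be tested are arranged without subtraction. The nonzero factor in x arises because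
   the argument on products specializes polynomials at reachable values. These belong to Z[x], in
   which one cannot divide. The factor does no harm: Z[x] is a domain, and the factor is cancelled
   when a certificate is used. Functionality speaks of two runs on one input tree, so it becomes an
   equation on the product of the automaton with itself. Equivalence adds the inclusions between the
   domains. There the first automaton may still be nondeterministic, since every one of its runs has
   to be tested, whereas failure of all the runs of the second is visible only after
   determinization. *)
From Stdlib Require List.
Require Import Defs.
From mathcomp Require Import all_boot all_order all_algebra boolp qpoly generic_quotient zify ring.

Set Implicit Arguments.
Unset Strict Implicit.
Unset Printing Implicit Defensive.

Import Order.TTheory GRing.Theory Num.Theory.

(** * Closure properties of recursive functions *)

Notation code := CodeSeq.code.
Notation decode := CodeSeq.decode.

Section TupleRecursion.

Variable k : nat.
Implicit Types (f g : k.-tuple nat -> nat).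

Lemma recursive_nth i : recursive (fun x : k.-tuple nat => nth 0 x i).
Proof.
case: (ltnP i k) => [ik|ki].
  by apply: (@rec_proj _ (Ordinal ik)) => x; rewrite (tnth_nth 0).
by apply: rec_zero => x; rewrite nth_default // size_tuple.
Qed.

Lemma recursive_ext f g : recursive f -> f =1 g -> recursive g.
Proof.
move=> rf fg; apply: (rec_comp (h := fun i x => nth 0 x i)) rf _ _.
  by move=> i; apply: recursive_nth.
by move=> x; rewrite -fg; congr f; apply: eq_from_tnth => i;
  rewrite tnth_mktuple (tnth_nth 0).
Qed.

(** Arguments are lists read by [nth], which keeps tuple types out of the applications below. *)
Lemma recursive_comp_seq m (g : seq nat -> nat) (hs : seq (k.-tuple nat -> nat)) :
  recursive (fun t : m.-tuple nat => g t) -> size hs = m ->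
  (forall i, i < m -> recursive (nth (fun=> 0) hs i)) ->
  recursive (fun x => g [seq h x | h <- hs]).
Proof.
move=> rg sz rh; pose H (i : 'I_m) := nth (fun=> 0) hs i.
apply: (rec_comp (h := H) rg) => [i|x]; first exact: rh.
congr g; apply: (@eq_from_nth _ 0) => [|i]; first by rewrite size_map size_tuple.
rewrite size_map sz => im; rewrite (nth_map (fun=> 0)) ?sz //.
by rewrite -[i]/(nat_of_ord (Ordinal im)) -tnth_nth tnth_mktuple.
Qed.

End TupleRecursion.

Definition RF (f : nat -> nat) := recursive (fun t : 1.-tuple nat => f (nth 0 t 0)).
Definition R2 (f : nat -> nat -> nat) :=
  recursive (fun t : 2.-tuple nat => f (nth 0 t 0) (nth 0 t 1)).

Lemma recursive_comp1 k f (a : k.-tuple nat -> nat) :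
  RF f -> recursive a -> recursive (fun x => f (a x)).
Proof.
move=> rf ra; apply: (recursive_comp_seq (hs := [:: a]) (g := fun s => f (nth 0 s 0)) rf) => //.
by case.
Qed.

Lemma recursive_comp2 k f (a b : k.-tuple nat -> nat) :
  R2 f -> recursive a -> recursive b -> recursive (fun x => f (a x) (b x)).
Proof.
move=> rf ra rb.
apply: (recursive_comp_seq (hs := [:: a; b]) (g := fun s => f (nth 0 s 0) (nth 0 s 1)) rf) => //.
by case=> [|[]].
Qed.

Lemma RF_ext f g : RF f -> f =1 g -> RF g.
Proof. by move=> rf fg; apply: (recursive_ext rf) => t; apply: fg. Qed.

Lemma RF_id : RF (fun n => n).
Proof. exact: recursive_nth. Qed.

Lemma RF_comp f g : RF f -> RF g -> RF (fun e => f (g e)).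
Proof. exact: recursive_comp1. Qed.

Lemma RF_succ f : RF f -> RF (fun e => (f e).+1).
Proof.
apply: (@RF_comp S); apply: rec_succ => x.
by rewrite /thead (tnth_nth 0).
Qed.

Lemma RF_const c : RF (fun=> c).
Proof. by elim: c => [|c IHc]; [apply: rec_zero | apply: RF_succ]. Qed.

Lemma R2_add : R2 addn.
Proof.
apply: (rec_prim (recursive_nth 1 0) (h := fun x => (nth 0 x 1).+1)) => //.
exact: recursive_comp1 (RF_succ RF_id) (recursive_nth _ _).
Qed.

Lemma R2_mul : R2 muln.
Proof.
apply: (rec_prim (k := 1) (g := fun=> 0) (h := fun x => nth 0 x 1 + nth 0 x 2)) => //=.
- exact: rec_zero.
- exact: recursive_comp2 R2_add (recursive_nth _ _) (recursive_nth _ _).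
by move=> y x; rewrite mulSn addnC.
Qed.

Lemma RF_pred : RF predn.
Proof.
exact: (rec_prim (k := 0) (g := fun=> 0) (rec_zero _) (recursive_nth _ 0)).
Qed.

Lemma R2_sub : R2 subn.
Proof.
have R : R2 (fun a b => b - a).
  apply: (rec_prim (recursive_nth 1 0) (h := fun x => (nth 0 x 1).-1)) => //=.
  - exact: recursive_comp1 RF_pred (recursive_nth _ _).
  - by move=> x; rewrite subn0.
  - by move=> y x; rewrite subnS.
exact: recursive_comp2 R (recursive_nth _ 1) (recursive_nth _ 0).
Qed.

Lemma RF_add f g : RF f -> RF g -> RF (fun e => f e + g e).
Proof. exact: recursive_comp2 R2_add. Qed.
Lemma RF_mul f g : RF f -> RF g -> RF (fun e => f e * g e).
Proof. exact: recursive_comp2 R2_mul. Qed.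
Lemma RF_sub f g : RF f -> RF g -> RF (fun e => f e - g e).
Proof. exact: recursive_comp2 R2_sub. Qed.

Lemma RF_rect0 z h : R2 h -> RF (nat_rect (fun=> nat) z h).
Proof.
move=> rh; apply: (rec_prim (k := 0) (g := fun=> z) (h := fun x => h (nth 0 x 0) (nth 0 x 1))) => //.
apply: (recursive_comp1 (f := fun=> z) (a := fun=> 0)); first exact: RF_const.
exact: rec_zero.
Qed.

Lemma R2_iter h : RF h -> R2 (fun y x => iter y h x).
Proof.
move=> rh; apply: (rec_prim (recursive_nth 1 0) (h := fun x => h (nth 0 x 1))) => //.
exact: recursive_comp1 rh (recursive_nth _ _).
Qed.

Lemma RF_expn2 : RF (expn 2).
Proof.
apply: (RF_ext (f := fun n => iter n (muln 2) 1)) => [|n].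
  apply: (@recursive_comp2 _ (fun y x => iter y (muln 2) x)) (recursive_nth _ 0) _.
    by apply: R2_iter; apply: RF_mul (RF_const 2) RF_id.
  exact: RF_const 1.
by elim: n => //= n ->; rewrite expnS.
Qed.

Lemma RF_odd : RF odd.
Proof.
apply: (RF_ext (f := nat_rect (fun=> nat) 0 (fun _ b => 1 - b))) => [|n].
  apply: RF_rect0; apply: (recursive_comp2 R2_sub _ (recursive_nth _ 1)).
  exact: recursive_comp1 (RF_const 1) (recursive_nth _ 0).
by elim: n => //= n ->; case: odd.
Qed.

Lemma RF_half : RF half.
Proof.
apply: (RF_ext (f := nat_rect (fun=> nat) 0 (fun n h => odd n + h))) => [|n].
  apply: RF_rect0; apply: (recursive_comp2 R2_add _ (recursive_nth _ 1)).
  exact: recursive_comp1 RF_odd (recursive_nth _ 0).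
by elim: n => //= n ->; rewrite uphalf_half.
Qed.

(** Every positive number is uniquely of this form and [code] iterates it, starting from 0 for the
    empty list. Thus [hd] is the exponent of 2, and both [hd] and [tl] are 0 at 0. *)
Definition pcons a b := 2 ^ a * b.*2.+1.
Definition hd n := head 0 (decode n).
Definition tl n := code (behead (decode n)).

Lemma code_cons a s : code (a :: s) = pcons a (code s). Proof. by []. Qed.

Lemma decode_pcons a b : decode (pcons a b) = a :: decode b.
Proof. by rewrite -{1}(CodeSeq.decodeK b) -code_cons CodeSeq.codeK. Qed.

Lemma hd_pcons a b : hd (pcons a b) = a. Proof. by rewrite /hd decode_pcons. Qed.
Lemma tl_pcons a b : tl (pcons a b) = b.
Proof. by rewrite /tl decode_pcons CodeSeq.decodeK. Qed.

Lemma iter_half_pcons y a b : y <= a -> iter y half (pcons a b) = pcons (a - y) b.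
Proof.
elim: y => [|y IHy] ya; first by rewrite subn0.
rewrite iterS IHy ?(ltnW ya) // /pcons -subnSK // expnS -mulnA mul2n.
by rewrite doubleK.
Qed.

Lemma hd_least n : iter (hd n) half n = (tl n).*2.+1 \/ n = 0.
Proof.
case: n => [|n]; [by right | left].
have [a [s E]] : exists a s, decode n.+1 = a :: s.
  case E : (decode n.+1) => [|a s]; last by exists a, s.
  by have := CodeSeq.decodeK n.+1; rewrite E.
rewrite /hd /tl E -(CodeSeq.decodeK n.+1) E /= -[_ * _]/(pcons _ _).
by rewrite iter_half_pcons // subnn /pcons mul1n.
Qed.

(** Minimization: the exponent of 2 is the least number of halvings that leads to an odd number. The
    factor [n] in [g] makes the search stop at once for [n = 0], which has no odd half. *)
Lemma RF_hd : RF hd.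
Proof.
pose g (y n : nat) := n * (1 - odd (iter y half n)).
have rg : R2 g.
  apply: (recursive_comp2 R2_mul (recursive_nth _ 1)).
  apply: (recursive_comp2 R2_sub).
    exact: recursive_comp1 (RF_const 1) (recursive_nth _ 0).
  apply: (recursive_comp1 RF_odd).
  exact: recursive_comp2 (R2_iter RF_half) (recursive_nth _ 0) (recursive_nth _ 1).
apply: (rec_min rg) => [x|x y] /=.
  rewrite /g; case: (hd_least (nth 0 x 0)) => [->|->] //=.
  by rewrite odd_double muln0.
move=> lt_y; rewrite /g; set n := nth 0 x 0 in lt_y *.
have n0 : n != 0 by apply: contraTneq lt_y => ->; rewrite ltn0.
have -> : odd (iter y half n) = false; last by rewrite muln1; apply/eqP.
have [a [s E]] : exists a s, decode n = a :: s.
  case E : (decode n) => [|a s]; last by exists a, s.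
  by move: n0; rewrite -(CodeSeq.decodeK n) E.
move: lt_y; rewrite /hd E /= => lt_y.
rewrite -(CodeSeq.decodeK n) E /= -[_ * _]/(pcons _ _) iter_half_pcons 1?ltnW //.
by rewrite -subnSK // /pcons expnS -mulnA oddM.
Qed.

Lemma RF_tl : RF tl.
Proof.
apply: (RF_ext (f := fun n => half (iter (hd n) half n))) => [|n].
  apply: (RF_comp RF_half).
  exact: recursive_comp2 (R2_iter RF_half) RF_hd RF_id.
case: (hd_least n) => [->|-> //]; by rewrite -[_.+1]/(true + _) half_bit_double.
Qed.

Lemma R2_pcons : R2 pcons.
Proof.
apply: (recursive_comp2 R2_mul).
  exact: recursive_comp1 RF_expn2 (recursive_nth _ _).
apply: (@recursive_comp1 _ (fun b => b.*2.+1)); last exact: recursive_nth.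
apply: RF_succ; apply: (RF_ext (RF_add RF_id RF_id)) => n; exact: addnn.
Qed.

Lemma RF_pcons f g : RF f -> RF g -> RF (fun e => pcons (f e) (g e)).
Proof. exact: recursive_comp2 R2_pcons. Qed.

(* A function of several arguments is handled as a unary function of the
   packed argument [pcons a (pcons b ...)]; the free variable [e] of a binder
   is found below the bound ones. *)
Lemma RF_rect (n z : nat -> nat) (h : nat -> nat -> nat -> nat) :
  RF n -> RF z -> RF (fun u => h (tl (tl u)) (hd u) (hd (tl u))) ->
  RF (fun e => nat_rect (fun=> nat) (z e) (h e) (n e)).
Proof.
move=> rn rz rh.
apply: (recursive_comp2 (f := fun y e => nat_rect (fun=> nat) (z e) (h e) y) _ rn RF_id).
apply: (rec_prim (h := fun x => h (nth 0 x 2) (nth 0 x 0) (nth 0 x 1)) rz) => //.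
set H := fun u => _ in rh.
have H_E x : H (pcons (nth 0 x 0) (pcons (nth 0 x 1) (nth 0 x 2)))
      = h (nth 0 x 2) (nth 0 x 0) (nth 0 x 1).
  by rewrite /H !(tl_pcons, hd_pcons).
apply: (recursive_ext (f := fun x : 3.-tuple nat =>
    H (pcons (nth 0 x 0) (pcons (nth 0 x 1) (nth 0 x 2))))) => // .
apply: recursive_comp1 rh _; apply: (recursive_comp2 R2_pcons (recursive_nth _ _)).
exact: recursive_comp2 R2_pcons (recursive_nth _ _) (recursive_nth _ _).
Qed.

(** * Recursive functions with values in lists and booleans *)

Definition RL (f : nat -> seq nat) := RF (fun e => code (f e)).
Definition RB (f : nat -> bool) := RF (fun e => nat_of_bool (f e)).

Lemma RF_decode f : RF f -> RL (fun e => decode (f e)).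
Proof. by move=> rf; apply: (RF_ext rf) => e; rewrite CodeSeq.decodeK. Qed.

Lemma RF_code f : RL f -> RF (fun e => code (f e)). Proof. by []. Qed.

Lemma RL_const s : RL (fun=> s). Proof. exact: RF_const. Qed.
Lemma RB_const b : RB (fun=> b). Proof. exact: RF_const. Qed.

Lemma RF_bool f : RB f -> RF (fun e => nat_of_bool (f e)). Proof. by []. Qed.

Lemma RL_cons f s : RF f -> RL s -> RL (fun e => f e :: s e).
Proof. exact: RF_pcons. Qed.

Lemma RF_head s : RL s -> RF (fun e => head 0 (s e)).
Proof. by move/(RF_comp RF_hd)/RF_ext; apply=> e; rewrite /hd CodeSeq.codeK. Qed.

Lemma RL_behead s : RL s -> RL (fun e => behead (s e)).
Proof. by move/(RF_comp RF_tl)/RF_ext; apply=> e; rewrite /tl CodeSeq.codeK. Qed.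

Lemma RL_rect n z h :
  RF n -> RL z -> RL (fun u => h (tl (tl u)) (hd u) (decode (hd (tl u)))) ->
  RL (fun e => nat_rect (fun=> seq nat) (z e) (h e) (n e)).
Proof.
move=> rn rz rh; apply: (RF_ext (RF_rect rn rz (h := fun e y ih => code (h e y (decode ih))) rh)).
by move=> e; elim: (n e) => //= y ->; rewrite CodeSeq.codeK.
Qed.

Lemma RL_iter n z h :
  RF n -> RL z -> RL (fun u => h (tl u) (decode (hd u))) ->
  RL (fun e => iter (n e) (h e) (z e)).
Proof.
move=> rn rz rh.
have rs : RF (fun u => pcons (hd (tl u)) (tl (tl u))).
  by apply: RF_pcons; [apply: RF_comp RF_hd RF_tl | apply: RF_comp RF_tl RF_tl].
have rh' := RF_comp rh rs.
apply: (RF_ext (RL_rect rn rz (h := fun e _ ih => h e ih) _)).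
  by apply: (RF_ext rh') => u /=; rewrite tl_pcons hd_pcons.
by move=> e; elim: (n e) => //= y ->.
Qed.

Lemma RB_eq f g : RF f -> RF g -> RB (fun e => f e == g e).
Proof.
move=> rf rg; apply: (RF_ext (f := fun e => 1 - ((f e - g e) + (g e - f e)))).
  by apply: RF_sub (RF_const 1) (RF_add (RF_sub rf rg) (RF_sub rg rf)).
by move=> e; lia.
Qed.

Lemma RB_leq f g : RF f -> RF g -> RB (fun e => f e <= g e).
Proof. by move=> rf rg; apply: RB_eq (RF_sub rf rg) (RF_const 0). Qed.

Lemma RB_neg b : RB b -> RB (fun e => ~~ b e).
Proof.
by move=> rb; apply: (RF_ext (RF_sub (RF_const 1) rb)) => e; case: (b e).
Qed.

Lemma RB_and b c : RB b -> RB c -> RB (fun e => b e && c e).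
Proof. by move=> rb rc; apply: (RF_ext (RF_mul rb rc)) => e; rewrite mulnb. Qed.

Lemma RB_or b c : RB b -> RB c -> RB (fun e => b e || c e).
Proof.
move=> rb rc; apply: (RF_ext (RB_neg (RB_and (RB_neg rb) (RB_neg rc)))) => e.
by case: (b e) (c e) => [] [].
Qed.

Lemma RB_imp b c : RB b -> RB c -> RB (fun e => b e ==> c e).
Proof.
move=> rb rc; apply: (RF_ext (RB_or (RB_neg rb) rc)) => e.
by case: (b e) (c e) => [] [].
Qed.

Lemma RF_if b f g : RB b -> RF f -> RF g -> RF (fun e => if b e then f e else g e).
Proof.
move=> rb rf rg; apply: (RF_ext (f := fun e => b e * f e + ~~ b e * g e)).
  by apply: RF_add; apply: RF_mul => //; apply: RB_neg.
by move=> e; case: (b e); lia.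
Qed.

Lemma RL_if b s t : RB b -> RL s -> RL t -> RL (fun e => if b e then s e else t e).
Proof.
move=> rb rf rg; apply: (RF_ext (RF_if rb rf rg)) => e; by case: (b e).
Qed.

Lemma RL_ext s t : RL s -> s =1 t -> RL t.
Proof. by move=> rs st; apply: (RF_ext rs) => e; rewrite st. Qed.

Lemma RL_comp s f : RL s -> RF f -> RL (fun e => s (f e)).
Proof. by move=> rs rf; apply: (RF_comp (f := fun e => code (s e))). Qed.

(** The code of a list may thus serve as the number of iterations of a loop over the list. *)
Lemma size_code s : size s <= code s.
Proof.
elim: s => //= a s IHs; rewrite -[(size s).+1]mul1n leq_mul ?expn_gt0 // ltnS.
by apply: leq_trans IHs _; rewrite -addnn leq_addr.
Qed.

Lemma RF_foldl s z f :
  RL s -> RF z -> RF (fun u => f (tl (tl u)) (hd (tl u)) (hd u)) ->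
  RF (fun e => foldl (f e) (z e) (s e)).
Proof.
move=> rs rz rf.
(* The state is the accumulator followed by the items still to be read. It is stationary once they
   are exhausted, so that iterating too often is harmless. *)
pose step e (t : seq nat) :=
  if behead t == [::] then t else f e (head 0 t) (head 0 (behead t)) :: behead (behead t).
have rt : RL (fun u => decode (hd u)) by apply: RF_decode RF_hd.
have rt' := RL_behead rt; have rt'' := RL_behead rt'.
have r_step : RL (fun u => step (tl u) (decode (hd u))).
  apply: RL_if => //; last apply: RL_cons rt''.
    apply: (RF_ext (RB_eq rt' (RF_const 0))) => u; case: behead => //= a s'.
    by rewrite muln_eq0 expn_eq0.
  have := RF_comp rf (RF_pcons (RF_head rt') (RF_pcons (RF_head rt) RF_tl)).
  by move/RF_ext; apply=> u; rewrite !(tl_pcons, hd_pcons).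
have := RF_head (RL_iter rs (RL_cons rz rs) r_step).
move/RF_ext; apply=> e; have := size_code (s e).
move: (code (s e)) => n; elim: (s e) (z e) n => [|a s' IHs] z' n /= le_n.
  suff -> : iter n (step e) [:: z'] = [:: z'] by [].
  by elim: n {le_n} => //= n ->.
by case: n le_n => // n; rewrite ltnS iterSr; apply: IHs.
Qed.

Lemma RL_rev s : RL s -> RL (fun e => rev (s e)).
Proof.
move=> rs; have := RF_foldl (f := fun _ acc a => pcons a acc) rs (RF_const 0).
move/(_ (RF_pcons RF_hd (RF_comp RF_hd RF_tl)))/RF_ext; apply=> e.
rewrite /rev -[0]/(code [::]); elim: (s e) [::] => //= a s' IHs t.
by rewrite -IHs.
Qed.

Lemma RF_foldr s z f :
  RL s -> RF z -> RF (fun u => f (tl (tl u)) (hd u) (hd (tl u))) ->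
  RF (fun e => foldr (f e) (z e) (s e)).
Proof.
move=> rs rz rf; apply: (RF_ext (RF_foldl (f := fun e acc a => f e a acc) (RL_rev rs) rz rf)).
by move=> e; rewrite foldl_rev.
Qed.

Lemma RL_foldr s z f :
  RL s -> RL z -> RL (fun u => f (tl (tl u)) (hd u) (decode (hd (tl u)))) ->
  RL (fun e => foldr (f e) (z e) (s e)).
Proof.
move=> rs rz rf.
apply: (RF_ext (RF_foldr (f := fun e a acc => code (f e a (decode acc))) rs rz rf)).
by move=> e; elim: (s e) => //= a s' ->; rewrite CodeSeq.codeK.
Qed.

(** Weakening of packed arguments: a fold binds an item and an accumulator, whereas [f] knows the
    item only. *)
Lemma RF_shift (f : nat -> nat -> nat) :
  RF (fun u => f (tl u) (hd u)) -> RF (fun u => f (tl (tl u)) (hd u)).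
Proof.
move=> rf; have := RF_comp rf (RF_pcons RF_hd (RF_comp RF_tl RF_tl)).
by move/RF_ext; apply=> u; rewrite tl_pcons hd_pcons.
Qed.

Lemma RL_cat s t : RL s -> RL t -> RL (fun e => s e ++ t e).
Proof.
move=> rs rt; apply: (RL_ext (RL_foldr (f := fun _ a acc => a :: acc) rs rt _)).
  by apply: RL_cons RF_hd (RF_decode (RF_comp RF_hd RF_tl)).
by move=> e; elim: (s e) => //= a s' ->.
Qed.

Lemma RL_map s f : RL s -> RF (fun u => f (tl u) (hd u)) ->
  RL (fun e => [seq f e y | y <- s e]).
Proof.
move=> rs rf; apply: (RL_ext (RL_foldr (f := fun e a acc => f e a :: acc) rs (RL_const [::]) _)).
  by apply: RL_cons (RF_shift rf) (RF_decode (RF_comp RF_hd RF_tl)).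
by move=> e; elim: (s e) => //= a s' ->.
Qed.

Lemma RL_flatten_map s f : RL s -> RL (fun u => f (tl u) (hd u)) ->
  RL (fun e => flatten [seq f e y | y <- s e]).
Proof.
move=> rs rf; apply: (RL_ext (RL_foldr (f := fun e a acc => f e a ++ acc) rs (RL_const [::]) _)).
  by apply: RL_cat (RF_shift (f := fun e y => code (f e y)) rf) (RF_decode (RF_comp RF_hd RF_tl)).
by move=> e; elim: (s e) => //= a s' ->.
Qed.

Lemma RF_size s : RL s -> RF (fun e => size (s e)).
Proof.
move=> rs; have := RF_foldr (f := fun _ _ n => n.+1) rs (RF_const 0).
move/(_ (RF_succ (RF_comp RF_hd RF_tl)))/RF_ext; apply=> e.
by elim: (s e) => //= a s' ->.
Qed.

Lemma RF_sumn s : RL s -> RF (fun e => sumn (s e)).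
Proof.
move=> rs; have := RF_foldr (f := fun _ a n => a + n) rs (RF_const 0).
by move/(_ (RF_add RF_hd (RF_comp RF_hd RF_tl))).
Qed.

Lemma RF_nth s n : RL s -> RF n -> RF (fun e => nth 0 (s e) (n e)).
Proof.
move=> rs rn; have := RF_head (RL_iter rn rs (h := fun=> behead) (RL_behead (RF_decode RF_hd))).
move/RF_ext; apply=> e; elim: (n e) (s e) => [|m IHm] [|a t] //=.
  by rewrite -iterS iterSr /= -[X in _ = X](nth_nil 0 m) -IHm.
by rewrite -iterS iterSr /= IHm.
Qed.

Lemma RL_iota n : RF n -> RL (fun e => iota 0 (n e)).
Proof.
move=> rn; apply: (RL_ext (RL_rect (h := fun _ y t => t ++ [:: y]) rn (RL_const [::]) _)).
  apply: RL_cat (RF_decode (RF_comp RF_hd RF_tl)) (RL_cons RF_hd (RL_const [::])).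
by move=> e; elim: (n e) => //= m ->; rewrite -[0 :: _]/(iota 0 m.+1) -[in RHS]addn1 iotaD.
Qed.

Lemma RL_mkseq n f : RF n -> RF (fun u => f (tl u) (hd u)) ->
  RL (fun e => mkseq (f e) (n e)).
Proof. by move=> rn rf; apply: RL_map (RL_iota rn) rf. Qed.

Lemma RB_all s (b : nat -> pred nat) : RL s -> RB (fun u => b (tl u) (hd u)) ->
  RB (fun e => all (b e) (s e)).
Proof.
move=> rs rb; apply: (RF_ext (RF_foldr (f := fun e a n => b e a * n) rs (RF_const 1) _)).
  by apply: RF_mul (RF_shift (f := fun e y => b e y) rb) (RF_comp RF_hd RF_tl).
by move=> e; elim: (s e) => //= a s' ->; rewrite mulnb.
Qed.

Lemma RB_has s (b : nat -> pred nat) : RL s -> RB (fun u => b (tl u) (hd u)) ->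
  RB (fun e => has (b e) (s e)).
Proof.
move=> rs rb.
apply: (RF_ext (RB_neg (RB_all (b := fun e y => ~~ b e y) rs (RB_neg rb)))) => e.
by rewrite -has_predC; congr nat_of_bool; apply: eq_has => y /=; rewrite negbK.
Qed.

(** * Course-of-values recursion on codes *)

Lemma decode_lt n c : c \in decode n -> c < n.
Proof. by move=> cn; rewrite -(CodeSeq.decodeK n); apply: (allP (CodeSeq.ltn_code _)). Qed.

Section CourseOfValues.

Variable F : nat -> seq nat -> nat.

(** The table of the values at [n - 1], ..., 0, in this order: the value at [c] is in position
    [(n - c).-1]. *)
Fixpoint ctab n : seq nat :=
  if n is n'.+1 then
    F n' [seq nth 0 (ctab n') (n' - c).-1 | c <- decode n'] :: ctab n'
  else [::].

(** Locked, lest simplification unfold the table for a given code. *)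
Definition cfold n := locked (head 0 (ctab n.+1)).

Lemma cfold_ctab n : cfold n = head 0 (ctab n.+1).
Proof. by rewrite /cfold -lock. Qed.

Lemma nth_ctab n c : c < n -> nth 0 (ctab n) (n - c).-1 = cfold c.
Proof.
elim: n => // n IHn; rewrite ltnS leq_eqVlt => /predU1P[->|cn].
  by rewrite subSnn cfold_ctab.
by rewrite -IHn //; have -> : (n.+1 - c).-1 = (n - c).-1.+1 by lia.
Qed.

Lemma cfoldE n : cfold n = F n [seq cfold c | c <- decode n].
Proof.
by rewrite cfold_ctab; congr F; apply/eq_in_map => c /decode_lt; apply: nth_ctab.
Qed.

Lemma cfold_code s : cfold (code s) = F (code s) [seq cfold c | c <- s].
Proof. by rewrite cfoldE CodeSeq.codeK. Qed.

End CourseOfValues.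

Lemma RF_cfold F n : RF n ->
  RF (fun u => F (tl (tl u)) (hd u) (decode (hd (tl u)))) ->
  RF (fun e => cfold (F e) (n e)).
Proof.
move=> rn rF.
suff : RF (fun e => head 0 (ctab (F e) (n e).+1)).
  by move/RF_ext; apply=> e; rewrite cfold_ctab.
apply: RF_head.
have r2 f : RF f -> RF (fun e => hd (f e)) /\ RF (fun e => tl (f e)).
  by move=> rf; split; [apply: RF_comp RF_hd rf | apply: RF_comp RF_tl rf].
pose h e y ih := F e y [seq nth 0 ih (y - c).-1 | c <- decode y] :: ih.
apply: (RL_ext (RL_rect (h := h) (RF_succ rn) (RL_const [::]) _)) => [|e]; last first.
  by elim: (n e).+1 => //= y ->.
have [r0 r1] := r2 _ RF_id; have [r10 r11] := r2 _ r1.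
apply: RL_cons; last exact: RF_decode r10.
pose h' u := code [seq nth 0 (decode (hd (tl u))) (hd u - c).-1 | c <- decode (hd u)].
have rh' : RF h'.
  have r_tl2 : RF (fun u => hd (tl (tl u))) by apply: RF_comp RF_hd (RF_comp RF_tl RF_tl).
  apply: (RL_map (s := fun u => decode (hd u))
    (f := fun u c => nth 0 (decode (hd (tl u))) (hd u - c).-1)).
    exact: RF_decode.
  apply: RF_nth; first exact: RF_decode.
  by apply: (RF_comp RF_pred); apply: RF_sub r0; apply: RF_comp RF_hd r1.
have := RF_comp rF (RF_pcons r0 (RF_pcons rh' r11)).
by move/RF_ext; apply=> u; rewrite !(tl_pcons, hd_pcons) CodeSeq.codeK.
Qed.

(** * Polynomial systems, their refutations and certificates *)

Arguments CodeSeq.code : simpl never.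

Lemma RF_hd' f : RF f -> RF (fun e => hd (f e)). Proof. exact: RF_comp RF_hd. Qed.
Lemma RF_tl' f : RF f -> RF (fun e => tl (f e)). Proof. exact: RF_comp RF_tl. Qed.

(** A missing field reads 0 and every number is the code of a list, so the checkers below are total,
    whatever they are given. *)
Definition fld n i := nth 0 (decode n) i.
Definition dl n i := decode (fld n i).

Lemma RF_fld n i : RF n -> RF i -> RF (fun e => fld (n e) (i e)).
Proof. by move=> rn; apply: RF_nth; apply: RF_decode. Qed.

Lemma RL_dl n i : RF n -> RF i -> RL (fun e => dl (n e) (i e)).
Proof. by move=> rn ri; apply/RF_decode/RF_fld. Qed.

(** A hook for the closure lemmas of newly defined functions; it is redefined as these become
    available. *)
Ltac rf_user := fail.
Ltac rf_step :=
  cbv beta;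
  first [ assumption
  | match goal with
    | H : RF ?m |- RF (fun e => ?m (@?g e)) => apply (RF_comp H)
    | H : RL ?m |- RL (fun e => ?m (@?g e)) => apply (RL_comp H)
    end
  | simple apply RF_const | simple apply RL_const | simple apply RB_const
  | simple apply RF_id
  | simple apply RF_hd' | simple apply RF_tl'
  | rf_user
  | simple apply RL_dl | simple apply RF_fld
  | simple apply RF_nth | simple apply RF_head | simple apply RL_behead
  | simple apply RF_size | simple apply RF_sumn
  | simple apply RF_decode | simple apply RF_bool | simple apply RF_code
  | simple apply RL_cons | simple apply RL_cat
  | simple apply RL_flatten_map
  | simple apply RL_mkseq | simple apply RL_iota
  | simple apply RL_map
  | simple apply RB_all | simple apply RB_has
  | simple apply RF_cfold
  | simple apply RF_foldr | simple apply RL_iter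
  | simple apply RF_if | simple apply RL_if
  | simple apply RB_leq | simple apply RB_eq
  | simple apply RB_neg | simple apply RB_and | simple apply RB_or | simple apply RB_imp
  | simple apply RF_succ | simple apply RF_add | simple apply RF_mul | simple apply RF_sub
  ].
Ltac rf := repeat rf_step.

(* Polynomials over nat in the variables 0, 1, ..., as codes: [:: 0; c] is a
   constant, [:: 1; i] a variable, and 2 and 3 tag sums and products.  Every
   number is the code of some polynomial. *)
Definition ev_step (E : seq nat) n (L : seq nat) : nat :=
  if fld n 0 == 1 then nth 0 E (fld n 1)
  else if fld n 0 == 2 then nth 0 L 1 + nth 0 L 2
  else if fld n 0 == 3 then nth 0 L 1 * nth 0 L 2
  else fld n 1.

Definition ev E n := cfold (ev_step E) n.

Lemma RF_ev E n : RL E -> RF n -> RF (fun e => ev (E e) (n e)).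
Proof. by move=> rE rn; rewrite /ev /ev_step; rf. Qed.

(* A system is [:: m; rules; finals], a rule [:: target; sources; updates] and
   a final equation [:: state; u; v].  Every state has m registers.  In an
   update, variable 0 is a global parameter and variable 1 + i * m + j is
   register j of child i; in u and v, variable 1 + j is register j. *)
Definition updates m r E := mkseq (fun j => ev E (nth 0 (dl r 2) j)) m.

(** The environment in which an equation about the state of child [i] is evaluated: the parameter,
    then the registers of that child alone. *)
Definition block m E i := nth 0 E 0 :: mkseq (fun j => nth 0 E (1 + i * m + j)) m.

(* The code of a run lists the index of the last rule, then the subruns.  The
   result is [:: is it a run?; state; registers]. *)
Definition run_step s x w (L : seq nat) : nat :=
  let rules := dl s 1 in
  let r := nth 0 rules (fld w 0) in
  let kids := behead L in
  code [:: nat_of_bool [&& fld w 0 < size rules, size kids == size (dl r 1)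
                  & all (fun i => (fld (nth 0 kids i) 0 == 1) &&
                                  (fld (nth 0 kids i) 1 == nth 0 (dl r 1) i))
                        (iota 0 (size (dl r 1)))];
          fld r 0;
          code (updates (fld s 0) r (x :: flatten [seq dl c 2 | c <- kids]))].

Definition run_value s x w := cfold (run_step s x) w.

(* [y] is [:: run; parameter; index of a violated final equation]. *)
Definition refutes s y : bool :=
  let x := fld y 1 in
  let res := run_value s x (fld y 0) in
  let f := nth 0 (dl s 2) (fld y 2) in
  [&& fld y 2 < size (dl s 2), fld res 0 == 1, fld res 1 == fld f 0
    & ev (x :: dl res 2) (fld f 1) != ev (x :: dl res 2) (fld f 2)].

Definition listed y q u v : bool :=
  has (fun it => [&& fld it 0 == q, fld it 1 == u & fld it 2 == v]) (decode y).

(* With pf = [:: c; c'; x0; combos] and combos made of [:: h; i; u'; v'], the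
   equality of [side .. u v 3] and [side .. v u 2] is the identity
   (c - c') * (u - v)(updates) = \sum h * (u' - v')(child i)
   rearranged so as to avoid subtraction. *)
Definition side m r pf a b z E : nat :=
  let x := nth 0 E 0 in
  ev [:: x] (fld pf 0) * ev (x :: updates m r E) a +
  ev [:: x] (fld pf 1) * ev (x :: updates m r E) b +
  sumn [seq ev E (fld c 0) * ev (block m E (fld c 1)) (fld c z) | c <- dl pf 3].

(** The point is built from its last coordinate. Each new coordinate exceeds [A] and [B] at the
    point completed by ones, hence all the coefficients that will be read as digits in that base. *)
Definition kpoint (A B : seq nat -> nat) N : seq nat :=
  nat_rect (fun=> seq nat) [::]
    (fun j t => let E := iter (N - j) (cons 1) t in (A E + B E).+1 :: t) N.

(* [c <> c'] is witnessed by the value [x0] of the parameter. *)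
Definition inductive_proof s y r u v pf : bool :=
  let A := side (fld s 0) r pf u v 3 in
  let B := side (fld s 0) r pf v u 2 in
  let E := kpoint A B (size (dl r 1) * fld s 0).+1 in
  [&& ev [:: fld pf 2] (fld pf 0) != ev [:: fld pf 2] (fld pf 1),
      all (fun c => (fld c 1 < size (dl r 1)) &&
                    listed y (nth 0 (dl r 1) (fld c 1)) (fld c 2) (fld c 3)) (dl pf 3)
    & A E == B E].

(* [y] lists equations [:: state; u; v; one proof per rule]. *)
Definition certifies s y : bool :=
  all (fun it => all (fun i =>
         (fld (nth 0 (dl s 1) i) 0 == fld it 0) ==>
         inductive_proof s y (nth 0 (dl s 1) i) (fld it 1) (fld it 2) (nth 0 (dl it 3) i))
       (iota 0 (size (dl s 1)))) (decode y) &&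
  all (fun f => listed y (fld f 0) (fld f 1) (fld f 2)) (dl s 2).

Ltac rf_user ::= simple apply RF_ev.

Lemma RL_updates m r E : RF m -> RF r -> RL E ->
  RL (fun e => updates (m e) (r e) (E e)).
Proof. by move=> rm rr rE; rewrite /updates; rf. Qed.

Lemma RL_block m E i : RF m -> RL E -> RF i -> RL (fun e => block (m e) (E e) (i e)).
Proof. by move=> rm rE ri; rewrite /block; rf. Qed.

Ltac rf_user ::= first [simple apply RF_ev | simple apply RL_updates | simple apply RL_block].

Lemma RF_run_value s x w : RF s -> RF x -> RF w -> RF (fun e => run_value (s e) (x e) (w e)).
Proof. by move=> rs rx rw; rewrite /run_value /run_step; cbv zeta; rf. Qed.

Lemma RB_listed y q u v : RF y -> RF q -> RF u -> RF v ->
  RB (fun e => listed (y e) (q e) (u e) (v e)).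
Proof. by move=> ry rq ru rv; rewrite /listed; rf. Qed.

Lemma RF_side m r pf a b z E : RF m -> RF r -> RF pf -> RF a -> RF b -> RF z -> RL E ->
  RF (fun e => side (m e) (r e) (pf e) (a e) (b e) (z e) (E e)).
Proof. by move=> *; rewrite /side; rf. Qed.

Lemma RL_kpoint A B N :
  RF (fun u => A (tl u) (decode (hd u))) -> RF (fun u => B (tl u) (decode (hd u))) ->
  RF N -> RL (fun e => kpoint (A e) (B e) (N e)).
Proof.
move=> rA rB rN; rewrite /kpoint.
apply: RL_rect => //; first exact: RL_const; cbv beta zeta.
have rE : RL (fun u => iter (N (tl (tl u)) - hd u) (cons 1) (decode (hd (tl u)))) by rf.
have rpack : RF (fun u => pcons (code (iter (N (tl (tl u)) - hd u) (cons 1) (decode (hd (tl u))))) (tl (tl u))).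
  by apply: RF_pcons; rf.
apply: RL_cons; last by rf.
apply/RF_succ/RF_add.
  by apply: (RF_ext (RF_comp rA rpack)) => u; rewrite tl_pcons hd_pcons CodeSeq.codeK.
by apply: (RF_ext (RF_comp rB rpack)) => u; rewrite tl_pcons hd_pcons CodeSeq.codeK.
Qed.

Ltac rf_user ::= first [simple apply RF_ev | simple apply RL_updates | simple apply RL_block
  | simple apply RF_run_value | simple apply RB_listed | simple apply RF_side
  | simple apply RL_kpoint ].

Lemma RB_inductive_proof s y r u v pf : RF s -> RF y -> RF r -> RF u -> RF v -> RF pf ->
  RB (fun e => inductive_proof (s e) (y e) (r e) (u e) (v e) (pf e)).
Proof. by move=> *; rewrite /inductive_proof; cbv zeta; rf. Qed.

Lemma RB_refutes s y : RF s -> RF y -> RB (fun e => refutes (s e) (y e)).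
Proof. by move=> *; rewrite /refutes; cbv zeta; rf. Qed.

Lemma RB_certifies s y : RF s -> RF y -> RB (fun e => certifies (s e) (y e)).
Proof.
move=> *; rewrite /certifies; cbv zeta; rf.
by simple apply RB_inductive_proof; rf.
Qed.

(** * Kronecker substitution *)

Definition econst c := code [:: 0; c].
Definition evar i := code [:: 1; i].
Definition eadd a b := code [:: 2; a; b].
Definition emul a b := code [:: 3; a; b].

Lemma fld_code s i : fld (code s) i = nth 0 s i.
Proof. by rewrite /fld CodeSeq.codeK. Qed.

Lemma dl_code s i : dl (code s) i = decode (nth 0 s i).
Proof. by rewrite /dl fld_code. Qed.

Lemma ev_const E c : ev E (econst c) = c.
Proof. by rewrite /ev cfold_code /ev_step !fld_code. Qed.
Lemma ev_var E i : ev E (evar i) = nth 0 E i.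
Proof. by rewrite /ev cfold_code /ev_step !fld_code. Qed.
Lemma ev_add E a b : ev E (eadd a b) = ev E a + ev E b.
Proof. by rewrite /ev cfold_code /ev_step !fld_code. Qed.
Lemma ev_mul E a b : ev E (emul a b) = ev E a * ev E b.
Proof. by rewrite /ev cfold_code /ev_step !fld_code. Qed.
Definition evE := (ev_const, ev_var, ev_add, ev_mul).

Lemma code_ind (P : nat -> Prop) :
  (forall n, (forall c, c \in decode n -> P c) -> P n) -> forall n, P n.
Proof. by move=> IH n; elim/ltn_ind: n => n IHn; apply: IH => c /decode_lt/IHn. Qed.

(** Polynomials are analysed through their values only, so that ill-formed codes need no separate
    treatment; the bounds on [a] and [b] allow induction. *)
Variant ev_spec n : Prop :=
  | EvConst c of forall E, ev E n = c
  | EvVar i of forall E, ev E n = nth 0 E i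
  | EvAdd a b of a < n & b < n & forall E, ev E n = ev E a + ev E b
  | EvMul a b of a < n & b < n & forall E, ev E n = ev E a * ev E b.

Lemma evP n : ev_spec n.
Proof.
have evEn E : ev E n = ev_step E n [seq ev E c | c <- decode n] by exact: cfoldE.
have nth_ev E i c0 : ev E c0 = 0 ->
    nth 0 [seq ev E c | c <- decode n] i = ev E (nth c0 (decode n) i).
  move=> ev0; have [lt_i|ge_i] := ltnP i (size (decode n)).
    by rewrite (nth_map c0).
  by rewrite !nth_default ?size_map.
(* The default 0 of a missing field is itself a polynomial with value 0, so defaults before and
   after evaluation agree. *)
have ev00 E : ev E 0 = 0 by rewrite /ev cfoldE.
have lt_fld i : n != 0 -> fld n i < n.
  move=> n0; rewrite /fld; have [lt_i|ge_i] := ltnP i (size (decode n)).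
    by rewrite decode_lt // mem_nth.
  by rewrite nth_default // lt0n.
case: (eqVneq n 0) => [->|n0]; first by apply: (@EvConst _ 0).
case: (eqVneq (fld n 0) 1) => [h1|n1].
  by apply: (@EvVar _ (fld n 1)) => E; rewrite evEn /ev_step h1.
case: (eqVneq (fld n 0) 2) => [h2|n2].
  apply: (@EvAdd _ (fld n 1) (fld n 2)); rewrite ?lt_fld // => E.
  by rewrite evEn /ev_step h2 /= !(nth_ev _ _ 0).
case: (eqVneq (fld n 0) 3) => [h3|n3].
  apply: (@EvMul _ (fld n 1) (fld n 2)); rewrite ?lt_fld // => E.
  by rewrite evEn /ev_step h3 /= !(nth_ev _ _ 0).
apply: (@EvConst _ (fld n 1)) => E.
by rewrite evEn /ev_step (negPf n1) (negPf n2) (negPf n3).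
Qed.

Lemma ev_ind (P : nat -> Prop) :
  (forall n c, (forall E, ev E n = c) -> P n) ->
  (forall n i, (forall E, ev E n = nth 0 E i) -> P n) ->
  (forall n a b, P a -> P b -> (forall E, ev E n = ev E a + ev E b) -> P n) ->
  (forall n a b, P a -> P b -> (forall E, ev E n = ev E a * ev E b) -> P n) ->
  forall n, P n.
Proof.
move=> Pc Pv Pa Pm n; elim/ltn_ind: n => n IHn.
case: (evP n) => [c|i|a b /IHn Pa' /IHn Pb|a b /IHn Pa' /IHn Pb] ev_n.
- exact: Pc ev_n.
- exact: Pv ev_n.
- exact: Pa ev_n.
- exact: Pm ev_n.
Qed.

Lemma ev_subst (E' : seq nat -> seq nat) (es : nat -> nat) :
  (forall E i, nth 0 (E' E) i = ev E (es i)) ->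
  forall n, exists n', forall E, ev E n' = ev (E' E) n.
Proof.
move=> hE; elim/ev_ind => [n c|n i|n a b [a' Ha] [b' Hb]|n a b [a' Ha] [b' Hb]] ev_n.
- by exists (econst c) => E; rewrite evE ev_n.
- by exists (es i) => E; rewrite ev_n hE.
- by exists (eadd a' b') => E; rewrite evE ev_n Ha Hb.
- by exists (emul a' b') => E; rewrite evE ev_n Ha Hb.
Qed.

(** Polynomial functions of [N] variables, as polynomials in the first one with coefficients in the
    others. That the coefficients are natural numbers is what makes values at 1 bound them. *)
Fixpoint npol N (A : seq nat -> nat) : Prop :=
  if N is N'.+1 then
    exists d (a : nat -> seq nat -> nat), (forall i, npol N' (a i)) /\
      forall E, size E = N' -> forall x, A (x :: E) = \sum_(i < d) a i E * x ^ i
  else True.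

Lemma npol_ext N A B : npol N A -> (forall E, size E = N -> A E = B E) -> npol N B.
Proof.
case: N => //= N [d [a [pa Aa]]] AB; exists d, a; split=> // E sE x.
by rewrite -Aa // AB //= sE.
Qed.

Lemma npol_const N c : npol N (fun=> c).
Proof.
elim: N c => //= N IHN c; exists 1, (fun _ _ => c); split=> // E _ x.
by rewrite big_ord1 expn0 muln1.
Qed.

Lemma npol_var N i : npol N (fun E => nth 0 E i).
Proof.
elim: N i => //= N IHN [|i] /=.
  exists 2, (fun i _ => i); split=> [j|E _ x]; first exact: npol_const.
  by rewrite big_ord_recl big_ord1 /= expn1 mul0n mul1n.
exists 1, (fun _ E => nth 0 E i); split=> // E _ x.
by rewrite big_ord1 expn0 muln1.
Qed.

(** The two closures are proved together because the coefficients of a product are sums of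
    products. *)
Lemma npol_add_mul N A B : npol N A -> npol N B ->
  npol N (fun E => A E + B E) /\ npol N (fun E => A E * B E).
Proof.
elim: N A B => //= N IHN A B [d [a [pa Aa]]] [d' [b [pb Bb]]].
have padd f g : npol N f -> npol N g -> npol N (fun E => f E + g E).
  by move=> pf pg; case: (IHN _ _ pf pg).
have pmul f g : npol N f -> npol N g -> npol N (fun E => f E * g E).
  by move=> pf pg; case: (IHN _ _ pf pg).
have psum m (F : nat -> seq nat -> nat) : (forall i, npol N (F i)) ->
    npol N (fun E => \sum_(i < m) F i E).
  move=> pF; elim: m => [|m IHm].
    by apply: npol_ext (npol_const N 0) _ => E _; rewrite big_ord0.
  by apply: npol_ext (padd _ _ IHm (pF m)) _ => E _; rewrite big_ord_recr.
(* The coefficients are unconstrained from the degree bound on; they are cut off to 0 before the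
   convolution is formed. *)
pose a' i E := (i < d) * a i E; pose b' i E := (i < d') * b i E.
have pa' i : npol N (a' i) by apply: pmul => //; apply: npol_const.
have pb' i : npol N (b' i) by apply: pmul => //; apply: npol_const.
(* Passing to [{poly int}] provides the formulas for sums and products; the result comes back since
   nat embeds in int. *)
pose pol (c : nat -> nat) n : {poly int} := (\poly_(i < n) (c i)%:R)%R.
have polE (c : nat -> nat) n (x : nat) : ((\sum_(i < n) c i * x ^ i)%N%:R = (pol c n).[x%:R] :> int)%R.
  by rewrite horner_poly natr_sum; apply: eq_bigr => i _; rewrite natrM natrX.
have pol'E (c : nat -> nat) n i : ((pol c n)`_i = ((i < n) * c i)%N%:R :> int)%R.
  by rewrite coef_poly; case: ltnP; rewrite ?mul1n ?mul0n.
have int_inj (x y : nat) : (x%:R = y%:R :> int)%R -> x = y.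
  by move/eqP; rewrite eqr_nat => /eqP.
split.
  exists (d + d'), (fun i E => a' i E + b' i E); split=> [i|E sE x].
    exact: padd.
  rewrite Aa // Bb //; apply: int_inj; rewrite natrD (polE (a^~ E)) (polE (b^~ E)) -hornerD.
  rewrite (@horner_coef_wide _ (d + d')); last first.
    rewrite (leq_trans (size_polyD _ _)) // geq_max.
    by rewrite !(leq_trans (size_poly _ _)) ?leq_addr ?leq_addl.
  rewrite natr_sum; apply: eq_bigr => i _.
  by rewrite coefD !pol'E -natrD -natrX -natrM.
exists (d + d'), (fun k E => \sum_(i < k.+1) a' i E * b' (k - i) E); split=> [k|E sE x].
  apply: (psum k.+1 (fun i E => a' i E * b' (k - i) E)) => i; exact: pmul.
rewrite Aa // Bb //; apply: int_inj; rewrite natrM (polE (a^~ E)) (polE (b^~ E)) -hornerM.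
rewrite (@horner_coef_wide _ (d + d')); last first.
  rewrite (leq_trans (size_polyMleq _ _)) // (leq_trans (leq_pred _)) //.
  by rewrite leq_add ?size_poly.
rewrite natr_sum; apply: eq_bigr => k _.
rewrite coefM natrM natrX natr_sum; congr (_ * _)%R.
by apply: eq_bigr => i _; rewrite !pol'E -natrM.
Qed.

Lemma npol_ev N n : npol N (fun E => ev E n).
Proof.
elim/ev_ind: n => [n c|n i|n a b pa pb|n a b pa pb] ev_n.
- by apply: npol_ext (npol_const N c) _ => E _; rewrite ev_n.
- by apply: npol_ext (npol_var N i) _ => E _; rewrite ev_n.
- by apply: npol_ext (npol_add_mul pa pb).1 _ => E _; rewrite ev_n.
- by apply: npol_ext (npol_add_mul pa pb).2 _ => E _; rewrite ev_n.
Qed.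

(** The value at 1 is the sum of the coefficients, none of which is negative. *)
Lemma npol_coef_le N d (a : nat -> seq nat -> nat) A E i :
  size E = N -> (forall x, A (x :: E) = \sum_(i < d) a i E * x ^ i) ->
  (i < d) * a i E <= A (1 :: E).
Proof.
move=> sE ->; have [id|] := ltnP i d; last by [].
rewrite (bigD1 (Ordinal id)) //= exp1n muln1 mul1n; exact: leq_addr.
Qed.

Lemma digits_eq T d (a b : nat -> nat) :
  (forall i, a i < T) -> (forall i, b i < T) ->
  \sum_(i < d) a i * T ^ i = \sum_(i < d) b i * T ^ i ->
  forall i, i < d -> a i = b i.
Proof.
elim: d a b => // d IHd a b aT bT.
rewrite !big_ord_recl /= !expn0 !muln1.
have shift (c : nat -> nat) : \sum_(i < d) c (bump 0 i) * T ^ bump 0 i =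
    (\sum_(i < d) c i.+1 * T ^ i) * T.
  by rewrite big_distrl /=; apply: eq_bigr => i _; rewrite /bump /= add1n expnSr mulnA.
rewrite !shift => eq_ab.
have T0 : 0 < T by apply: leq_ltn_trans (aT 0).
have ab0 : a 0 = b 0.
  by have := congr1 (modn^~ T) eq_ab; rewrite !(addnC (_ 0)) !modnMDl !modn_small.
move: eq_ab; rewrite ab0 => /addnI/eqP; rewrite eqn_pmul2r // => /eqP eq_ab.
case=> [|i] // id; exact: (IHd (fun i => a i.+1) (fun i => b i.+1)).
Qed.

(* Kronecker substitution: digits in base [head 0 E] recover the coefficients
   of the first variable, which are bounded by the value at 1. *)
Lemma npol_identity N A B E : npol N A -> npol N B -> size E = N ->
  (forall j, j < N -> A (nseq j.+1 1 ++ drop j.+1 E) < nth 0 E j /\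
                      B (nseq j.+1 1 ++ drop j.+1 E) < nth 0 E j) ->
  A E = B E -> forall E', size E' = N -> A E' = B E'.
Proof.
elim: N A B E => [|N IHN] A B E pA pB.
  by move=> /size0nil-> _ AB E' /size0nil->.
case: pA pB => [d [a [pa Aa]]] [d' [b [pb Bb]]].
case: E => // T E [sE] big_E AB.
pose a' i F := (i < d) * a i F; pose b' i F := (i < d') * b i F.
have pa' i : npol N (a' i) by case: (npol_add_mul (npol_const N (i < d)) (pa i)).
have pb' i : npol N (b' i) by case: (npol_add_mul (npol_const N (i < d')) (pb i)).
have widen (F : seq nat) (c : nat -> seq nat -> nat) n m x : n <= m ->
    \sum_(i < n) c i F * x ^ i = \sum_(i < m) ((i < n) * c i F) * x ^ i.
  move=> nm; rewrite (big_ord_widen m (fun i => c i F * x ^ i)) //.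
  rewrite big_mkcond /=; apply: eq_bigr => i _.
  by case: ltnP => _; rewrite ?mul1n ?mul0n.
have Aa' F x : size F = N -> A (x :: F) = \sum_(i < d + d') a' i F * x ^ i.
  by move=> sF; rewrite Aa // (widen _ _ d (d + d')) ?leq_addr.
have Bb' F x : size F = N -> B (x :: F) = \sum_(i < d + d') b' i F * x ^ i.
  by move=> sF; rewrite Bb // (widen _ _ d' (d + d')) ?leq_addl.
have a_le i F : size F = N -> a' i F <= A (1 :: F).
  by move=> sF; apply: (npol_coef_le i sF) => x; apply: Aa.
have b_le i F : size F = N -> b' i F <= B (1 :: F).
  by move=> sF; apply: (npol_coef_le i sF) => x; apply: Bb.
have [AT BT] : A (1 :: E) < T /\ B (1 :: E) < T.
  by have := big_E 0 isT; rewrite /= drop0.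
have ab_E i : i < d + d' -> a' i E = b' i E.
  apply: (@digits_eq T (d + d') (a'^~ E) (b'^~ E)); last by rewrite -Aa' // -Bb'.
    by move=> j; apply: leq_ltn_trans (a_le j E sE) AT.
  by move=> j; apply: leq_ltn_trans (b_le j E sE) BT.
case=> // x F [sF]; rewrite Aa' // Bb' //; apply: eq_bigr => i _; congr (_ * _).
apply: (IHN _ _ E (pa' i) (pb' i) sE) => [j jN|//|//]; last exact: ab_E.
have sj : size (nseq j.+1 1 ++ drop j.+1 E) = N.
  by rewrite size_cat size_nseq size_drop sE subnKC.
have /= [Aj Bj] := big_E j.+1 jN.
by split; [apply: leq_ltn_trans (a_le i _ sj) Aj | apply: leq_ltn_trans (b_le i _ sj) Bj].
Qed.

Lemma size_kpoint A B N : size (kpoint A B N) = N.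
Proof.
have sz f n : size (nat_rect (fun=> seq nat) [::] (fun (j : nat) t => f j t :: t) n) = n.
  by elim: n => //= n ->.
exact: (sz (fun j t => (A (iter (N - j) (cons 1) t) + B (iter (N - j) (cons 1) t)).+1)).
Qed.

Lemma kpoint_identity N A B : npol N A -> npol N B ->
  A (kpoint A B N) = B (kpoint A B N) -> forall E, size E = N -> A E = B E.
Proof.
move=> pA pB; rewrite /kpoint.
set K := nat_rect _ _ _.
have sK n : size (K n) = n by elim: n => //= n ->.
(* The coordinates from [j] on are a former stage of the construction, the one from which the
   preceding coordinate was computed. *)
have K_drop j : j <= N -> drop j (K N) = K (N - j).
  elim: j => [|j IHj] jN; first by rewrite drop0 subn0.
  by rewrite -[j.+1]add1n -drop_drop IHj ?(ltnW jN) // -subnSK //= drop0.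
apply: npol_identity => // j jN.
have -> : nth 0 (K N) j = nth 0 (drop j (K N)) 0 by rewrite nth_drop addn0.
have Nj : N - j = (N - j.+1).+1 by rewrite subnSK.
rewrite !K_drop ?(ltnW jN) // Nj [nth _ _ _]/=.
have -> : N - (N - j.+1) = j.+1 by lia.
have -> : iter j.+1 (cons 1) (K (N - j.+1)) = nseq j.+1 1 ++ K (N - j.+1).
  by move: (K _) => t; elim: j.+1 => //= i ->.
by rewrite !ltnS leq_addr leq_addl.
Qed.

(** * Reachable values and soundness of certificates *)

(* Register values are functions of the parameter, the value of variable 0. *)
Inductive reach s : nat -> (nat -> seq nat) -> Prop :=
| Reach r (rhos : nat -> nat -> seq nat) rho :
    r \in dl s 1 ->
    (forall i, i < size (dl r 1) -> reach s (nth 0 (dl r 1) i) (rhos i)) ->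
    (forall x, rho x = updates (fld s 0) r
       (x :: flatten [seq rhos i x | i <- iota 0 (size (dl r 1))])) ->
    reach s (fld r 0) rho.

Definition vanishing s : Prop :=
  forall q rho, reach s q rho -> forall f, f \in dl s 2 -> fld f 0 = q ->
  forall x, ev (x :: rho x) (fld f 1) = ev (x :: rho x) (fld f 2).

Lemma reach_size s q rho x : reach s q rho -> size (rho x) = fld s 0.
Proof. by case=> r rhos {}rho _ _ ->; rewrite size_mkseq. Qed.

Lemma run_valueE s x w :
  run_value s x w = run_step s x w [seq run_value s x c | c <- decode w].
Proof. exact: cfoldE. Qed.

Lemma reach_run s q rho : reach s q rho ->
  exists w, forall x, run_value s x w = code [:: 1; q; code (rho x)].
Proof.
elim=> {q rho} r rhos rho r_s _ IH rhoE; set k := size (dl r 1) in IH rhoE *.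
have /choice[ws wsE] : forall i, exists w, i < k ->
    forall x, run_value s x w = code [:: 1; nth 0 (dl r 1) i; code (rhos i x)].
  by move=> i; case: (ltnP i k) => [/IH[w wE]|_]; [exists w | exists 0].
exists (code (index r (dl s 1) :: map ws (iota 0 k))) => x.
rewrite run_valueE CodeSeq.codeK /run_step fld_code /= index_mem r_s nth_index //.
rewrite -map_comp size_map size_iota eqxx /=.
have kidE i : i < k -> nth 0 [seq (run_value s x \o ws) i | i <- iota 0 k] i =
    code [:: 1; nth 0 (dl r 1) i; code (rhos i x)].
  by move=> ik; rewrite (nth_map 0) ?size_iota // nth_iota //= wsE.
have -> : all (fun i =>
      (fld (nth 0 [seq (run_value s x \o ws) i | i <- iota 0 k] i) 0 == 1) &&
      (fld (nth 0 [seq (run_value s x \o ws) i | i <- iota 0 k] i) 1 == nth 0 (dl r 1) i))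
    (iota 0 k).
  apply/allP => i; rewrite mem_iota => /andP[_ ik].
  by rewrite kidE // !fld_code /= !eqxx.
rewrite rhoE -map_comp; congr (code [:: _; _; code (updates _ _ (_ :: flatten _))]).
by apply/eq_in_map => i; rewrite mem_iota => /andP[_ ik] /=; rewrite wsE // dl_code CodeSeq.codeK.
Qed.

(** Whether [w] is a run, and in which state it ends, does not depend on the parameter: a test at
    [x0] gives register values for all [x]. *)
Lemma run_reach s x0 w : fld (run_value s x0 w) 0 = 1 ->
  exists2 rho, reach s (fld (run_value s x0 w) 1) rho &
    forall x, dl (run_value s x w) 2 = rho x.
Proof.
elim/code_ind: w => w IH.
pose L := [seq run_value s x0 c | c <- decode w].
rewrite run_valueE -/L /run_step !fld_code /=.
set r := nth 0 (dl s 1) (fld w 0); case: and3P => // -[lt_r /eqP szL okL] _.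
have size_w : size (behead (decode w)) = size (dl r 1).
  by rewrite -szL !size_behead size_map.
have kidE x i : i < size (dl r 1) ->
    nth 0 (behead [seq run_value s x c | c <- decode w]) i
    = run_value s x (nth 0 (behead (decode w)) i).
  by rewrite -size_w => ik; rewrite behead_map (nth_map 0).
have /choice[rhos rhosP] : forall i, exists rho, i < size (dl r 1) ->
    reach s (nth 0 (dl r 1) i) rho /\
    forall x, dl (run_value s x (nth 0 (behead (decode w)) i)) 2 = rho x.
  move=> i; case: (ltnP i (size (dl r 1))) => ik; last by exists (fun=> [::]).
  have /(allP okL)/andP[] : i \in iota 0 (size (dl r 1)) by rewrite mem_iota.
  rewrite kidE // => /eqP ok1 /eqP <-.
  have [|rho rrho rhoE] := IH _ _ ok1; last by exists rho.
  by apply: mem_behead; rewrite mem_nth ?size_w.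
exists (fun x => updates (fld s 0) r
       (x :: flatten [seq rhos i x | i <- iota 0 (size (dl r 1))])).
  by apply: Reach => [||//]; [rewrite mem_nth | move=> i /rhosP[]].
move=> x; rewrite run_valueE /run_step dl_code /= CodeSeq.codeK -/r.
congr (updates _ _ (_ :: flatten _)).
apply: (@eq_from_nth _ [::]) => [|i]; rewrite !size_map size_behead size_map.
  by rewrite -size_behead size_w size_iota.
rewrite -size_behead size_w => ik.
rewrite (nth_map 0) ?size_behead ?size_map -?size_behead ?size_w // kidE //.
by rewrite (nth_map 0) ?size_iota // nth_iota //= (rhosP i ik).2.
Qed.

Lemma refutesP s : (exists y, refutes s y) <-> ~ vanishing s.
Proof.
split=> [[y /and4P[lt_f /eqP ok /eqP eq_q neq_uv]] van|].
  have [rho rrho rhoE] := run_reach ok.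
  by move: neq_uv; rewrite rhoE (van _ _ rrho _ (mem_nth 0 lt_f)) // eqxx.
move/existsNP=> [q /existsNP[rho /not_implyP[rrho /existsNP[f]]]].
move=> /not_implyP[f_s /not_implyP[fq /existsNP[x neq_uv]]].
have [w wE] := reach_run rrho.
exists (code [:: w; x; index f (dl s 2)]).
rewrite /refutes !fld_code /= wE !fld_code dl_code CodeSeq.codeK index_mem f_s.
by rewrite nth_index //= fq eqxx; apply/eqP.
Qed.

Lemma ev0 E : ev E 0 = 0.
Proof. by rewrite /ev cfoldE. Qed.

Lemma nth_map_ev E es i : nth 0 [seq ev E e | e <- es] i = ev E (nth 0 es i).
Proof.
have [lt_i|ge_i] := ltnP i (size es); first by rewrite (nth_map 0).
by rewrite !nth_default ?size_map ?ev0.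
Qed.

Definition representable (f : seq nat -> nat) := exists n, forall E, f E = ev E n.

Lemma representable_add f g : representable f -> representable g ->
  representable (fun E => f E + g E).
Proof. by move=> [n fn] [m gm]; exists (eadd n m) => E; rewrite fn gm evE. Qed.

Lemma representable_mul f g : representable f -> representable g ->
  representable (fun E => f E * g E).
Proof. by move=> [n fn] [m gm]; exists (emul n m) => E; rewrite fn gm evE. Qed.

Lemma representable_sumn (T : Type) (l : seq T) f :
  (forall i, representable (f i)) -> representable (fun E => sumn [seq f i E | i <- l]).
Proof.
move=> rf; elim: l => [|i l IHl] /=; last exact: representable_add.
by exists (econst 0) => E; rewrite evE.
Qed.

Lemma ev_comp es n : exists n', forall E, ev E n' = ev [seq ev E e | e <- es] n.
Proof. by apply: (ev_subst (es := nth 0 es)) => E i; rewrite nth_map_ev. Qed.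

Lemma representable_comp E' es n : (forall E, E' E = [seq ev E e | e <- es]) ->
  representable (fun E => ev (E' E) n).
Proof.
by move=> E'E; have [n' n'E] := ev_comp es n; exists n' => E; rewrite E'E n'E.
Qed.

Lemma representable_side m r pf a b z : representable (side m r pf a b z).
Proof.
have cst n : representable (fun E => ev [:: nth 0 E 0] n).
  by apply: (@representable_comp _ [:: evar 0]) => E /=; rewrite evE.
have upd n : representable (fun E => ev (nth 0 E 0 :: updates m r E) n).
  apply: (@representable_comp _ (evar 0 :: mkseq (fun j => nth 0 (dl r 2) j) m)) => E /=.
  by rewrite evE -map_comp.
have blk i n : representable (fun E => ev (block m E i) n).
  apply: (@representable_comp _ (evar 0 :: mkseq (fun j => evar (1 + i * m + j)) m)) => E /=.
  by rewrite evE -map_comp /block; congr (_ :: _); apply: eq_map => j /=; rewrite evE.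
apply: representable_add; first by apply: representable_add; apply: representable_mul.
apply: (representable_sumn _ (f := fun c E => ev E (fld c 0) * ev (block m E (fld c 1)) (fld c z))) => c.
by apply: representable_mul => //; exists (fld c 0).
Qed.

Lemma npol_representable N f : representable f -> npol N f.
Proof. by move=> [n fn]; apply: npol_ext (npol_ev N n) _. Qed.

Lemma flatten_env_size m k (rs : nat -> seq nat) :
  (forall i, i < k -> size (rs i) = m) ->
  size (flatten [seq rs i | i <- iota 0 k]) = k * m.
Proof.
move=> s_rs; rewrite size_flatten /shape -map_comp.
have -> : [seq (size \o rs) i | i <- iota 0 k] = nseq k m.
  apply: (@eq_from_nth _ 0); rewrite size_map size_iota ?size_nseq // => i ik.
  by rewrite (nth_map 0) ?size_iota // nth_iota //= s_rs // nth_nseq ik.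
by rewrite sumn_nseq mulnC.
Qed.

Lemma nth_flatten_env m k (rs : nat -> seq nat) i j :
  (forall i, i < k -> size (rs i) = m) -> i < k -> j < m ->
  nth 0 (flatten [seq rs i | i <- iota 0 k]) (i * m + j) = nth 0 (rs i) j.
Proof.
move=> s_rs ik jm; rewrite -{1}(subnKC ik) -addn1 -addnA !iotaD !map_cat !flatten_cat /=.
rewrite nth_cat (flatten_env_size (m := m)); last by move=> i' /ltn_trans/(_ ik)/s_rs.
by rewrite ltnNge leq_addr /= addKn add0n cats0 nth_cat s_rs // jm.
Qed.

Lemma block_env m k (rs : nat -> seq nat) i x :
  (forall i, i < k -> size (rs i) = m) -> i < k ->
  block m (x :: flatten [seq rs i | i <- iota 0 k]) i = x :: rs i.
Proof.
move=> s_rs ik; congr (_ :: _); apply: (@eq_from_nth _ 0); rewrite size_mkseq ?s_rs // => j jm.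
by rewrite nth_mkseq //= nth_flatten_env.
Qed.

(** Serves twice: to cancel the factor in x in the soundness of certificates, and to specialize
    polynomials at a reachable value in their completeness. *)
Lemma reach_poly s q rho : reach s q rho ->
  exists es, forall x, rho x = [seq ev [:: x] e | e <- es].
Proof.
elim=> {q rho} r rhos rho r_s _ IH rhoE; set k := size (dl r 1) in IH rhoE *.
have /choice[ess essP] : forall i, exists es, i < k ->
    forall x, rhos i x = [seq ev [:: x] e | e <- es].
  by move=> i; case: (ltnP i k) => [/IH[es esP]|_]; [exists es | exists [::]].
pose es0 := evar 0 :: flatten [seq ess i | i <- iota 0 k].
have /choice[n' n'E] := ev_comp es0.
exists (mkseq (fun j => n' (nth 0 (dl r 2) j)) (fld s 0)) => x.
rewrite rhoE -map_comp; apply: eq_map => j /=; rewrite n'E /= evE; congr (ev (_ :: _) _).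
rewrite map_flatten -map_comp; congr flatten.
by apply/eq_in_map => i; rewrite mem_iota /= => ik; rewrite essP.
Qed.

Lemma ev_horner n : exists p : {poly int}, forall x, ((ev [:: x] n)%:R = p.[x%:R])%R.
Proof.
elim/ev_ind: n => [n c|n i|n a b [p pE] [q qE]|n a b [p pE] [q qE]] ev_n.
- by exists (c%:R)%:P%R => x; rewrite ev_n hornerC.
- case: i ev_n => [|i] ev_n; first by exists 'X%R => x; rewrite ev_n hornerX.
  by exists 0%R => x; rewrite ev_n /= nth_nil horner0.
- by exists (p + q)%R => x; rewrite ev_n natrD pE qE hornerD.
- by exists (p * q)%R => x; rewrite ev_n natrM pE qE hornerM.
Qed.

Lemma poly_eq0_nat (p : {poly int}) : (forall x : nat, p.[x%:R] = 0)%R -> p = 0%R.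
Proof.
move=> p0; apply: (@roots_geq_poly_eq0 _ _ (mkseq (fun i => i%:R)%R (size p))).
- by apply/allP => _ /mapP[i _ ->]; apply/rootP.
- by rewrite mkseq_uniq // => i j /eqP; rewrite eqr_nat => /eqP.
- by rewrite size_mkseq.
Qed.

(** The hypothesis is [(c1 - c2) * (u - v) = 0] without subtraction. An integer polynomial that
    vanishes at all natural numbers is 0, and [{poly int}] is a domain. *)
Lemma poly_fun_cancel (c1 c2 u v : nat) x0 : ev [:: x0] c1 <> ev [:: x0] c2 ->
  (forall x, ev [:: x] c1 * ev [:: x] u + ev [:: x] c2 * ev [:: x] v
           = ev [:: x] c1 * ev [:: x] v + ev [:: x] c2 * ev [:: x] u) ->
  forall x, ev [:: x] u = ev [:: x] v.
Proof.
move=> neq_c eq_x.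
have [[p1 p1E] [p2 p2E]] := (ev_horner c1, ev_horner c2).
have [[pu puE] [pv pvE]] := (ev_horner u, ev_horner v).
have /eqP : ((p1 - p2) * (pu - pv) = 0)%R.
  apply: poly_eq0_nat => x; rewrite hornerM !hornerD !hornerN -p1E -p2E -puE -pvE.
  have := congr1 (fun n => n%:R : int)%R (eq_x x); rewrite !natrD !natrM => eq_x'.
  have ringE (a b c d : int) : ((a - b) * (c - d) = (a * c + b * d) - (a * d + b * c))%R by ring.
  by rewrite ringE eq_x' subrr.
rewrite mulf_eq0 => /orP[] /eqP p0.
  case: neq_c; apply/eqP; rewrite -(eqr_nat int) p1E p2E -subr_eq0.
  by rewrite -hornerN -hornerD p0 horner0.
move=> x; apply/eqP; rewrite -(eqr_nat int) puE pvE -subr_eq0.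
by rewrite -hornerN -hornerD p0 horner0.
Qed.

Lemma certifies_sound s y : certifies s y -> vanishing s.
Proof.
case/andP=> /allP cert_y /allP cert_f.
suff inv q rho : reach s q rho -> forall u v, listed y q u v ->
    forall x, ev (x :: rho x) u = ev (x :: rho x) v.
  by move=> q rho r_rho f f_s fq x; apply: (inv _ _ r_rho); rewrite -fq; apply: cert_f.
elim=> {q rho} r rhos rho r_s r_rhos IH rhoE u v /hasP[it it_y /and3P[/eqP itr /eqP itu /eqP itv]].
have r_rho : reach s (fld r 0) rho by apply: Reach r_s r_rhos rhoE.
set k := size (dl r 1) in r_rhos IH rhoE.
have := allP (cert_y it it_y) (index r (dl s 1)).
rewrite mem_iota /= index_mem r_s nth_index // itr eqxx /= itu itv => /(_ isT).
set pf := nth _ _ _ => /and3P[/eqP neq_c /allP ok_c /eqP eqAB].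
set m := fld s 0 in rhoE eqAB.
have s_rhos x i : i < k -> size (rhos i x) = m by move=> /r_rhos/reach_size->.
have [es esE] := reach_poly r_rho.
have [u' u'E] := ev_comp (evar 0 :: es) u.
have [v' v'E] := ev_comp (evar 0 :: es) v.
have regE x n : ev [seq ev [:: x] e | e <- evar 0 :: es] n = ev (x :: rho x) n.
  by rewrite esE /= evE.
move=> x; rewrite -!regE -u'E -v'E; move: x.
apply: (poly_fun_cancel neq_c) => x; rewrite u'E v'E !regE.
have := kpoint_identity (npol_representable _ (representable_side m r pf u v 3))
  (npol_representable _ (representable_side m r pf v u 2)) eqAB.
move/(_ (x :: flatten [seq rhos i x | i <- iota 0 k])).
rewrite /= (flatten_env_size (s_rhos x)) => /(_ erefl); rewrite /side -rhoE /=.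
(* The two sides differ here by exchanging [v'] and [u'], which are equal at the children by
   induction; the sums then cancel. *)
set S1 := sumn _; set S2 := sumn _; have -> : S1 = S2 by
  congr sumn; apply/eq_in_map => c /ok_c/andP[ck lc]; rewrite (block_env _ (s_rhos x)) // (IH _ ck _ _ lc).
by move/addIn.
Qed.

(** * Hilbert's basis theorem *)

Section Noetherian.

Local Open Scope ring_scope.

Definition ideal_gen (R : comNzRingType) (I : R -> Prop) (p : R) : Prop :=
  exists2 l : seq (R * R), (forall c, c \in l -> I c.2) & p = \sum_(c <- l) c.1 * c.2.

(** [I] is any subset, and the generators are sought in [I] itself: below, they must be equations
    that hold at the reachable values. *)
Definition noetherian (R : comNzRingType) : Prop :=
  forall I : R -> Prop, exists G : seq R,
    (forall g, g \in G -> I g) /\ forall p, I p -> ideal_gen (fun g => g \in G) p.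

Section IdealGen.

Variable R : comNzRingType.
Implicit Types (I J : R -> Prop) (p q : R).

Lemma ideal_gen_mem I p : I p -> ideal_gen I p.
Proof.
move=> Ip; exists [:: (1, p)] => [c|]; first by rewrite inE => /eqP->.
by rewrite big_seq1 mul1r.
Qed.

Lemma ideal_gen0 I : ideal_gen I 0.
Proof. by exists [::]; rewrite // big_nil. Qed.

Lemma ideal_genD I p q : ideal_gen I p -> ideal_gen I q -> ideal_gen I (p + q).
Proof.
move=> [l lI ->] [l' l'I ->]; exists (l ++ l'); last by rewrite big_cat.
by move=> c; rewrite mem_cat => /orP[/lI|/l'I].
Qed.

Lemma ideal_genM I h p : ideal_gen I p -> ideal_gen I (h * p).
Proof.
move=> [l lI ->]; exists [seq (h * c.1, c.2) | c <- l].
  by move=> _ /mapP[c /lI Ic ->].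
by rewrite big_map big_distrr /=; apply: eq_bigr => c _; rewrite mulrA.
Qed.

Lemma ideal_genN I p : ideal_gen I p -> ideal_gen I (- p).
Proof. by rewrite -mulN1r; apply: ideal_genM. Qed.

Lemma ideal_gen_sum I (T : eqType) (l : seq T) (F : T -> R) :
  (forall c, c \in l -> ideal_gen I (F c)) -> ideal_gen I (\sum_(c <- l) F c).
Proof.
elim: l => [_|c l IHl Il]; first by rewrite big_nil; apply: ideal_gen0.
rewrite big_cons; apply: ideal_genD; first by apply: Il; rewrite mem_head.
by apply: IHl => d dl; apply: Il; rewrite inE dl orbT.
Qed.

Lemma ideal_gen_trans I J p :
  (forall q, I q -> ideal_gen J q) -> ideal_gen I p -> ideal_gen J p.
Proof.
move=> IJ [l lI ->]; apply: ideal_gen_sum => c /lI/IJ; exact: ideal_genM.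
Qed.

Lemma ideal_gen_finite I (L : seq R) : (forall q, q \in L -> ideal_gen I q) ->
  exists2 G : seq R, (forall g, g \in G -> I g) &
    forall q, q \in L -> ideal_gen (fun g => g \in G) q.
Proof.
elim: L => [_|q L IHL IL]; first by exists [::].
have [r rL|G GI LG] := IHL; first by apply: IL; rewrite inE rL orbT.
have [l lI qE] := IL q (mem_head _ _).
exists ([seq c.2 | c <- l] ++ G) => [g|r].
  by rewrite mem_cat => /orP[/mapP[c /lI Ic ->]|/GI].
rewrite inE => /predU1P[->|/LG].
  by exists l => // c cl; rewrite mem_cat map_f.
by apply: ideal_gen_trans => g gG; apply: ideal_gen_mem; rewrite mem_cat gG orbT.
Qed.

(** Finitely many terms generate the ideal of all terms, and they all occur before some index [n].
    This is the form used for sequences of leading coefficients. *)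
Lemma noetherian_seq (f : nat -> R) : noetherian R ->
  exists n, ideal_gen (fun g => exists2 i, (i < n)%N & g = f i) (f n).
Proof.
case/(_ (fun g => exists i, g = f i)) => G [Gf fG].
have [n nG] : exists n, forall g, g \in G -> exists2 i, (i < n)%N & g = f i.
  elim: G Gf {fG} => [_|g G IHG Gf]; first by exists 0%N.
  have [h hG|n nG] := IHG; first by apply: Gf; rewrite inE hG orbT.
  have [i gi] := Gf g (mem_head _ _); exists (maxn i.+1 n) => h.
  rewrite inE => /predU1P[->|/nG[j jn ->]]; first by exists i; rewrite // leq_max leqnn.
  by exists j; rewrite // leq_max jn orbT.
exists n; have [|l lG ->] := fG (f n); first by exists n.
by exists l => // c /lG/nG.
Qed.

End IdealGen.

(** Euclidean division by a nonzero element [d] of least absolute value in the generated ideal. As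
    [d] need not be in [I], it is replaced by the elements of [I] from which it is combined. *)
Lemma noetherian_int : noetherian int.
Proof.
move=> I; have [[p Ip p0]|I0] := pselect (exists2 p, ideal_gen I p & p != 0); last first.
  exists [::]; split=> // p Ip; exists [::] => //; rewrite big_nil.
  by apply: contra_notP I0 => /eqP p0; exists p => //; apply: ideal_gen_mem.
have exP : exists n, `[< exists2 d, ideal_gen I d & (d != 0) && (`|d| == n%:Z) >].
  by exists `|p|%N; apply/asboolP; exists p => //; rewrite p0 abszE eqxx.
case: (ex_minnP exP) => n /asboolP[d Id /andP[d0 /eqP dn]] n_min.
have [|G GI dG] := @ideal_gen_finite _ I [:: d].
  by move=> q; rewrite inE => /eqP->.
exists G; split=> // q Iq; rewrite (divz_eq q d).
suff -> : (q %% d)%Z = 0.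
  by rewrite addr0; apply: ideal_genM; apply: dG; rewrite mem_head.
apply: contraTeq (ltz_mod q d0) => r0; rewrite -leNgt dn.
have := n_min `|(q %% d)%Z|%N; rewrite -lez_nat abszE ger0_norm ?modz_ge0 //; apply.
apply/asboolP; exists (q %% d)%Z; last by rewrite r0 ger0_norm ?modz_ge0 ?eqxx.
rewrite /modz; apply: ideal_genD; first exact: ideal_gen_mem.
by apply: ideal_genN; apply: ideal_genM.
Qed.

Lemma size_sub_lead (R : comNzRingType) (p r : {poly R}) :
  p != 0 -> (size r <= size p)%N -> r`_(size p).-1 = lead_coef p ->
  (size (p - r)%R < size p)%N.
Proof.
move=> p0 rp rE; have sp : (0 < size p)%N by rewrite size_poly_gt0.
rewrite -[X in (_ < X)%N](prednK sp) ltnS; apply/leq_sizeP => j le_j.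
rewrite coefB; case: (ltngtP (size p).-1 j) le_j => // [lt_j|<-] _.
  have pj : (size p <= j)%N by rewrite -(prednK sp).
  by rewrite !nth_default ?subr0 // (leq_trans rp).
by rewrite rE subrr.
Qed.

(** By contradiction: let [g n] be of least size among the elements of the ideal of [I] that are not
    generated by the earlier ones. Some leading coefficient is a combination of earlier ones;
    subtracting the same combination of shifted [g i] lowers the size and does not enter the ideal
    of the earlier ones. *)
Lemma noetherian_poly (R : comNzRingType) : noetherian R -> noetherian {poly R}.
Proof.
move=> noethR I; apply: contrapT => noG.
have escape (L : seq {poly R}) : exists p, (forall q, q \in L -> ideal_gen I q) ->
    [/\ ideal_gen I p, ~ ideal_gen (fun g => g \in L) p &
        forall q, ideal_gen I q -> ~ ideal_gen (fun g => g \in L) q ->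
        (size p <= size q)%N].
  have [LI|] := pselect (forall q, q \in L -> ideal_gen I q); last by exists 0.
  have exP : exists n, `[< exists2 p : {poly R}, size p = n &
      ideal_gen I p /\ ~ ideal_gen (fun g => g \in L) p >].
    apply: contrapT => noP; apply: noG.
    have [G GI LG] := ideal_gen_finite LI; exists G; split=> // p Ip.
    apply: ideal_gen_trans LG _; apply: contrapT => nLp; apply: noP.
    exists (size p); apply/asboolP; exists p => //.
    by split=> //; apply: ideal_gen_mem.
  case: (ex_minnP exP) => n /asboolP[p sp [Ip nLp]] n_min; exists p => _.
  split=> // q Iq nLq; rewrite sp; apply: n_min; apply/asboolP; by exists q.
have /choice[next nextP] := escape => {escape}.
pose gs := fix gs n := if n is n'.+1 then next (gs n') :: gs n' else [::].
have gsI n : forall q, q \in gs n -> ideal_gen I q.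
  elim: n => // n IHn q; rewrite inE => /predU1P[->|/IHn //].
  by have [] := nextP _ IHn.
pose g n := next (gs n).
have gI n : ideal_gen I (g n) by have [] := nextP _ (gsI n).
have gs_mem i n : (i < n)%N -> g i \in gs n.
  elim: n => // n IHn; rewrite ltnS leq_eqVlt => /predU1P[->|/IHn gn].
    exact: mem_head.
  by rewrite inE gn orbT.
have gs_mono i n : (i <= n)%N -> {subset gs i <= gs n}.
  move=> le_in q; elim: n le_in => [|n IHn]; first by rewrite leqn0 => /eqP->.
  rewrite leq_eqVlt => /predU1P[-> //|]; rewrite ltnS => /IHn qn /qn qn'.
  by rewrite inE qn' orbT.
have g_out n : ~ ideal_gen (fun q => q \in gs n) (g n) by have [] := nextP _ (gsI n).
have g_min n q : ideal_gen I q -> ~ ideal_gen (fun q => q \in gs n) q ->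
    (size (g n) <= size q)%N by have [] := nextP _ (gsI n); auto.
have g_size i n : (i <= n)%N -> (size (g i) <= size (g n))%N.
  move=> le_in; apply: g_min => //; apply: contra_not (@g_out n).
  apply: ideal_gen_trans => q /(gs_mono _ _ le_in) qn.
  exact: (ideal_gen_mem (I := fun q => q \in gs n)).
have g0 n : g n != 0.
  by apply/eqP => gn0; apply: (g_out n); rewrite gn0; apply: ideal_gen0.
have [n [l lP lE]] := noetherian_seq (fun n => lead_coef (g n)) noethR.
have /choice[ix ixP] (c : R) : exists i, (exists2 j, (j < n)%N & c = lead_coef (g j)) ->
    (i < n)%N /\ c = lead_coef (g i).
  have [[j jn cj]|] := pselect (exists2 j, (j < n)%N & c = lead_coef (g j)).
    by exists j.
  by exists 0%N.
(* The power of the indeterminate raises an earlier polynomial to the degree of [g n], so that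
   leading coefficients add up; [ix] recovers which one from its leading coefficient. *)
pose term (c : R * R) := c.1 *: ('X^(size (g n) - size (g (ix c.2))) * g (ix c.2)).
pose r := \sum_(c <- l) term c.
have term_gen c : c \in l -> ideal_gen (fun q => q \in gs n) (term c).
  move=> /lP/ixP[lt_ix _]; rewrite /term -mul_polyC mulrA.
  apply: ideal_genM.
  by apply: (ideal_gen_mem (I := fun q => q \in gs n)); apply: gs_mem.
have r_gen : ideal_gen (fun q => q \in gs n) r by apply: ideal_gen_sum.
have : (size (g n - r)%R < size (g n))%N.
  apply: size_sub_lead => //.
    apply: (leq_trans (size_sum _ _ _)); apply/bigmax_leqP_seq => c /lP/ixP[lt_ix _] _.
    apply: (leq_trans (size_scale_leq _ _)); apply: (leq_trans (size_polyMleq _ _)).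
    by rewrite size_polyXn addSn /= subnK // g_size // ltnW.
  rewrite [RHS]lE coef_sum big_seq [RHS]big_seq; apply: eq_bigr => c /lP/ixP[lt_ix cE].
  rewrite [in RHS]cE coefZ coefXnM /lead_coef; congr (_ * _).
  have gn : (0 < size (g n))%N by rewrite size_poly_gt0.
  have gi : (0 < size (g (ix c.2)))%N by rewrite size_poly_gt0.
  have le_g := g_size _ _ (ltnW lt_ix).
  have arith a b : (0 < a -> 0 < b -> b <= a ->
      (a.-1 < a - b) = false /\ a.-1 - (a - b) = b.-1)%N by lia.
  by have [-> ->] := arith _ _ gn gi le_g.
rewrite ltnNge => /negP; apply; apply: g_min.
  apply: ideal_genD => //; apply: ideal_genN; apply: ideal_gen_trans r_gen.
  exact: gsI.
apply: contra_not (@g_out n) => gr; rewrite -(subrK r (g n)); exact: ideal_genD.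
Qed.

Fixpoint polyn n : comNzRingType := if n is n'.+1 then {poly (polyn n')} else int.

Lemma noetherian_polyn n : noetherian (polyn n).
Proof. by elim: n => [|n /noetherian_poly //]; apply: noetherian_int. Qed.

End Noetherian.

(* A pair of codes stands for the difference of two polynomials over nat. *)
Definition dv E (g : nat * nat) : int := ((ev E g.1)%:R - (ev E g.2)%:R)%R.

Definition dadd (g h : nat * nat) := (eadd g.1 h.1, eadd g.2 h.2).
Definition dmul (g h : nat * nat) :=
  (eadd (emul g.1 h.1) (emul g.2 h.2), eadd (emul g.1 h.2) (emul g.2 h.1)).
Definition dopp (g : nat * nat) := (g.2, g.1).

Lemma dvD E g h : dv E (dadd g h) = (dv E g + dv E h)%R.
Proof. by rewrite /dv !evE !natrD; ring. Qed.
Lemma dvM E g h : dv E (dmul g h) = (dv E g * dv E h)%R.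
Proof. by rewrite /dv !evE !natrD !natrM; ring. Qed.
Lemma dvN E g : dv E (dopp g) = (- dv E g)%R.
Proof. by rewrite /dv opprB. Qed.
Lemma dv_const E c : dv E (econst c, 0) = c%:R%R.
Proof. by rewrite /dv evE ev0 subr0. Qed.
Lemma dv_left E n : dv E (n, 0) = (ev E n)%:R%R.
Proof. by rewrite /dv ev0 subr0. Qed.
Definition dvE := (dvD, dvM, dvN, dv_const).

Lemma dv_subst (E' : seq nat -> seq nat) (es : nat -> nat) g :
  (forall E i, nth 0 (E' E) i = ev E (es i)) ->
  exists g', forall E, dv E g' = dv (E' E) g.
Proof.
move=> E'E; have [[u uE] [v vE]] := (ev_subst E'E g.1, ev_subst E'E g.2).
by exists (u, v) => E; rewrite /dv uE vE.
Qed.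

Lemma dv_comp es g : exists g', forall E, dv E g' = dv [seq ev E e | e <- es] g.
Proof. by apply: (dv_subst (es := nth 0 es)) => E i; rewrite nth_map_ev. Qed.

Lemma dv_take n g : exists g', forall E, dv E g' = dv (take n E) g.
Proof.
apply: (dv_subst (es := fun i => if i < n then evar i else 0)) => E i.
have [lt_in|le_ni] := ltnP i n; first by rewrite nth_take // evE.
by rewrite nth_default ?ev0 // size_take_min (leq_trans (geq_minl _ _)).
Qed.

Section Evaluation.

Local Open Scope ring_scope.

(** The outermost indeterminate takes the value at the head of the list, seen as a constant of the
    smaller ring. *)
Fixpoint psi n : polyn n -> seq nat -> int :=
  match n return polyn n -> seq nat -> int with
  | 0%N => fun p _ => p
  | n'.+1 => fun p E => psi (p.[(head 0%N E)%:R] : polyn n') (behead E)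
  end.

Lemma psi_nat n (k : nat) E : psi (k%:R : polyn n) E = k%:R.
Proof.
elim: n E => //= n IHn E; rewrite -(IHn (behead E)); congr (psi _ _).
by rewrite -polyC_natr hornerC.
Qed.

Lemma psiD n (p q : polyn n) E : psi (p + q) E = psi p E + psi q E.
Proof. by elim: n p q E => //= n IHn p q E; rewrite hornerD IHn. Qed.

Lemma psiM n (p q : polyn n) E : psi (p * q) E = psi p E * psi q E.
Proof. by elim: n p q E => //= n IHn p q E; rewrite hornerM IHn. Qed.

Lemma psi_sum n (T : Type) (l : seq T) (F : T -> polyn n) E :
  psi (\sum_(c <- l) F c) E = \sum_(c <- l) psi (F c) E.
Proof.
elim: l => [|c l IHl]; first by rewrite !big_nil -[0]/(0%:R) psi_nat.
by rewrite !big_cons psiD IHl.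
Qed.

Lemma psi_var n i : exists p : polyn n, forall E, size E = n -> psi p E = (nth 0%N E i)%:R.
Proof.
elim: n i => [|n IHn] i.
  by exists 0 => E /size0nil->; rewrite nth_nil.
case: i => [|i].
  by exists 'X => -[|x E] //= _; rewrite hornerX psi_nat.
have [p pE] := IHn i; exists p%:P => -[|x E] //= [sE].
by rewrite hornerC pE.
Qed.

Lemma ev_psi n u : exists p : polyn n, forall E, size E = n -> psi p E = (ev E u)%:R.
Proof.
elim/ev_ind: u => [u c|u i|u a b [p pE] [q qE]|u a b [p pE] [q qE]] ev_u.
- by exists c%:R => E sE; rewrite ev_u psi_nat.
- by have [p pE] := psi_var n i; exists p => E sE; rewrite ev_u pE.
- by exists (p + q) => E sE; rewrite ev_u psiD natrD pE // qE.
- by exists (p * q) => E sE; rewrite ev_u psiM natrM pE // qE.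
Qed.

Lemma dv_psi n g : exists p : polyn n, forall E, size E = n -> psi p E = dv E g.
Proof.
have [[p pE] [q qE]] := (ev_psi n g.1, ev_psi n g.2).
exists (p - q) => E sE; have := psiD (p - q) q E.
by rewrite subrK /dv -pE // -qE // => ->; rewrite addrK.
Qed.

Lemma psi_dv n (p : polyn n) : exists g, forall E, size E = n -> psi p E = dv E g.
Proof.
elim: n p => [|n IHn] p.
  case: p => k /=.
    by exists (econst k, 0%N) => E _; rewrite dv_const natz.
  by exists (0%N, econst k.+1) => E _; rewrite /dv evE ev0 sub0r natz NegzE.
elim/poly_ind: p => [|p c [g gE]].
  by exists (0, 0)%N => E sE; rewrite -[0]/(0%:R) psi_nat /dv subrr.
have [h hE] := IHn c.
have [h' h'E] : exists h', forall E, dv E h' = dv (behead E) h.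
  by apply: (dv_subst (es := fun i => evar i.+1)) => E i; rewrite evE nth_behead.
exists (dadd (dmul g (evar 0, 0%N)) h') => E sE.
rewrite psiD psiM gE // dvD dvM h'E dv_left evE; congr (_ * _ + _).
  by case: E sE => //= x E _; rewrite hornerX psi_nat.
by case: E sE => //= x E [sE]; rewrite hornerC hE.
Qed.

(** The basis theorem transported to codes: it is applied to the polynomials that represent some
    element of [I], and the identities are kept as equalities of values. *)
Lemma finite_basis n (I : nat * nat -> Prop) : exists G : seq (nat * nat),
  (forall g, g \in G -> I g) /\
  forall f, I f -> exists2 l : seq ((nat * nat) * (nat * nat)),
    (forall c, c \in l -> c.2 \in G) &
    forall E, size E = n -> dv E f = \sum_(c <- l) dv E c.1 * dv E c.2.
Proof.
pose represents (p : polyn n) g := forall E, size E = n -> psi p E = dv E g.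
have /choice[code_of code_ofP] : forall p : polyn n, exists g, represents p g.
  exact: psi_dv.
(* A generator found in the polynomial ring is brought back to a code that belongs to [I], not
   merely to one with the same values. *)
have /choice[gen genP] : forall p : polyn n, exists g,
    (exists2 g, I g & represents p g) -> I g /\ represents p g.
  move=> p; have [[g Ig pg]|] := pselect (exists2 g, I g & represents p g).
    by exists g.
  by exists (0, 0)%N.
have [G [GI GP]] := @noetherian_polyn n (fun p => exists2 g, I g & represents p g).
exists [seq gen p | p <- G]; split=> [_ /mapP[p /GI/genP[Ig _] ->] //|f If].
have [p pf] := dv_psi n f.
have [|l lG pE] := GP p; first by exists f.
exists [seq (code_of c.1, gen c.2) | c <- l] => [_ /mapP[c cl ->]|E sE] /=.
  by apply: map_f; apply: lG.
rewrite -pf // pE psi_sum big_map big_seq [RHS]big_seq; apply: eq_bigr => c /lG/GI/genP[_ gc].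
by rewrite psiM code_ofP // gc.
Qed.

End Evaluation.

Definition nonzero c := exists x, dv [:: x] c <> 0%R.

Lemma nonzero_mul c d : nonzero c -> nonzero d -> nonzero (dmul c d).
Proof.
move=> [x cx] [x' dx']; apply: contrapT => /forallNP cd0; apply: dx'.
have dv_horner g : exists p : {poly int}, forall x, (dv [:: x] g = p.[x%:R])%R.
  have [[p pE] [q qE]] := (ev_horner g.1, ev_horner g.2).
  by exists (p - q)%R => y; rewrite hornerD hornerN -pE -qE.
have [[p pE] [q qE]] := (dv_horner c, dv_horner d).
have /eqP : (p * q = 0)%R.
  by apply: poly_eq0_nat => y; rewrite hornerM -pE -qE -dvM; apply: contrapT.
rewrite mulf_eq0 => /orP[/eqP p0|/eqP q0]; last by rewrite qE q0 horner0.
by case: cx; rewrite pE p0 horner0.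
Qed.

(** * Ideals of products *)

Section ProductOfVarieties.

Local Open Scope ring_scope.
Implicit Types (X : (nat -> seq nat) -> Prop) (g h c : nat * nat).

Definition vanishes X g := forall rho, X rho -> forall x, dv (x :: rho x) g = 0.

Definition polynomial (rho : nat -> seq nat) :=
  exists es, forall x, rho x = [seq ev [:: x] e | e <- es].

Lemma dv_param c : exists c', forall x r, dv (x :: r) c' = dv [:: x] c.
Proof.
have [c' c'E] := dv_take 1 c; exists c' => x r.
by rewrite c'E /= take0.
Qed.

(* Eliminate the terms [a_j b_j] one by one.  If [b_0] does not vanish at some
   [rho2] in [X2], then [g = \sum_j b_j(rho2) a_j] vanishes on [X1] and allows
   to express [a_0], up to the factor [b_0(rho2)], by the other [a_j]. *)
Lemma vanishes_prod2 X1 X2 : (forall rho, X2 rho -> polynomial rho) ->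
  forall l : seq ((nat * nat) * (nat * nat)),
  (forall rho1 rho2 x, X1 rho1 -> X2 rho2 ->
     \sum_(p <- l) dv (x :: rho1 x) p.1 * dv (x :: rho2 x) p.2 = 0) ->
  exists2 c, nonzero c & exists2 l' : seq ((nat * nat) * (nat * nat)),
    (forall p, p \in l' -> vanishes X1 p.1 \/ vanishes X2 p.2) &
    forall x r1 r2, dv [:: x] c * (\sum_(p <- l) dv (x :: r1) p.1 * dv (x :: r2) p.2)
      = \sum_(p <- l') dv (x :: r1) p.1 * dv (x :: r2) p.2.
Proof.
move=> polyX2 l; have [n] := ubnP (size l).
elim: n l => // n IHn [|[a0 b0] l] /= le_l van.
  exists (econst 1, 0%N); first by exists 0%N; rewrite dv_const.
  by exists [::] => // x r1 r2; rewrite !big_nil mulr0.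
have [b0X|] := pselect (vanishes X2 b0).
  have [|c c0 [l' l'P cE]] := IHn l le_l.
    move=> rho1 rho2 x X1r X2r; rewrite -[RHS](van rho1 rho2 x) // big_cons /=.
    by rewrite b0X // mulr0 add0r.
  have [c' c'E] := dv_param c.
  exists c => //; exists ((dmul c' a0, b0) :: l').
    by move=> p; rewrite inE => /predU1P[->|/l'P //]; right.
  by move=> x r1 r2; rewrite !big_cons mulrDr cE /= dvM c'E mulrA.
move=> /existsNP[rho2 /not_implyP[X2r2 /existsNP[x0 b00]]].
have [es esE] := polyX2 _ X2r2.
have /choice[at_rho2 at_rho2E] : forall g, exists g', forall x,
    dv [:: x] g' = dv (x :: rho2 x) g.
  move=> g; have [g' g'E] := dv_comp (evar 0 :: es) g.
  by exists g' => x; rewrite g'E /= evE esE.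
have /choice[lift liftE] := dv_param.
pose beta (p : (nat * nat) * (nat * nat)) := lift (at_rho2 p.2).
have betaE x r (p : (nat * nat) * (nat * nat)) : dv (x :: r) (beta p) = dv (x :: rho2 x) p.2.
  by rewrite liftE at_rho2E.
pose g := foldr (fun p acc => dadd (dmul (beta p) p.1) acc) (0, 0)%N ((a0, b0) :: l).
have gE x r : dv (x :: r) g =
    \sum_(p <- (a0, b0) :: l) dv (x :: rho2 x) p.2 * dv (x :: r) p.1.
  rewrite /g; elim: (_ :: l) => [|p s IHs]; first by rewrite big_nil /dv subrr.
  by rewrite big_cons /= dvD dvM betaE IHs.
have g_van : vanishes X1 g.
  move=> rho1 X1r x; rewrite gE -[RHS](van rho1 rho2 x) //.
  by apply: eq_bigr => p _; rewrite mulrC.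
(* Multiplying the sum by [b0] at [rho2] and subtracting [b0 * g] removes the term of [a0]. What
   remains is one term shorter and still vanishes on the product. *)
pose l0 := [seq (p.1, dadd (dmul (beta (a0, b0)) p.2) (dopp (dmul (beta p) b0))) | p <- l].
have l0E x r1 r2 : \sum_(p <- l0) dv (x :: r1) p.1 * dv (x :: r2) p.2 =
    dv (x :: rho2 x) b0 * (\sum_(p <- (a0, b0) :: l) dv (x :: r1) p.1 * dv (x :: r2) p.2)
    - dv (x :: r2) b0 * dv (x :: r1) g.
  rewrite gE !big_cons big_map /=.
  have -> : \sum_(p <- l) dv (x :: r1) p.1 *
        dv (x :: r2) (dadd (dmul (beta (a0, b0)) p.2) (dopp (dmul (beta p) b0))) =
      dv (x :: rho2 x) b0 * (\sum_(p <- l) dv (x :: r1) p.1 * dv (x :: r2) p.2)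
      - dv (x :: r2) b0 * (\sum_(p <- l) dv (x :: rho2 x) p.2 * dv (x :: r1) p.1).
    rewrite !big_distrr -sumrB /=; apply: eq_bigr => p _.
    by rewrite !dvE !betaE /=; ring.
  set S1 := \sum_(p <- l) _; set S2 := \sum_(p <- l) _; ring.
have [||c c0 [l' l'P cE]] := IHn l0; first by rewrite size_map.
  move=> rho1 rho3 x X1r X2r; rewrite l0E van // mulr0 (g_van _ X1r) mulr0.
  by rewrite subrr.
exists (dmul c (at_rho2 b0)).
  by apply: nonzero_mul => //; exists x0; rewrite at_rho2E.
exists ((g, dmul (lift c) b0) :: l').
  by move=> p; rewrite inE => /predU1P[->|/l'P //]; left.
move: (g) (l0) l0E cE => g' l0' l0E cE x r1 r2; rewrite [RHS]big_cons -cE.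
rewrite l0E [(g', _).1]/= [(g', _).2]/= (dvM [:: x]) at_rho2E (dvM (x :: r2)) liftE.
by set S := \sum_(p <- _) _; ring.
Qed.

(** Separation of variables between two groups of registers; the parameter [x] is shared by both
    factors. *)
Lemma dv_split n g : exists l : seq ((nat * nat) * (nat * nat)), forall x r1 r2,
  size r1 = n -> dv (x :: r1 ++ r2) g = \sum_(p <- l) dv (x :: r1) p.1 * dv (x :: r2) p.2.
Proof.
have ev_split u : exists l : seq ((nat * nat) * (nat * nat)), forall x r1 r2,
    size r1 = n -> (ev (x :: r1 ++ r2) u)%:R = \sum_(p <- l) dv (x :: r1) p.1 * dv (x :: r2) p.2.
  elim/ev_ind: u => [u k|u i|u a b [l lE] [l' l'E]|u a b [l lE] [l' l'E]] ev_u.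
  - exists [:: ((econst k, 0), (econst 1, 0))%N] => x r1 r2 _.
    by rewrite ev_u big_seq1 !dv_const mulr1.
  (* Index [n] is the last of [x :: r1]. A later index [i] is shifted by [n], not by [n + 1],
     because [x] heads the second group too. *)
  - exists [:: if (i <= n)%N then ((evar i, 0), (econst 1, 0))%N
               else ((econst 1, 0), (evar (i - n), 0))%N] => x r1 r2 sr1.
    rewrite ev_u big_seq1 -cat_cons nth_cat /= sr1 ltnS; case: leqP => le_i /=.
      by rewrite dv_const mulr1 dv_left evE.
    by rewrite dv_const mul1r dv_left evE -(subnSK le_i).
  - exists (l ++ l') => x r1 r2 sr1; rewrite ev_u natrD lE // l'E //.
    by rewrite big_cat.
  - exists [seq (dmul p.1 q.1, dmul p.2 q.2) | p <- l, q <- l'] => x r1 r2 sr1.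
    rewrite ev_u natrM lE // l'E // big_allpairs_dep big_distrl /=; apply: eq_bigr => p _.
    by rewrite big_distrr /=; apply: eq_bigr => q _; rewrite !dvM; ring.
have [[l lE] [l' l'E]] := (ev_split g.1, ev_split g.2).
exists (l ++ [seq (dopp p.1, p.2) | p <- l']) => x r1 r2 sr1.
rewrite big_cat big_map /dv lE // l'E // -sumrN; congr (_ + _).
by apply: eq_bigr => p _; rewrite /dv -mulNr opprB.
Qed.

Section Blocks.

Variables (m : nat) (X : nat -> (nat -> seq nat) -> Prop).
Hypothesis polyX : forall i rho, X i rho -> polynomial rho.

(* [f] lies, up to a nonzero factor depending on the parameter only, in the
   ideal generated by the polynomials that vanish on one of the blocks. *)
Definition in_sum k (f : seq nat -> int) := exists2 c, nonzero c &
  exists2 l : seq (nat * ((nat * nat) * (nat * nat))),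
    (forall p, p \in l -> (p.1 < k)%N /\ vanishes (X p.1) p.2.2) &
    forall E, size E = (k * m).+1 -> dv (take 1 E) c * f E =
      \sum_(p <- l) dv E p.2.1 * dv (block m E p.1) p.2.2.

Lemma in_sum0 k f : (forall E, size E = (k * m).+1 -> f E = 0) -> in_sum k f.
Proof.
move=> f0; exists (econst 1, 0%N); first by exists 0%N; rewrite dv_const.
by exists [::] => // E sE; rewrite f0 // mulr0 big_nil.
Qed.

Lemma in_sum_ext k f f' : in_sum k f ->
  (forall E, size E = (k * m).+1 -> f E = f' E) -> in_sum k f'.
Proof.
move=> [c c0 [l lP lE]] ff'; exists c => //; exists l => // E sE.
by rewrite -ff' // lE.
Qed.

Lemma in_sum_mul k f h : in_sum k f -> in_sum k (fun E => dv E h * f E).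
Proof.
move=> [c c0 [l lP lE]]; exists c => //.
exists [seq (p.1, (dmul h p.2.1, p.2.2)) | p <- l] => [_ /mapP[p pl ->]|E sE] /=.
  exact: lP.
rewrite big_map mulrCA lE // big_distrr /=; apply: eq_bigr => p _.
by rewrite dvM mulrA.
Qed.

Lemma in_sum_scale k f c : nonzero c -> in_sum k (fun E => dv (take 1 E) c * f E) ->
  in_sum k f.
Proof.
move=> c0 [d d0 [l lP lE]]; exists (dmul d c); first exact: nonzero_mul.
by exists l => // E sE; rewrite dvM -mulrA lE.
Qed.

(** The two factors in x are brought to their product, each multiplying the combination of the
    other. *)
Lemma in_sum_add k f f' : in_sum k f -> in_sum k f' -> in_sum k (fun E => f E + f' E).
Proof.
move=> [c c0 [l lP lE]] f'_in.
have [d dE] := dv_take 1 c.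
have [c' c'0 [l' l'P l'E]] := in_sum_mul d f'_in.
have [d' d'E] := dv_take 1 c'.
exists (dmul c' c); first exact: nonzero_mul.
exists ([seq (p.1, (dmul d' p.2.1, p.2.2)) | p <- l] ++ l') => [p|E sE].
  by rewrite mem_cat => /orP[/mapP[q /lP lq ->]|/l'P].
rewrite big_cat big_map /= -l'E // dvM dE mulrDr -!mulrA lE //; congr (_ + _).
by rewrite big_distrr /=; apply: eq_bigr => p _; rewrite dvM d'E mulrA.
Qed.

Lemma in_sum_sum k (T : eqType) (l : seq T) (F : T -> seq nat -> int) :
  (forall p, p \in l -> in_sum k (F p)) -> in_sum k (fun E => \sum_(p <- l) F p E).
Proof.
elim: l => [_|p l IHl Fl]; first by apply: in_sum0 => E _; rewrite big_nil.
have Fp := Fl p (mem_head _ _).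
have IH : in_sum k (fun E => \sum_(q <- l) F q E).
  by apply: IHl => q ql; apply: Fl; rewrite inE ql orbT.
by apply: in_sum_ext (in_sum_add Fp IH) _ => E _; rewrite big_cons.
Qed.

Lemma dv_block i g : exists g', forall E, dv E g' = dv (block m E i) g.
Proof.
have [g' g'E] := dv_comp (evar 0 :: mkseq (fun j => evar (1 + i * m + j)%N) m) g.
exists g' => E; rewrite g'E /= evE /block; congr (dv (_ :: _) _).
by rewrite -map_comp; apply: eq_map => j /=; rewrite evE.
Qed.

(** Induction on the number of blocks, the last one being split off. In the terms given by
    [vanishes_prod2], either the second factor vanishes on the last block, or the first one vanishes
    on the product of the other blocks and the induction hypothesis applies to it. *)
Lemma vanishes_prod k P : (forall i rho x, X i rho -> size (rho x) = m) ->
  (forall rhos, (forall i, (i < k)%N -> X i (rhos i)) ->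
     forall x, dv (x :: flatten [seq rhos i x | i <- iota 0 k]) P = 0) ->
  in_sum k (fun E => dv E P).
Proof.
move=> sX; elim: k P => [|k IHk] P van.
  apply: in_sum0 => -[|x [|y E]] // _.
  by apply: (van (fun _ _ => [::])).
have [l lE] := dv_split (k * m) P.
pose X1 rho := exists2 rhos, (forall i, (i < k)%N -> X i (rhos i)) &
  forall x, rho x = flatten [seq rhos i x | i <- iota 0 k].
have [|c c0 [l' l'P cE]] := @vanishes_prod2 X1 (X k) (@polyX k) l.
  move=> _ rho2 x [rhos rhosX ->] X2r.
  rewrite -lE; last by apply: flatten_env_size => i ik; apply: sX (rhosX i ik).
  pose rhos' i := if i == k then rho2 else rhos i.
  rewrite -[RHS](van rhos' _ x) => [|i].
    congr (dv (_ :: _) _); rewrite -addn1 iotaD map_cat flatten_cat /= cats0 add0n.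
    rewrite /rhos' eqxx; congr (flatten _ ++ _); apply/eq_in_map => i.
    by rewrite mem_iota /= => /ltn_eqF->.
  by rewrite /rhos' ltnS leq_eqVlt; case: eqP => [->|_ /rhosX].
apply: in_sum_scale c0 _.
pose E1 (E : seq nat) := take (k * m).+1 E.
apply: (@in_sum_ext _ (fun E => \sum_(p <- l') dv (E1 E) p.1 * dv (block m E k) p.2)); last first.
  case=> // x E [sE]; rewrite /E1 /= take0.
  have sE1 : size (take (k * m) E) = (k * m)%N by rewrite size_takel // sE mulSn leq_addl.
  have -> : block m (x :: E) k = x :: drop (k * m) E.
    congr (_ :: _); apply: (@eq_from_nth _ 0%N); rewrite size_mkseq ?size_drop ?sE ?mulSn ?addnK // => j jm.
    by rewrite nth_mkseq // nth_drop.
  by rewrite -cE -lE // cat_take_drop.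
apply: in_sum_sum => p /l'P[] van_p; last first.
  have [h hE] := dv_take (k * m).+1 p.1.
  exists (econst 1, 0%N); first by exists 0%N; rewrite dv_const.
  exists [:: (k, (h, p.2))] => [q|E sE]; first by rewrite inE => /eqP->.
  by rewrite big_seq1 dv_const mul1r hE.
have [b bE] := dv_block k p.2.
apply: (@in_sum_ext _ (fun E => dv E b * dv (E1 E) p.1)); last by move=> E _; rewrite bE mulrC.
apply: in_sum_mul.
have [|d d0 [l1 l1P l1E]] := IHk p.1.
  by move=> rhos rhosX x; apply: (van_p (fun x => flatten [seq rhos i x | i <- iota 0 k])); exists rhos.
have /choice[ext extE] := dv_take (k * m).+1.
exists d => //; exists [seq (q.1, (ext q.2.1, q.2.2)) | q <- l1].
  by move=> _ /mapP[q /l1P[qk van_q] ->]; split=> //; apply: leqW.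
move=> E sE; have sE1 : size (E1 E) = (k * m).+1.
  by rewrite size_takel // sE ltnS mulSn leq_addl.
have E10 : take 1 (E1 E) = take 1 E by rewrite /E1; case: (E) => //= y t; rewrite !take0.
rewrite -E10 l1E // big_map; rewrite big_seq [RHS]big_seq; apply: eq_bigr => q /l1P[qk _] /=.
rewrite extE; congr (_ * dv _ _); rewrite /block /E1 nth_take //; congr (_ :: _).
apply/eq_in_map => j; rewrite mem_iota /= => jm; rewrite nth_take //.
rewrite add1n addSn ltnS; apply: (@leq_trans (q.1.+1 * m)).
  by rewrite mulSn addnC ltn_add2r.
by rewrite leq_mul2r qk orbT.
Qed.

End Blocks.

End ProductOfVarieties.

(** * Completeness of certificates *)

Lemma dv_eq0 E g : (dv E g = 0)%R <-> ev E g.1 = ev E g.2.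
Proof.
rewrite /dv; split=> [/eqP|->]; last by rewrite subrr.
by rewrite subr_eq0 eqr_nat => /eqP.
Qed.

Section Certificates.

Variable s : nat.
Local Notation m := (fld s 0).
Local Notation rules := (dl s 1).

Lemma updates_vanish r g :
  r \in rules -> vanishes (reach s (fld r 0)) g ->
  forall rhos, (forall i, i < size (dl r 1) -> reach s (nth 0 (dl r 1) i) (rhos i)) ->
  forall x, dv (x :: updates m r (x :: flatten [seq rhos i x | i <- iota 0 (size (dl r 1))])) g = 0%R.
Proof.
move=> r_s van rhos rhosP x.
apply: (van (fun x => updates m r (x :: flatten [seq rhos i x | i <- iota 0 (size (dl r 1))]))).
exact: Reach r_s rhosP _.
Qed.

(** [g] after the update vanishes on the product of the reachable values of the sources, so it is a
    combination of equations of the children, each of which is expanded in the basis of its state.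
    The proof is found before the list [y], since [y] has to contain it. *)
Lemma inductive_proof_complete (G : nat -> seq (nat * nat)) r g :
  (forall q f, vanishes (reach s q) f ->
    exists2 l : seq ((nat * nat) * (nat * nat)), (forall c, c \in l -> c.2 \in G q) &
    forall E, size E = m.+1 -> dv E f = (\sum_(c <- l) dv E c.1 * dv E c.2)%R) ->
  r \in rules -> vanishes (reach s (fld r 0)) g ->
  exists pf, forall y,
    (forall q h, q \in dl r 1 -> h \in G q -> listed y q h.1 h.2 && listed y q h.2 h.1) ->
    inductive_proof s y r g.1 g.2 pf.
Proof.
move=> G_basis r_s van_g; set k := size (dl r 1).
have [P PE] := dv_comp (evar 0 :: mkseq (fun j => nth 0 (dl r 2) j) m) g.
have P_upd x E : dv (x :: E) P = dv (x :: updates m r (x :: E)) g.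
  by rewrite PE /= evE -map_comp.
have [i rho|i rho x|rhos rhosP x|c [x0 cx0] [l lP lE]] :=
    @vanishes_prod m (fun i => reach s (nth 0 (dl r 1) i)) _ k P.
- exact: reach_poly.
- exact: reach_size.
- by rewrite P_upd updates_vanish.
have /choice[basis basisP] : forall q : nat * ((nat * nat) * (nat * nat)), exists b, q \in l ->
    (forall d, d \in b -> d.2 \in G (nth 0 (dl r 1) q.1)) /\
    forall E, size E = m.+1 -> dv E q.2.2 = (\sum_(d <- b) dv E d.1 * dv E d.2)%R.
  move=> q; have [ql|_] := boolP (q \in l); last by exists [::].
  by have [b bG bE] := G_basis _ _ (lP q ql).2; exists b => _.
have /choice[at_block at_blockE] : forall q : nat * (nat * nat), exists f', forall E,
    dv E f' = dv (block m E q.1) q.2.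
  by move=> [i f] /=; apply: dv_block.
(* A product [(h - h') * (u - v)] is written [h * (u - v) + h' * (v - u)], with coefficients over
   nat; hence equations have to be listed in both orientations. *)
pose combos := flatten [seq flatten [seq
   [:: code [:: (dmul q.2.1 (at_block (q.1, d.1))).1; q.1; d.2.1; d.2.2];
       code [:: (dmul q.2.1 (at_block (q.1, d.1))).2; q.1; d.2.2; d.2.1]]
   | d <- basis q] | q <- l].
exists (code [:: c.1; c.2; x0; code combos]) => y y_G.
rewrite /inductive_proof; cbv zeta; apply/and3P; split.
- rewrite !fld_code; by apply/eqP => c12; apply: cx0; apply/dv_eq0.
- rewrite dl_code CodeSeq.codeK; apply/allP => e /flatten_mapP[q ql /flatten_mapP[d db]].
  have [dG _] := basisP q ql; have qk := (lP q ql).1.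
  have /andP[l1 l2] := y_G _ _ (mem_nth 0 qk) (dG d db).
  by rewrite !inE => /orP[] /eqP->; rewrite !fld_code /= qk ?l1 ?l2.
set E := kpoint _ _ _.
have sE : size E = (k * m).+1 by rewrite size_kpoint.
move: E sE => E sE; rewrite /side !fld_code dl_code /= CodeSeq.codeK.
have sum_int (F : nat -> nat) (t : seq nat) :
    ((sumn [seq F e | e <- t])%:R = \sum_(e <- t) (F e)%:R :> int)%R.
  by elim: t => [|e t IHt]; rewrite ?big_nil // big_cons /= natrD IHt.
pose S z := ((sumn [seq ev E (fld e 0) * ev (block m E (fld e 1)) (fld e z) | e <- combos])%:R : int)%R.
have S23 : (S 2 - S 3 = dv (take 1 E) c * dv E P)%R.
  rewrite lE // /S !sum_int -sumrB big_flatten big_map big_seq [RHS]big_seq.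
  apply: eq_bigr => q ql; have [_ ->] := basisP q ql; last by rewrite /= size_mkseq.
  rewrite big_flatten big_map big_distrr; apply: eq_bigr => d _ /=.
  rewrite big_cons big_seq1 !fld_code /=.
  transitivity (dv E (dmul q.2.1 (at_block (q.1, d.1))) * dv (block m E q.1) d.2)%R.
    by rewrite /dv !natrM; ring.
  by rewrite dvM at_blockE mulrA.
have P_E : dv E P = dv (nth 0 E 0 :: updates m r E) g.
  by case: (E) sE => // x t _; rewrite P_upd.
have takeE : take 1 E = [:: nth 0 E 0] by case: (E) sE => //= x t _; rewrite take0.
rewrite -(eqr_nat int) -subr_eq0 !natrD !natrM -/(S 2) -/(S 3); apply/eqP.
move: S23; rewrite takeE P_E /dv => S23.
have -> : S 2 = (S 3 + (S 2 - S 3))%R by rewrite addrC subrK.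
by rewrite S23; ring.
Qed.

Lemma certifies_complete : vanishing s -> exists y, certifies s y.
Proof.
move=> van_s.
have /choice[G GP] := fun q => finite_basis m.+1 (vanishes (reach s q)).
pose sources := flatten [seq dl r 1 | r <- rules].
(* The invariant consists of the bases of all states that are sources of rules, in both
   orientations, and of the final equations, which must be proved inductive as well. *)
pose T := [seq (q, g.1, g.2) | q <- sources, g <- G q]
       ++ [seq (q, g.2, g.1) | q <- sources, g <- G q]
       ++ [seq (fld f 0, fld f 1, fld f 2) | f <- dl s 2].
have T_van t : t \in T -> vanishes (reach s t.1.1) (t.1.2, t.2).
  rewrite !mem_cat => /or3P[/allpairsPdep[q [g [_ gG ->]]]|/allpairsPdep[q [g [_ gG ->]]]|].
  - by rewrite /= -surjective_pairing; apply: (GP q).1.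
  - move=> rho r_rho x; rewrite -[(_, _)]/(dopp g) dvN.
    by rewrite ((GP q).1 g gG _ r_rho) oppr0.
  - move=> /mapP[f f_s ->] rho r_rho x /=; apply/dv_eq0.
    exact: van_s r_rho _ f_s erefl _.
pose item (pf : nat * nat * nat -> nat -> nat) t :=
  code [:: t.1.1; t.1.2; t.2; code [seq pf t i | i <- iota 0 (size rules)]].
have listed_item pf t : t \in T -> listed (code [seq item pf t | t <- T]) t.1.1 t.1.2 t.2.
  move=> tT; rewrite /listed CodeSeq.codeK; apply/hasP; exists (item pf t).
    exact: map_f.
  by rewrite !fld_code /= !eqxx.
have T_G y q h : (forall t, t \in T -> listed y t.1.1 t.1.2 t.2) ->
    q \in sources -> h \in G q -> listed y q h.1 h.2 && listed y q h.2 h.1.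
  move=> yT q_s hG; rewrite (yT (q, h.1, h.2)) ?(yT (q, h.2, h.1)) //.
    by rewrite !mem_cat; apply/or3P/Or32/allpairsPdep; exists q, h.
  by rewrite mem_cat; apply/orP; left; apply/allpairsPdep; exists q, h.
have /choice[pf pfP] : forall t, exists p, forall i, t \in T -> i < size rules ->
    fld (nth 0 rules i) 0 = t.1.1 -> forall y,
    (forall t, t \in T -> listed y t.1.1 t.1.2 t.2) ->
    inductive_proof s y (nth 0 rules i) t.1.2 t.2 (p i).
  move=> t; suff /choice[p pP] : forall i, exists p, t \in T -> i < size rules ->
      fld (nth 0 rules i) 0 = t.1.1 -> forall y,
      (forall t, t \in T -> listed y t.1.1 t.1.2 t.2) ->
      inductive_proof s y (nth 0 rules i) t.1.2 t.2 p by exists p.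
  move=> i; set r := nth 0 rules i.
  have [[tT i_s rt]|] := pselect [/\ t \in T, i < size rules & fld r 0 = t.1.1]; last first.
    by move=> not_t; exists 0 => tT i_s rt; case: not_t.
  have r_s : r \in rules by apply: mem_nth.
  have [|p pP] := @inductive_proof_complete G r (t.1.2, t.2) (fun q => (GP q).2) r_s.
    by rewrite rt; apply: T_van.
  exists p => _ _ _ y yT; apply: pP => q h qr; apply: T_G => //.
  by apply/flatten_mapP; exists r.
exists (code [seq item pf t | t <- T]); apply/andP; split.
  rewrite CodeSeq.codeK; apply/allP => _ /mapP[t tT ->]; apply/allP => i.
  rewrite mem_iota /= => i_s; apply/implyP; rewrite !fld_code dl_code CodeSeq.codeK /=.
  move=> /eqP rt; rewrite (nth_map 0) ?size_iota // nth_iota // add0n.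
  by apply: pfP => // t' t'T; apply: listed_item.
apply/allP => f f_s; apply: (listed_item pf (fld f 0, fld f 1, fld f 2)).
by rewrite !mem_cat; apply/or3P/Or33/map_f.
Qed.

End Certificates.

(* Dovetailing: search for a refutation or a certificate, one of which exists. *)
Theorem vanishing_decidable : exists D : nat -> nat,
  RF D /\ forall s, decides (D s) (vanishing s).
Proof.
have ex s : exists y, refutes s y || certifies s y.
  have [/certifies_complete[y sy]|] := pselect (vanishing s).
    by exists y; rewrite sy orbT.
  by move/refutesP=> [y sy]; exists y; rewrite sy.
pose search s := ex_minn (ex s).
have r_search : RF search.
  pose g y s := nat_of_bool (~~ (refutes s y || certifies s y)).
  have rg : R2 g.
    have rp : RF (fun u => g (hd u) (tl u)).
      rewrite /g; rf; first by simple apply RB_refutes; rf.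
      by simple apply RB_certifies; rf.
    have := @recursive_comp1 2 _ _ rp (recursive_comp2 R2_pcons (recursive_nth 2 0) (recursive_nth 2 1)).
    by move/recursive_ext; apply => t /=; rewrite hd_pcons tl_pcons.
  apply: (rec_min rg) => [t|t y] /=; rewrite /search /g.
    by case: ex_minnP => y ->.
  case: ex_minnP => z _ z_min lt_yz /eqP; rewrite eqb0 negbK => /z_min.
  by rewrite leqNgt lt_yz.
exists (fun s => certifies s (search s)); split.
  by simple apply RB_certifies; rf.
move=> s; rewrite /search; case: ex_minnP => y y_ok _; split=> [van|nvan].
  case/orP: y_ok => [sy|->] //.
  by have /refutesP := ex_intro (fun y => refutes s y) y sy.
by case: (boolP (certifies s y)) => // /certifies_sound.
Qed.

(** * Hashing forests *)

(* A forest with at most one hole is hashed to an affine function of the hash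
   of the hole, given by its slope and its value at 0: sum is the product of
   affine functions (of which one is constant), and substitution composition. *)
Definition aff_mul (P Q : nat * nat) := (P.1 * Q.2 + Q.1 * P.2, P.2 * Q.2).
Definition aff_root x c (P : nat * nat) := (x * P.1, x * P.2 + c).
Definition aff_comp (P Q : nat * nat) := (P.1 * Q.1, P.1 * Q.2 + P.2).

Lemma aff_mulA : associative aff_mul.
Proof. by move=> [a b] [c d] [e f]; rewrite /aff_mul /=; congr (_, _); ring. Qed.
Lemma aff_mulC : commutative aff_mul.
Proof. by move=> [a b] [c d]; rewrite /aff_mul /=; congr (_, _); ring. Qed.
Lemma aff_mul1 : left_id (0, 1) aff_mul.
Proof. by move=> [a b]; rewrite /aff_mul /=; congr (_, _); ring. Qed.

(** [aff_mul] drops the quadratic term of the product, so composition distributes over it only when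
    that term is 0, that is, when the hole occurs in one factor at most. *)
Lemma aff_mul_comp P P' Q : P.1 * P'.1 = 0 ->
  aff_comp (aff_mul P P') Q = aff_mul (aff_comp P Q) (aff_comp P' Q).
Proof.
case: P P' Q => [a b] [c d] [e f] /= ac; rewrite /aff_comp /aff_mul /=; congr (_, _).
  have -> : a * e * (c * f + d) + c * e * (a * f + b) = 2 * (a * c) * (e * f) + (a * d + c * b) * e by ring.
  by rewrite ac muln0 mul0n.
have -> : (a * f + b) * (c * f + d) = a * c * f * f + ((a * d + c * b) * f + b * d) by ring.
by rewrite ac.
Qed.

Section Hash.

Variables (Sigma : finType) (p : nat).
Implicit Types (t : otree Sigma) (s h g : seq (otree Sigma)).
Local Notation canon := (@Defs.canon Sigma).

(** For [n <= #|Sigma|] and [#|Sigma|.+1 < p] these are distinct multiples of [p] that [p ^ 2] does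
    not divide, as Eisenstein's criterion requires. *)
Definition letter_hash (n : nat) := n.+1 * p.

Fixpoint tree_hash x t : nat * nat :=
  if t is Node a s then
    aff_root x (letter_hash (enum_rank a)) (foldr aff_mul (0, 1) (map (tree_hash x) s))
  else (1, 0).

Definition forest_hash x s := foldr aff_mul (0, 1) (map (tree_hash x) s).

Lemma forest_hash_cat x s1 s2 :
  forest_hash x (s1 ++ s2) = aff_mul (forest_hash x s1) (forest_hash x s2).
Proof.
elim: s1 => [|t s1 IH]; first by rewrite [RHS]aff_mul1.
by rewrite /= -aff_mulA -IH.
Qed.

Lemma perm_forest_hash x s1 s2 : perm_eq s1 s2 -> forest_hash x s1 = forest_hash x s2.
Proof.
move=> s12; apply: (catCA_perm_subst _ s12) => t1 t2 t3.
by rewrite !forest_hash_cat !aff_mulA (aff_mulC (forest_hash x t1)).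
Qed.

Lemma tree_hash_canon x t : tree_hash x (canon t) = tree_hash x t.
Proof.
elim/otree_nested_ind: t => //= a s IHs; congr aff_root.
rewrite -/(forest_hash x _) -/(forest_hash x s) (@perm_forest_hash _ _ (map canon s)) ?perm_sort //.
by elim: s IHs => //= t s IHs [IHt /IHs{}IHs]; rewrite /forest_hash /= IHt -/(forest_hash x _) IHs.
Qed.

Lemma forest_hash_eqv x s1 s2 : forest_eqv s1 s2 -> forest_hash x s1 = forest_hash x s2.
Proof.
have canonE s : forest_hash x (map canon s) = forest_hash x s.
  by elim: s => //= t s IHs; rewrite /forest_hash /= tree_hash_canon -/(forest_hash x _) IHs.
by rewrite forest_eqvE => /(@perm_forest_hash x); rewrite !canonE.
Qed.

Lemma forest_hash_closed x s : forest_holes s = 0 -> (forest_hash x s).1 = 0.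
Proof.
have closed_forest u : All (fun t => tree_holes t = 0 -> (tree_hash x t).1 = 0) u ->
    forest_holes u = 0 -> (forest_hash x u).1 = 0.
  elim: u => //= t u IHu [IHt /IHu{}IHu] /eqP.
  rewrite /forest_holes /= addn_eq0 => /andP[/eqP/IHt t0 /eqP/IHu u0].
  by rewrite /forest_hash /= t0 -/(forest_hash x u) u0.
apply: (closed_forest); elim: s => //= t s IHs; split=> //.
elim/otree_nested_ind: t => //= a u IHu u0.
by rewrite -/(forest_hash x u) (closed_forest _ IHu) ?muln0.
Qed.

Lemma holes_le1_cons t s : forest_holes (t :: s) <= 1 ->
  [/\ tree_holes t <= 1, forest_holes s <= 1 & tree_holes t = 0 \/ forest_holes s = 0].
Proof. by rewrite /forest_holes /= => ts1; split; lia. Qed.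

Lemma tree_hash_closed x t : tree_holes t = 0 -> (tree_hash x t).1 = 0.
Proof.
move=> t0; have := @forest_hash_closed x [:: t].
by rewrite /forest_holes /forest_hash /= t0 muln1 => /(_ erefl)/eqP; rewrite addn0 => /eqP.
Qed.

Lemma forest_hash_subst x h g : forest_holes h <= 1 ->
  forest_hash x (forest_subst h g) = aff_comp (forest_hash x h) (forest_hash x g).
Proof.
have subst_forest s : All (fun t => tree_holes t <= 1 ->
      forest_hash x (tree_subst g t) = aff_comp (tree_hash x t) (forest_hash x g)) s ->
    forest_holes s <= 1 ->
    forest_hash x (forest_subst s g) = aff_comp (forest_hash x s) (forest_hash x g).
  elim: s => [|t s IHs] /=; first by move=> _ _; rewrite /aff_comp /= mul0n.
  move=> [IHt /IHs{}IHs] /holes_le1_cons[t1 s1 ts0].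
  rewrite /forest_subst /= forest_hash_cat IHt // -/(forest_subst s g) IHs //.
  rewrite /forest_hash /= -/(forest_hash x s) aff_mul_comp //.
  case: ts0 => [/(tree_hash_closed x)->//|/(forest_hash_closed x)->]; exact: muln0.
have subst_tree t : tree_holes t <= 1 ->
    forest_hash x (tree_subst g t) = aff_comp (tree_hash x t) (forest_hash x g).
  elim/otree_nested_ind: t => [_|a s /subst_forest IHs s1] /=.
    by case: (forest_hash x g) => a b; rewrite /aff_comp /= !mul1n addn0.
  rewrite /forest_hash /= -/(forest_hash x _) -/(forest_subst s g) IHs //.
  rewrite aff_mulC aff_mul1 /aff_comp /aff_root /= -/(forest_hash x s).
  by congr (_, _); ring.
by apply: subst_forest; elim: h => //= t h IHh; split=> //; apply: subst_tree.
Qed.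

(** * Injectivity of the hash *)

Section Injectivity.

Hypotheses (p_prime : prime p) (p_big : #|Sigma|.+1 < p).

Local Open Scope ring_scope.

Definition root_const t : nat :=
  if t is Node a _ then letter_hash (enum_rank a) else letter_hash #|Sigma|.

(** The hole is treated as a leaf with an additional letter, numbered [#|Sigma|]. Contexts then
    become ordinary polynomials, to which unique factorization applies. *)
Fixpoint tree_poly t : {poly int} :=
  if t is Node a s then
    'X * (\big[*%R/1]_(q <- map tree_poly s) q) + (letter_hash (enum_rank a))%:R%:P
  else 'X + (letter_hash #|Sigma|)%:R%:P.

Definition forest_poly s : {poly int} := \prod_(t <- s) tree_poly t.

Definition sub_forest t := if t is Node _ s then s else [::].

Lemma tree_polyE t : tree_poly t = 'X * forest_poly (sub_forest t) + (root_const t)%:R%:P.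
Proof.
by case: t => [|a s] /=; rewrite /forest_poly ?big_nil ?mulr1 // big_map.
Qed.

(** The polynomial is the affine hash applied to the value of the hole. With two holes this would
    fail, as [aff_mul] has no quadratic term. *)
Lemma forest_poly_hash x s : (forest_holes s <= 1)%N -> (forest_poly s).[x%:R] =
  (forest_hash x s).1%:R * (x%:R + (letter_hash #|Sigma|)%:R) + (forest_hash x s).2%:R.
Proof.
have hash_forest u : All (fun t => (tree_holes t <= 1)%N -> (tree_poly t).[x%:R] =
      (tree_hash x t).1%:R * (x%:R + (letter_hash #|Sigma|)%:R) + (tree_hash x t).2%:R) u ->
    (forest_holes u <= 1)%N -> (forest_poly u).[x%:R] =
      (forest_hash x u).1%:R * (x%:R + (letter_hash #|Sigma|)%:R) + (forest_hash x u).2%:R.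
  rewrite /forest_poly; elim: u => [|t u IH] /=.
    by move=> _ _; rewrite big_nil hornerC mul0r add0r.
  move=> [IHt /IH{}IH] /holes_le1_cons[/IHt{}IHt /IH{}IH tu0].
  rewrite big_cons hornerM IHt IH /forest_hash /= -/(forest_hash x u).
  have tu : ((tree_hash x t).1 * (forest_hash x u).1 = 0)%N.
    by case: tu0 => [/(tree_hash_closed x)->//|/(forest_hash_closed x)->]; apply: muln0.
  have {}tu : ((tree_hash x t).1%:R * (forest_hash x u).1%:R = 0 :> int) by rewrite -natrM tu.
  rewrite !natrD !natrM; move: tu; set A := _%:R; set B := _%:R => AB0.
  set y : int := x%:R + _; set C : int := (tree_hash x t).2%:R; set D : int := (forest_hash x u).2%:R.
  transitivity (A * B * y * y + ((A * D + B * C) * y + C * D)); first by ring.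
  by rewrite AB0; ring.
apply: (hash_forest); elim: s => //= t s IHs; split=> // {IHs}.
elim/otree_nested_ind: t => [_|a u /hash_forest IHu u1].
  by rewrite /= hornerD hornerX hornerC mulr1n mulr0n mul1r addr0.
rewrite tree_polyE hornerD hornerM hornerX hornerC IHu //= -/(forest_hash x u).
by rewrite !natrD !natrM; ring.
Qed.

(* The shape [X^k + p R], with [deg R < k], to which Eisenstein's criterion is
   applied; it is inherited by products. *)
Definition eis k (q : {poly int}) := exists2 r : {poly int}, (size r <= k)%N & q = 'X^k + p%:R *: r.

Lemma eis_mul k l q r : eis k q -> eis l r -> eis (k + l) (q * r).
Proof.
move=> [q' sq ->] [r' sr ->].
exists ('X^k * r' + 'X^l * q' + p%:R *: (q' * r')).
  rewrite !(leq_trans (size_polyD _ _)) // geq_max (leq_trans (size_polyD _ _)) /=; last first.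
    rewrite geq_max !(leq_trans (size_polyMleq _ _)) // size_polyXn addSn /= ?leq_add2l //.
    by rewrite addnC leq_add2r.
  rewrite (leq_trans (size_scale_leq _ _)) // (leq_trans (size_polyMleq _ _)) //.
  by rewrite (leq_trans (leq_pred _)) // leq_add.
by rewrite exprD -!mul_polyC; ring.
Qed.

Lemma eis_monic k q : eis k q -> q \is monic /\ size q = k.+1.
Proof.
move=> [r sr ->]; have sr' : (size (p%:R *: r) < size ('X^k : {poly int}))%N.
  by rewrite size_polyXn ltnS (leq_trans (size_scale_leq _ _)).
by rewrite size_polyDl // size_polyXn monicE lead_coefDl // lead_coefXn.
Qed.

Fixpoint tree_size t : nat := if t is Node _ s then (sumn (map tree_size s)).+1 else 1%N.

Definition forest_size s := sumn (map tree_size s).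

Lemma forest_eis s : eis (forest_size s) (forest_poly s).
Proof.
have eis1 : eis 0 1 by exists 0; rewrite ?size_poly0 // scaler0 addr0.
have eis_forest u : All (fun t => eis (tree_size t) (tree_poly t)) u ->
    eis (forest_size u) (forest_poly u).
  rewrite /forest_poly; elim: u => [|t u IHu] /=; first by rewrite big_nil.
  by move=> [IHt /IHu{}IHu]; rewrite big_cons; apply: eis_mul.
apply: (eis_forest); elim: s => //= t s IHs; split=> // {IHs}.
elim/otree_nested_ind: t => [|a u /eis_forest[r sr uE]] /=.
  exists (#|Sigma|.+1%:R)%:P; first by rewrite size_polyC; case: eqP.
  by rewrite -mul_polyC -polyCM /letter_hash natrM mulrC.
rewrite big_map -/(forest_poly u) uE.
exists ('X * r + ((enum_rank a).+1%:R)%:P).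
  rewrite (leq_trans (size_polyD _ _)) // geq_max (leq_trans (size_polyMleq _ _)) ?size_polyX ?ltnS //.
  by rewrite (leq_trans (size_polyC_leq1 _)).
by rewrite exprS -!mul_polyC /letter_hash natrM polyCM; ring.
Qed.

Lemma tree_poly1 t : forest_poly [:: t] = tree_poly t.
Proof. by rewrite /forest_poly big_seq1. Qed.

Lemma tree_poly_monic t : tree_poly t \is monic.
Proof. by rewrite -tree_poly1; case: (eis_monic (forest_eis [:: t])). Qed.

Lemma size_tree_poly t : size (tree_poly t) = (tree_size t).+1.
Proof.
by rewrite -tree_poly1; have [_ ->] := eis_monic (forest_eis [:: t]); rewrite /forest_size /= addn0.
Qed.

Lemma tree_size_gt0 t : (0 < tree_size t)%N. Proof. by case: t. Qed.

(** The constant coefficient is [p] times the positive number of the root label, which is less than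
    [p]. *)
Lemma tree_poly_irreducible t : irreducible_poly (tree_poly t).
Proof.
apply: (eisenstein_crit p_prime).
- by rewrite size_tree_poly eqSS -lt0n tree_size_gt0.
- rewrite (monicP (tree_poly_monic t)) dvdzE /= dvdn1.
  by case: p p_prime => [|[]].
- rewrite tree_polyE coefD coefXM coefC /= add0r dvdzE natz /=.
  have -> : root_const t = ((if t is Node a _ then (enum_rank a : nat) else #|Sigma|).+1 * p)%N.
    by case: t.
  rewrite -[(p ^+ 2)%R]/(p * p)%N dvdn_pmul2r ?prime_gt0 // gtnNdvd //.
  by case: t => // a _; apply: leq_ltn_trans p_big; rewrite ltnS ltnW.
move=> i; rewrite size_tree_poly /= => it.
have [r sr] := forest_eis [:: t]; rewrite tree_poly1 => ->.
rewrite coefD coefXn coefZ /forest_size /= addn0 (ltn_eqF it) add0r.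
by rewrite dvdz_mulr // natz.
Qed.

(** An irreducible divisor of a product divides a factor; that factor is irreducible too and both
    are monic, hence they are equal. *)
Lemma tree_poly_dvd_forest t s : tree_poly t %| forest_poly s ->
  exists2 u, u \in s & tree_poly t = tree_poly u.
Proof.
have irr_t := tree_poly_irreducible t.
rewrite /forest_poly; elim: s => [|u s IHs].
  rewrite big_nil dvdp1 size_tree_poly eqSS => /eqP t0.
  by have := tree_size_gt0 t; rewrite t0.
rewrite big_cons; have [tu _|] := boolP (tree_poly t %| tree_poly u).
  exists u; first exact: mem_head.
  have : tree_poly t %= tree_poly u.
    by apply: (tree_poly_irreducible u) => //; rewrite size_tree_poly eqSS -lt0n tree_size_gt0.
  by rewrite eqp_monic ?tree_poly_monic // => /eqP.
rewrite -irreducible_poly_coprime // => tu; rewrite Gauss_dvdpr // => /IHs[v vs ->].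
by exists v; rewrite // inE vs orbT.
Qed.

(** The root label is read off the constant coefficient; what remains is the indeterminate times the
    polynomial of the children. *)
Lemma root_const_inj t u : tree_poly t = tree_poly u ->
  root_const t = root_const u /\ forest_poly (sub_forest t) = forest_poly (sub_forest u).
Proof.
rewrite !tree_polyE => tu.
have /eqP : (root_const t)%:R = (root_const u)%:R :> int.
  by have := congr1 (fun q : {poly int} => q`_0) tu; rewrite !coefD !coefXM !coefC !add0r.
rewrite eqr_nat => /eqP tu0; split=> //; move: tu; rewrite tu0.
by move=> /addIr/mulfI; apply; rewrite polyX_eq0.
Qed.

(** The polynomial of a tree [t] of [s1] is that of some [u] in [s2]. Induction on the size shows
    that [t] and [u] have equivalent children, and, after cancelling the common factor, that the
    remaining trees match. A hole is not confused with a node, its number being no rank of a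
    letter. *)
Lemma forest_poly_inj s1 s2 : forest_poly s1 = forest_poly s2 -> forest_eqv s1 s2.
Proof.
rewrite forest_eqvE; have [n] := ubnP (forest_size s1).
elim: n s1 s2 => // n IHn [|t s1] s2 /= le_n s12.
  case: s2 s12 => //= u s2 /(congr1 (fun q : {poly int} => size q)).
  rewrite /forest_poly big_nil size_poly1 -/(forest_poly (u :: s2)).
  have [_ ->] := eis_monic (forest_eis (u :: s2)); rewrite /forest_size /= => - [] /esym/eqP.
  by rewrite addn_eq0 eqn0Ngt tree_size_gt0.
have [|u u_s2 tu] := @tree_poly_dvd_forest t s2.
  by rewrite -s12 /forest_poly big_cons dvdp_mulr.
have [c_tu sub_tu] := root_const_inj tu.
have canon_tu : canon t = canon u.
  have p0 : (0 < p)%N by apply: prime_gt0.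
  case: t u {u_s2 tu s12} c_tu sub_tu le_n => [|a ts] [|b us] //=.
  - rewrite /letter_hash => /eqP; rewrite eqn_pmul2r // eqSS => /eqP c_b.
    by have := ltn_ord (enum_rank b); rewrite -c_b ltnn.
  - rewrite /letter_hash => /eqP; rewrite eqn_pmul2r // eqSS => /eqP c_a.
    by have := ltn_ord (enum_rank a); rewrite c_a ltnn.
  rewrite /letter_hash => /eqP; rewrite eqn_pmul2r // eqSS => /eqP/val_inj/enum_rank_inj -> ts_us.
  rewrite /forest_size /= -/(forest_size ts) addSn ltnS => le_n; congr (Node _ _); apply/eqP.
  by rewrite perm_sort_leT IHn //; apply: leq_ltn_trans le_n; apply: leq_addr.
have s2_split := perm_to_rem u_s2.
rewrite (permPr (perm_map canon s2_split)) /= canon_tu perm_cons; apply: IHn.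
  move: le_n; rewrite ltnS; apply: leq_trans; rewrite /forest_size /= -[X in (X < _)%N]add0n.
  by rewrite ltn_add2r tree_size_gt0.
move: s12; rewrite /forest_poly (perm_big _ s2_split) /= !big_cons tu => /mulfI; apply.
by rewrite monic_neq0 ?tree_poly_monic.
Qed.

End Injectivity.

End Hash.

(** * Compilation of automata into polynomial systems *)

(* Symbolic affine functions: the codes of the slope and of the value at 0. *)
Definition cconst a b := code [:: econst a; econst b].
Definition cvar i := code [:: evar i; evar i.+1].
Definition cmul P Q :=
  code [:: eadd (emul (fld P 0) (fld Q 1)) (emul (fld Q 0) (fld P 1)); emul (fld P 1) (fld Q 1)].
Definition croot c P :=
  code [:: emul (evar 0) (fld P 0); eadd (emul (evar 0) (fld P 1)) (econst c)].
Definition ccomp P Q :=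
  code [:: emul (fld P 0) (fld Q 0); eadd (emul (fld P 0) (fld Q 1)) (fld P 1)].
Definition cswap P := code [:: fld P 1; fld P 0].

Definition cev E P : nat * nat := (ev E (fld P 0), ev E (fld P 1)).

Lemma cev_const E a b : cev E (cconst a b) = (a, b).
Proof. by rewrite /cev !fld_code /= !evE. Qed.
Lemma cev_var E i : cev E (cvar i) = (nth 0 E i, nth 0 E i.+1).
Proof. by rewrite /cev !fld_code /= !evE. Qed.
Lemma cev_mul E P Q : cev E (cmul P Q) = aff_mul (cev E P) (cev E Q).
Proof. by rewrite /cev !fld_code /= !evE. Qed.
Lemma cev_root E c P : cev E (croot c P) = aff_root (nth 0 E 0) c (cev E P).
Proof. by rewrite /cev !fld_code /= !evE. Qed.
Lemma cev_comp E P Q : cev E (ccomp P Q) = aff_comp (cev E P) (cev E Q).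
Proof. by rewrite /cev !fld_code /= !evE. Qed.
Lemma cev_swap E P : cev E (cswap P) = ((cev E P).2, (cev E P).1).
Proof. by rewrite /cev !fld_code. Qed.

Lemma RF_cconst a b : RF a -> RF b -> RF (fun e => cconst (a e) (b e)).
Proof. by move=> *; rewrite /cconst /econst; rf. Qed.
Lemma RF_cvar i : RF i -> RF (fun e => cvar (i e)).
Proof. by move=> *; rewrite /cvar /evar; rf. Qed.
Lemma RF_cmul P Q : RF P -> RF Q -> RF (fun e => cmul (P e) (Q e)).
Proof. by move=> *; rewrite /cmul /eadd /emul; rf. Qed.
Lemma RF_croot c P : RF c -> RF P -> RF (fun e => croot (c e) (P e)).
Proof. by move=> *; rewrite /croot /eadd /emul /evar /econst; rf. Qed.
Lemma RF_ccomp P Q : RF P -> RF Q -> RF (fun e => ccomp (P e) (Q e)).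
Proof. by move=> *; rewrite /ccomp /eadd /emul; rf. Qed.
Lemma RF_cswap P : RF P -> RF (fun e => cswap (P e)).
Proof. by move=> *; rewrite /cswap; rf. Qed.

Ltac rf_user ::= first [simple apply RF_cconst | simple apply RF_cvar | simple apply RF_cmul
  | simple apply RF_croot | simple apply RF_ccomp | simple apply RF_cswap ].

Section Compilation.

Variable p : nat.

(** The hole is encoded by [code [::]], which is 0; the code of a node is positive. *)
Definition ctree_step n L :=
  if n == 0 then cconst 1 0
  else croot (letter_hash p (fld n 0)) (foldr cmul (cconst 0 1) (behead L)).

Definition ctree n := cfold ctree_step n.

Definition cforest n := foldr cmul (cconst 0 1) [seq ctree t | t <- decode n].

Definition cterm_step (base : nat -> nat) n L :=
  if fld n 0 == 0 then cvar (base (fld n 1))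
  else if fld n 0 == 1 then cforest (fld n 1)
  else if fld n 0 == 2 then cmul (nth 0 L 1) (nth 0 L 2)
  else if fld n 0 == 3 then croot (letter_hash p (fld n 1)) (nth 0 L 2)
  else ccomp (nth 0 L 1) (nth 0 L 2).

Definition cterm base n := cfold (cterm_step base) n.

Lemma RF_ctree n : RF n -> RF (fun e => ctree (n e)).
Proof. by move=> *; rewrite /ctree /ctree_step /letter_hash; rf. Qed.

Lemma RF_cterm base n : RF (fun u => base (tl u) (hd u)) -> RF n ->
  RF (fun e => cterm (base e) (n e)).
Proof.
move=> rb rn; rewrite /cterm /cterm_step /cforest /letter_hash; rf.
  have := RF_comp rb (_ : RF (fun u => pcons (fld (hd u) 1) (tl (tl u)))).
  by move/(_ (RF_pcons _ _))/RF_ext; apply; [rf | rf | move=> u; rewrite tl_pcons hd_pcons].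
by simple apply RF_ctree; rf.
Qed.

(* The affine value of register [j] of child [i], for [m] numbers per child,
   the registers of the automaton starting at offset [off]. *)
Definition child_var m off v := 1 + fld v 0 * m + (off + 2 * fld v 1).
Definition state_var off v := 1 + (off + 2 * v).

Definition cupdates m off r :=
  flatten [seq decode (cterm (child_var m off) t) | t <- dl r 3].

Definition pair_rule m off r1 r2 :=
  code [:: code [:: fld r1 2; fld r2 2];
           code (mkseq (fun i => code [:: nth 0 (dl r1 1) i; nth 0 (dl r2 1) i]) (size (dl r1 1)));
           code (cupdates m 0 r1 ++ cupdates m off r2)].

(** A missing final function is coded by 0. Equality of two affine hashes takes two equations, one
    for the slopes and one for the values at 0. *)
Definition pair_final off q1 q2 f1 f2 :=
  let P1 := cterm (state_var 0) (fld f1 0) in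
  let P2 := cterm (state_var off) (fld f2 0) in
  if (f1 == 0) || (f2 == 0) then [::]
  else [:: code [:: code [:: q1; q2]; fld P1 0; fld P2 0];
           code [:: code [:: q1; q2]; fld P1 1; fld P2 1]].

(** The product of two automata on a common input tree; the registers of the second start at offset
    [off]. *)
Definition pair_system e1 e2 :=
  let off := 2 * fld e1 1 in
  let m := off + 2 * fld e2 1 in
  code [:: m;
    code (flatten [seq flatten [seq if fld r1 0 == fld r2 0 then [:: pair_rule m off r1 r2] else [::]
                               | r2 <- dl e2 3] | r1 <- dl e1 3]);
    code (flatten [seq flatten [seq pair_final off q1 q2 (nth 0 (dl e1 4) q1) (nth 0 (dl e2 4) q2)
                               | q2 <- iota 0 (size (dl e2 4))] | q1 <- iota 0 (size (dl e1 4))])].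

(* Truth values [b] are represented by [(~~ b, b)]: composition is disjunction,
   and exchanging the components is negation. *)
Definition call m r2 :=
  cswap (foldr (fun i acc => ccomp (cswap (cvar (child_var m 0 (code [:: i; nth 0 (dl r2 1) i])))) acc)
    (cconst 1 0) (iota 0 (size (dl r2 1)))).

Definition chas m e2 r1 q :=
  foldr (fun r2 acc => if (fld r2 0 == fld r1 0) && (fld r2 2 == q) then ccomp (call m r2) acc else acc)
    (cconst 1 0) (dl e2 3).

(** The component 0 holds the negation; the final equations of [domain_system] require it to be
    0. *)
Definition caccept e2 :=
  foldr (fun q acc => if nth 0 (dl e2 4) q == 0 then acc else ccomp (cvar (state_var 0 q)) acc)
    (cconst 1 0) (iota 0 (size (dl e2 4))).

(* The runs of the first automaton, paired with the set of states that the
   second one can reach on the same tree. *)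
Definition domain_system e1 e2 :=
  let n2 := size (dl e2 4) in
  let m := 2 * n2 in
  code [:: m;
    code [seq code [:: fld r1 2; fld r1 1;
                       code (flatten [seq decode (chas m e2 r1 q) | q <- iota 0 n2])] | r1 <- dl e1 3];
    code (flatten [seq if nth 0 (dl e1 4) q1 == 0 then [::]
                       else [:: code [:: q1; fld (caccept e2) 0; econst 0]]
                  | q1 <- iota 0 (size (dl e1 4))])].

Lemma RF_child_var m off v : RF m -> RF off -> RF v -> RF (fun e => child_var (m e) (off e) (v e)).
Proof. by move=> *; rewrite /child_var; rf. Qed.
Lemma RF_state_var off v : RF off -> RF v -> RF (fun e => state_var (off e) (v e)).
Proof. by move=> *; rewrite /state_var; rf. Qed.
End Compilation.

Ltac rf_user ::= first [simple apply RF_cconst | simple apply RF_cvar | simple apply RF_cmul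
  | simple apply RF_croot | simple apply RF_ccomp | simple apply RF_cswap
  | simple apply RF_child_var | simple apply RF_state_var | simple apply RF_cterm ].

Lemma RF_pair_system p a b : RF a -> RF b -> RF (fun e => pair_system p (a e) (b e)).
Proof. by move=> *; rewrite /pair_system /pair_rule /pair_final /cupdates; cbv zeta; rf. Qed.

Lemma RF_call m r : RF m -> RF r -> RF (fun e => call (m e) (r e)).
Proof. by move=> *; rewrite /call; rf. Qed.

Ltac rf_user ::= first [simple apply RF_cconst | simple apply RF_cvar | simple apply RF_cmul
  | simple apply RF_croot | simple apply RF_ccomp | simple apply RF_cswap
  | simple apply RF_child_var | simple apply RF_state_var | simple apply RF_call ].

Lemma RF_domain_system a b : RF a -> RF b -> RF (fun e => domain_system (a e) (b e)).
Proof.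
by move=> *; rewrite /domain_system /chas /caccept /econst; cbv zeta; rf.
Qed.

Local Open Scope quotient_scope.

Section UForestHash.

Variables (Sigma : finType) (p : nat).
Hypotheses (p_prime : prime p) (p_big : #|Sigma|.+1 < p).
Implicit Types (u v g h : uforest Sigma).

Definition uhash x u := forest_hash p x (repr u).

Lemma uhash_pi x s : uhash x (\pi_(uforest Sigma) s) = forest_hash p x s.
Proof. exact/forest_hash_eqv/repr_eqv. Qed.

Lemma uhash_add x u v : uhash x (uadd u v) = aff_mul (uhash x u) (uhash x v).
Proof. by rewrite uhash_pi forest_hash_cat. Qed.

Lemma uhash_root x a u :
  uhash x (uroot a u) = aff_root x (letter_hash p (enum_rank a)) (uhash x u).
Proof. by rewrite uhash_pi /forest_hash /= aff_mulC aff_mul1. Qed.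

Lemma uhash_subst x h g : holes h <= 1 ->
  uhash x (usubst h g) = aff_comp (uhash x h) (uhash x g).
Proof. by move=> h1; rewrite uhash_pi forest_hash_subst. Qed.

(** Equal hashes for all [x] give polynomials that agree at all natural numbers, hence equal
    polynomials. *)
Lemma uhash_inj u v : holes u <= 1 -> holes v <= 1 ->
  (forall x, uhash x u = uhash x v) -> u = v.
Proof.
move=> u1 v1 uv; rewrite -(reprK u) -(reprK v); apply/pi_eqv.
apply: (forest_poly_inj p_prime p_big).
apply/subr0_eq/poly_eq0_nat => x.
have hash_poly (w : uforest Sigma) : holes w <= 1 -> ((forest_poly p (repr w)).[x%:R] = (uhash x w).1%:R *
    (x%:R + (letter_hash p #|Sigma|)%:R) + (uhash x w).2%:R)%R.
  by move=> w1; apply: forest_poly_hash.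
by rewrite hornerD hornerN !hash_poly // uv subrr.
Qed.

End UForestHash.

(** * Runs of automata *)

Section Runs.

Variables (Sigma : finType) (Gamma : signature).
Implicit Types (M : automaton Sigma Gamma) (t : ranked_tree Gamma).

Definition tree_symbol t : Gamma := let: RNode a _ := t in a.
Definition tree_children t : seq (ranked_tree Gamma) :=
  let: RNode a ts := t in [seq ts i | i <- enum 'I_(rank a)].
(** Children indexed by numbers, so that two rules with the same symbol can be compared without
    transport; [t] itself is the default value. *)
Definition child t i := nth t (tree_children t) i.

Lemma child_RNode a (ts : 'I_(rank a) -> ranked_tree Gamma) (i : 'I_(rank a)) :
  child (RNode ts) i = ts i.
Proof. by rewrite /child (nth_map i) ?size_enum_ord // nth_ord_enum. Qed.

Lemma ranked_tree_child_ind (P : ranked_tree Gamma -> Prop) :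
  (forall t, (forall i, i < rank (tree_symbol t) -> P (child t i)) -> P t) -> forall t, P t.
Proof.
move=> IH; elim=> a ts IHts; apply: IH => i ia.
by rewrite -[i]/(nat_of_ord (Ordinal ia)) child_RNode.
Qed.

(** Registers are compared through [val] because [rule_target r = q] is only propositional: the two
    sides live in different types. *)
Lemma run_inv M t (q : state M) (rs : forall j, UCF Sigma (reg_sort q j)) : run t rs ->
  exists r, [/\ List.In r (rules M), tree_symbol t = rule_symbol r, rule_target r = q &
    exists2 rs' : forall i j, UCF Sigma (reg_sort (rule_source r i) j),
      (forall i : 'I_(rank (rule_symbol r)), run (child t i) (rs' i)) &
      forall j, val (rs j) = val (eval (fun y => rs' y.1 y.2) (rule_update r j))].
Proof.
case=> r r_M ts rs' runs; exists r; split=> //; exists rs' => // i.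
by rewrite child_RNode.
Qed.

Lemma run_intro M t r (rs' : forall i j, UCF Sigma (reg_sort (rule_source r i) j)) :
  List.In r (rules M) -> tree_symbol t = rule_symbol r ->
  (forall i : 'I_(rank (rule_symbol r)), run (child t i) (rs' i)) ->
  run t (fun j => eval (fun y => rs' y.1 y.2) (rule_update r j)).
Proof.
case: t => a ts r_M /= ar; subst a => runs; apply: Run => // i.
by have := runs i; rewrite child_RNode.
Qed.

Section Values.

Variable p : nat.

Definition reg_hash x n (ty : 'I_n -> bool) (rs : forall j, UCF Sigma (ty j)) : seq nat :=
  flatten [seq [:: (uhash p x (val (rs j))).1; (uhash p x (val (rs j))).2] | j <- enum 'I_n].

Lemma flatten_pairs_size (T : Type) (a b : T -> nat) s :
  size (flatten [seq [:: a j; b j] | j <- s]) = 2 * size s.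
Proof. by elim: s => //= j s ->; rewrite mulnS. Qed.

Lemma nth_flatten_pairs (T : Type) (a b : T -> nat) s i :
  nth 0 (flatten [seq [:: a j; b j] | j <- s]) (2 * i) = nth 0 (map a s) i /\
  nth 0 (flatten [seq [:: a j; b j] | j <- s]) (2 * i).+1 = nth 0 (map b s) i.
Proof.
elim: s i => [|j s IHs] i; first by rewrite !nth_nil.
by case: i => [|i] //; rewrite mulnS add2n; apply: IHs.
Qed.

Lemma size_reg_hash x n (ty : 'I_n -> bool) (rs : forall j, UCF Sigma (ty j)) :
  size (reg_hash x rs) = 2 * n.
Proof. by rewrite flatten_pairs_size size_enum_ord. Qed.

Lemma nth_reg_hash x n (ty : 'I_n -> bool) (rs : forall j, UCF Sigma (ty j)) (j : 'I_n) :
  (nth 0 (reg_hash x rs) (2 * j), nth 0 (reg_hash x rs) (2 * j).+1) = uhash p x (val (rs j)).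
Proof.
have [-> ->] := nth_flatten_pairs (fun j => (uhash p x (val (rs j))).1)
  (fun j => (uhash p x (val (rs j))).2) (enum 'I_n) j.
have nthE (f : 'I_n -> nat) : nth 0 [seq f i | i <- enum 'I_n] j = f j.
  by rewrite (nth_map j) ?size_enum_ord // nth_ord_enum.
by rewrite !nthE -surjective_pairing.
Qed.

Lemma cev_tree E (t : otree Sigma) :
  cev E (ctree p (encode_otree t)) = tree_hash p (nth 0 E 0) t.
Proof.
elim/otree_nested_ind: t => [|a s IHs] /=.
  by rewrite /ctree cfoldE /ctree_step /= cev_const.
rewrite /ctree cfold_code /ctree_step fld_code ifF; last first.
  by rewrite code_cons muln_eq0 expn_eq0.
rewrite cev_root /=; congr aff_root.
elim: s IHs => [|t s IHs] /=; first by rewrite cev_const.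
by move=> [IHt /IHs{}IHs]; rewrite cev_mul IHs -IHt.
Qed.

Lemma cev_forest E b (c : UCF Sigma b) :
  cev E (cforest p (encode_ucf c)) = uhash p (nth 0 E 0) (val c).
Proof.
rewrite /cforest /encode_ucf CodeSeq.codeK /uhash /forest_hash -map_comp.
elim: (repr _) => [|t s IHs] /=; first by rewrite cev_const.
by rewrite cev_mul IHs cev_tree.
Qed.

Lemma cev_term E X (ty : X -> bool) (encode_var : X -> nat) base
    (env : forall y, UCF Sigma (ty y)) b (f : term Sigma ty b) :
  (forall y, cev E (cvar (base (encode_var y))) = uhash p (nth 0 E 0) (val (env y))) ->
  cev E (cterm p base (encode_term encode_var f)) = uhash p (nth 0 E 0) (val (eval env f)).
Proof.
move=> varE; elim: f => [y|b' c|b1 b2 b12 f1 IH1 f2 IH2|b' a f IH|b1 b2 f1 IH1 f2 IH2] /=;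
  rewrite /cterm cfold_code /cterm_step !fld_code /=.
- exact: varE.
- exact: cev_forest.
- by rewrite cev_mul uhash_add IH1 IH2.
- by rewrite cev_root uhash_root IH.
rewrite cev_comp uhash_subst ?IH1 ?IH2 //.
exact: leq_trans (eq_leq (eqP (valP (eval env f1)))) (leq_b1 b1).
Qed.

Lemma map_decode_cterm E base n :
  [seq ev E u | u <- decode (cterm p base n)]
   = [:: (cev E (cterm p base n)).1; (cev E (cterm p base n)).2].
Proof.
suff [a [b ->]] : exists a b, cterm p base n = code [:: a; b].
  by rewrite CodeSeq.codeK /cev !fld_code.
have forest_pair l : exists a b, foldr cmul (cconst 0 1) l = code [:: a; b].
  by case: l => [|c l]; [exists (econst 0), (econst 1) | do 2!eexists].
rewrite /cterm cfoldE /cterm_step; do 4![case: ifP => _; first by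
  [do 2!eexists | apply: forest_pair]]; by do 2!eexists.
Qed.

Lemma ev_cupdates M E m off (r : rule Sigma Gamma (@reg_sort _ _ M))
    (rs : forall i j, UCF Sigma (reg_sort (rule_source r i) j)) :
  (forall (i : 'I_(rank (rule_symbol r))) (j : 'I_(nreg M)), (nth 0 E (1 + i * m + (off + 2 * j)), nth 0 E (1 + i * m + (off + 2 * j)).+1)
     = uhash p (nth 0 E 0) (val (rs i j))) ->
  [seq ev E u | u <- cupdates p m off (encode_rule r)] =
  reg_hash (nth 0 E 0) (fun j => eval (fun y => rs y.1 y.2) (rule_update r j)).
Proof.
move=> varE; rewrite /cupdates /reg_hash map_flatten dl_code /= CodeSeq.codeK -!map_comp.
congr flatten; apply: eq_map => j /=; rewrite map_decode_cterm.
rewrite (cev_term (env := fun y => rs y.1 y.2)) //= => -[i j'] /=.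
by rewrite cev_var /child_var !fld_code /= varE.
Qed.

Lemma size_cupdates M m off (r : rule Sigma Gamma (@reg_sort _ _ M)) :
  size (cupdates p m off (encode_rule r)) = 2 * nreg M.
Proof.
have sz base n : size (decode (cterm p base n)) = 2.
  by rewrite -(size_map (ev [::])) map_decode_cterm.
have szs base s : size (flatten [seq decode (cterm p base n) | n <- s]) = 2 * size s.
  by elim: s => //= n s IHs; rewrite size_cat sz IHs mulnS.
by rewrite /cupdates dl_code /= CodeSeq.codeK szs size_map size_enum_ord.
Qed.

End Values.

End Runs.

Lemma nth_map_enum_rank (T : finType) (f : T -> nat) (y : T) :
  nth 0 [seq f z | z <- enum T] (enum_rank y) = f y.
Proof. by rewrite (nth_map y) -?cardE // nth_enum_rank. Qed.

Lemma enum_rank_nat_inj (T : finType) (y z : T) :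
  nat_of_ord (enum_rank y) = nat_of_ord (enum_rank z) -> y = z.
Proof. by move/val_inj/enum_rank_inj. Qed.

Lemma nth_map_ord n (f : 'I_n -> nat) (i : 'I_n) : nth 0 [seq f j | j <- enum 'I_n] i = f i.
Proof. by rewrite (nth_map i) ?size_enum_ord // nth_ord_enum. Qed.

Lemma In_map_mem (T : Type) (f : T -> nat) l y : List.In y l -> f y \in map f l.
Proof.
elim: l => //= z l IHl [->|/IHl yl]; rewrite inE ?eqxx //.
by rewrite yl orbT.
Qed.

Lemma mem_map_In (T : Type) (f : T -> nat) l n : n \in map f l ->
  exists2 y, List.In y l & n = f y.
Proof.
elim: l => //= z l IHl; rewrite inE => /predU1P[->|/IHl[y yl ->]].
  by exists z; [left|].
by exists y; [right|].
Qed.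

Section HashedRuns.

Variables (Sigma : finType) (Gamma : signature) (p : nat).
Implicit Types (M : automaton Sigma Gamma) (t : ranked_tree Gamma).

Definition hashed_run M t (q : nat) (rho : nat -> seq nat) :=
  exists (q0 : state M) (rs : forall j, UCF Sigma (reg_sort q0 j)),
    [/\ run t rs, q = enum_rank q0 & forall x, rho x = reg_hash p x rs].

Lemma hashed_run_size M t q rho x : hashed_run M t q rho -> size (rho x) = 2 * nreg M.
Proof. by move=> [q0 [rs [_ _ ->]]]; rewrite size_reg_hash. Qed.

Lemma rules_encode M : dl (encode M) 3 = [seq encode_rule r | r <- rules M].
Proof. by rewrite dl_code /= CodeSeq.codeK. Qed.

Lemma finals_encode M :
  dl (encode M) 4 = [seq encode_final (final q) | q <- enum (state M)].
Proof. by rewrite dl_code /= CodeSeq.codeK. Qed.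

Lemma nreg_encode M : fld (encode M) 1 = nreg M.
Proof. by rewrite fld_code. Qed.

Section EncodeRule.

Variables (n : nat) (Q : finType) (ty : Q -> 'I_n -> bool) (r : rule Sigma Gamma ty).

Lemma symbol_encode_rule : fld (encode_rule r) 0 = enum_rank (rule_symbol r).
Proof. by rewrite fld_code. Qed.

Lemma target_encode_rule : fld (encode_rule r) 2 = enum_rank (rule_target r).
Proof. by rewrite fld_code. Qed.

Lemma size_sources : size (dl (encode_rule r) 1) = rank (rule_symbol r).
Proof. by rewrite dl_code /= CodeSeq.codeK size_map size_enum_ord. Qed.

Lemma nth_sources (i : 'I_(rank (rule_symbol r))) :
  nth 0 (dl (encode_rule r) 1) i = enum_rank (rule_source r i).
Proof.
rewrite dl_code /= CodeSeq.codeK.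
exact: (nth_map_ord (fun i => nat_of_ord (enum_rank (rule_source r i)))).
Qed.

End EncodeRule.

(** The automaton owns a slice, starting at [off], of the [m] numbers of each child. This covers
    both components of a product as well as an automaton on its own. *)
Definition aligned n k (rhos : nat -> nat -> seq nat) x m off E :=
  nth 0 E 0 = x /\ forall i j, i < k -> j < 2 * n ->
    nth 0 E (1 + i * m + (off + j)) = nth 0 (rhos i x) j.

Lemma hashed_run_inv M t q rho : hashed_run M t q rho ->
  exists r, [/\ List.In r (rules M), tree_symbol t = rule_symbol r,
    q = fld (encode_rule r) 2 & exists2 rhos : nat -> nat -> seq nat,
    forall i, i < rank (rule_symbol r) ->
      hashed_run M (child t i) (nth 0 (dl (encode_rule r) 1) i) (rhos i) &
    forall x m off E, aligned (nreg M) (rank (rule_symbol r)) rhos x m off E ->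
      [seq ev E u | u <- cupdates p m off (encode_rule r)] = rho x].
Proof.
move=> [q0 [rs [run_t qE rhoE]]].
have [r [r_M t_r r_q0 [rs' runs rsE]]] := run_inv run_t.
exists r; split=> //; first by rewrite target_encode_rule r_q0.
pose rhos i x := if insub i is Some i' then reg_hash p x (rs' i') else [::].
have rhosE (i : 'I_(rank (rule_symbol r))) x : rhos i x = reg_hash p x (rs' i).
  by rewrite /rhos valK.
exists rhos => [i ir|x m off E [E0 E_al]].
  rewrite -[i]/(nat_of_ord (Ordinal ir)) nth_sources.
  exists (rule_source r (Ordinal ir)), (rs' (Ordinal ir)); split=> // x.
rewrite (ev_cupdates (rs := rs')) => [|i j].
  rewrite rhoE /reg_hash; congr flatten; apply: eq_map => j.
  by rewrite E0 rsE.
rewrite E0 -nth_reg_hash -rhosE -addnS -addnS !E_al ?ltn_ord //.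
  by have := ltn_ord j; lia.
by have := ltn_ord j; lia.
Qed.

Lemma hashed_run_intro M t r rhos rho : List.In r (rules M) ->
  tree_symbol t = rule_symbol r ->
  (forall i, i < rank (rule_symbol r) ->
      hashed_run M (child t i) (nth 0 (dl (encode_rule r) 1) i) (rhos i)) ->
  (forall x, exists m off E, aligned (nreg M) (rank (rule_symbol r)) rhos x m off E /\
      [seq ev E u | u <- cupdates p m off (encode_rule r)] = rho x) ->
  hashed_run M t (fld (encode_rule r) 2) rho.
Proof.
move=> r_M t_r runs rhoE.
have ex_rs (i : 'I_(rank (rule_symbol r))) : exists rs : forall j, UCF Sigma (reg_sort (rule_source r i) j),
    run (child t i) rs /\ forall x, rhos i x = reg_hash p x rs.
  have [q [rs [run_i]]] := runs i (ltn_ord i).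
  by rewrite nth_sources => /enum_rank_nat_inj q_i; subst q => rsE; exists rs.
pose rs' i := projT1 (cid (ex_rs i)).
have rs'P (i : 'I_(rank (rule_symbol r))) : run (child t i) (rs' i) /\ forall x, rhos i x = reg_hash p x (rs' i).
  exact: projT2 (cid (ex_rs i)).
exists (rule_target r), (fun j => eval (fun y => rs' y.1 y.2) (rule_update r j)).
split; [by apply: run_intro => // i; case: (rs'P i) | by rewrite target_encode_rule |].
move=> x; have [m [off [E [[E0 E_al] <-]]]] := rhoE x.
rewrite (ev_cupdates (rs := rs')) ?E0 // => i j.
rewrite -nth_reg_hash -(rs'P i).2 -addnS -addnS !E_al ?ltn_ord //.
  by have := ltn_ord j; lia.
by have := ltn_ord j; lia.
Qed.

End HashedRuns.

(** * Pairs of runs *)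

Lemma updates_map m r E : size (dl r 2) = m -> updates m r E = [seq ev E u | u <- dl r 2].
Proof.
move=> sz; apply: (@eq_from_nth _ 0); rewrite size_mkseq ?size_map // => j jm.
by rewrite nth_mkseq // nth_map_ev.
Qed.

Lemma code_inj : injective code.
Proof. exact: can_inj CodeSeq.codeK. Qed.

Section PairSystem.

Variables (Sigma : finType) (Gamma : signature) (p : nat).
Hypotheses (p_prime : prime p) (p_big : #|Sigma|.+1 < p).
Variables M1 M2 : automaton Sigma Gamma.
Implicit Types t : ranked_tree Gamma.

Local Notation n1 := (nreg M1).
Local Notation n2 := (nreg M2).
Local Notation m := (2 * n1 + 2 * n2).
Local Notation S := (pair_system p (encode M1) (encode M2)).

Lemma pair_system_size : fld S 0 = m.
Proof. by rewrite fld_code /= !nreg_encode. Qed.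

Lemma pair_system_rules R : R \in dl S 1 <-> exists r1 r2,
  [/\ List.In r1 (rules M1), List.In r2 (rules M2), rule_symbol r1 = rule_symbol r2 &
      R = pair_rule p m (2 * n1) (encode_rule r1) (encode_rule r2)].
Proof.
rewrite dl_code /= CodeSeq.codeK !rules_encode !nreg_encode; split.
  move=> /flatten_mapP[_ /mem_map_In[r1 r1M ->] /flatten_mapP[_ /mem_map_In[r2 r2M ->]]].
  case: eqP => //; rewrite !symbol_encode_rule => /enum_rank_nat_inj r12.
  by rewrite inE => /eqP ->; exists r1, r2.
move=> [r1 [r2 [r1M r2M r12 ->]]]; apply/flatten_mapP.
exists (encode_rule r1); first exact: In_map_mem.
apply/flatten_mapP; exists (encode_rule r2); first exact: In_map_mem.
by rewrite !symbol_encode_rule r12 eqxx inE.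
Qed.

Lemma pair_rule_updates (r1 : rule Sigma Gamma (@reg_sort _ _ M1))
    (r2 : rule Sigma Gamma (@reg_sort _ _ M2)) E :
  updates m (pair_rule p m (2 * n1) (encode_rule r1) (encode_rule r2)) E
  = [seq ev E u | u <- cupdates p m 0 (encode_rule r1)] ++
    [seq ev E u | u <- cupdates p m (2 * n1) (encode_rule r2)].
Proof.
have dl2 : dl (pair_rule p m (2 * n1) (encode_rule r1) (encode_rule r2)) 2 =
    cupdates p m 0 (encode_rule r1) ++ cupdates p m (2 * n1) (encode_rule r2).
  by rewrite dl_code /= CodeSeq.codeK.
rewrite updates_map dl2; first exact: map_cat.
by rewrite size_cat; congr (_ + _); apply: size_cupdates.
Qed.

Lemma pair_aligned k x (rhos1 rhos2 : nat -> nat -> seq nat) :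
  (forall i, i < k -> size (rhos1 i x) = 2 * n1) ->
  (forall i, i < k -> size (rhos2 i x) = 2 * n2) ->
  let E := x :: flatten [seq rhos1 i x ++ rhos2 i x | i <- iota 0 k] in
  aligned n1 k rhos1 x m 0 E /\ aligned n2 k rhos2 x m (2 * n1) E.
Proof.
move=> s1 s2 E.
have s12 i : i < k -> size (rhos1 i x ++ rhos2 i x) = m.
  by move=> ik; rewrite size_cat s1 ?s2.
split; split=> // i j ik jn; rewrite /E /= (nth_flatten_env s12) //.
- by rewrite nth_cat s1 // jn.
- by rewrite ltn_addr.
- by rewrite nth_cat s1 // ltnNge leq_addr addKn.
by rewrite ltn_add2l.
Qed.

Lemma pair_reach t q1 q2 rho1 rho2 : hashed_run p M1 t q1 rho1 -> hashed_run p M2 t q2 rho2 ->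
  reach S (code [:: q1; q2]) (fun x => rho1 x ++ rho2 x).
Proof.
elim/ranked_tree_child_ind: t q1 q2 rho1 rho2 => t IH q1 q2 rho1 rho2.
move=> /hashed_run_inv[r1 [r1M t_r1 -> [rhos1 runs1 rho1E]]].
move=> /hashed_run_inv[r2 [r2M t_r2 -> [rhos2 runs2 rho2E]]].
have r12 : rule_symbol r1 = rule_symbol r2 by rewrite -t_r1.
pose R := pair_rule p m (2 * n1) (encode_rule r1) (encode_rule r2).
have R_S : R \in dl S 1 by apply/pair_system_rules; exists r1, r2.
have -> : code [:: fld (encode_rule r1) 2; fld (encode_rule r2) 2] = fld R 0.
  by rewrite [RHS]fld_code.
have srcs : dl R 1 = mkseq (fun i => code [:: nth 0 (dl (encode_rule r1) 1) i;
    nth 0 (dl (encode_rule r2) 1) i]) (rank (rule_symbol r1)).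
  by rewrite dl_code /= CodeSeq.codeK size_sources.
apply: (Reach (rhos := fun i x => rhos1 i x ++ rhos2 i x) R_S).
  move=> i; rewrite srcs size_mkseq => ir; rewrite nth_mkseq //.
  by apply: (IH i); [rewrite t_r1 | apply: runs1 | apply: runs2; rewrite -r12].
move=> x; rewrite pair_system_size pair_rule_updates srcs size_mkseq.
have [|i ir|al1 al2] := @pair_aligned (rank (rule_symbol r1)) x rhos1 rhos2.
- by move=> i /runs1/hashed_run_size.
- by apply: hashed_run_size (runs2 i _); rewrite -r12.
move: al2; rewrite {1}r12 => al2.
by congr (_ ++ _); apply: esym; [apply: rho1E al1 | apply: rho2E al2].
Qed.

Lemma pair_reach_inv Q rho : reach S Q rho -> exists t q1 q2 rho1 rho2,
  [/\ Q = code [:: q1; q2], hashed_run p M1 t q1 rho1, hashed_run p M2 t q2 rho2 &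
      forall x, rho x = rho1 x ++ rho2 x].
Proof.
elim=> {Q rho} R rhos rho /pair_system_rules[r1 [r2 [r1M r2M r12 ->]]].
set k := rank (rule_symbol r1).
have -> : dl (pair_rule p m (2 * n1) (encode_rule r1) (encode_rule r2)) 1 =
    mkseq (fun i => code [:: nth 0 (dl (encode_rule r1) 1) i;
    nth 0 (dl (encode_rule r2) 1) i]) k.
  by rewrite dl_code /= CodeSeq.codeK size_sources.
rewrite size_mkseq pair_system_size => _ IH rhoE.
have /choice[c cP] (i : 'I_k) : exists c : ranked_tree Gamma * (nat -> seq nat) * (nat -> seq nat),
    [/\ hashed_run p M1 c.1.1 (nth 0 (dl (encode_rule r1) 1) i) c.1.2,
        hashed_run p M2 c.1.1 (nth 0 (dl (encode_rule r2) 1) i) c.2 &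
        forall x, rhos i x = c.1.2 x ++ c.2 x].
  have [t [q1 [q2 [rho1 [rho2 [+ run1 run2 iE]]]]]] := IH i (ltn_ord i).
  rewrite nth_mkseq // => /code_inj[q1E q2E]; exists (t, rho1, rho2).
  by rewrite q1E q2E.
pose ext (f : 'I_k -> nat -> seq nat) (i x : nat) := if insub i is Some i' then f i' x else [::].
have extE f (i : 'I_k) x : ext f i x = f i x by rewrite /ext valK.
pose rhos1 := ext (fun i => (c i).1.2); pose rhos2 := ext (fun i => (c i).2).
(* Both components of a child come from one and the same tree, so the chosen trees assemble into a
   common input. *)
pose t := RNode (fun i => (c i).1.1).
have runs1 i : i < k -> hashed_run p M1 (child t i) (nth 0 (dl (encode_rule r1) 1) i) (rhos1 i).
  move=> ik; have [[q [rs [run1 qE rsE]]] _ _] := cP (Ordinal ik).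
  rewrite -[i]/(nat_of_ord (Ordinal ik)) child_RNode; exists q, rs; split=> // x.
  by rewrite /rhos1 extE.
have runs2 i : i < k -> hashed_run p M2 (child t i) (nth 0 (dl (encode_rule r2) 1) i) (rhos2 i).
  move=> ik; have [_ [q [rs [run2 qE rsE]]] _] := cP (Ordinal ik).
  rewrite -[i]/(nat_of_ord (Ordinal ik)) child_RNode; exists q, rs; split=> // x.
  by rewrite /rhos2 extE.
pose E x := x :: flatten [seq rhos1 i x ++ rhos2 i x | i <- iota 0 k].
have E_al x : aligned n1 k rhos1 x m 0 (E x) /\ aligned n2 k rhos2 x m (2 * n1) (E x).
  apply: pair_aligned => i ik; first exact: hashed_run_size (runs1 i ik).
  exact: hashed_run_size (runs2 i ik).
have EE x : x :: flatten [seq rhos i x | i <- iota 0 k] = E x.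
  congr (_ :: flatten _); apply/eq_in_map => i; rewrite mem_iota /= => ik.
  have [_ _ iE] := cP (Ordinal ik).
  by rewrite -[i]/(nat_of_ord (Ordinal ik)) /rhos1 /rhos2 !extE iE.
exists t, (fld (encode_rule r1) 2), (fld (encode_rule r2) 2),
  (fun x => [seq ev (E x) u | u <- cupdates p m 0 (encode_rule r1)]),
  (fun x => [seq ev (E x) u | u <- cupdates p m (2 * n1) (encode_rule r2)]).
split; first by rewrite fld_code.
- apply: (hashed_run_intro (rhos := rhos1)) => // x; exists m, 0, (E x); split=> //.
  exact: (E_al x).1.
- apply: (hashed_run_intro (rhos := rhos2)) => //; rewrite -r12 //.
  by move=> x; exists m, (2 * n1), (E x); split=> //; apply: (E_al x).2.
by move=> x; rewrite rhoE EE pair_rule_updates.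
Qed.

Lemma encode_final_eq0 n (ty : 'I_n -> bool) (f : option {b : bool & term Sigma ty b}) :
  (encode_final f == 0) = ~~ f.
Proof. by case: f => // f; rewrite /encode_final code_cons muln_eq0 expn_eq0. Qed.

Lemma cev_final (M : automaton Sigma Gamma) (q : state M) (rs : forall j, UCF Sigma (reg_sort q j)) b
    (f : term Sigma (reg_sort q) b) E off :
  (forall j, j < 2 * nreg M -> nth 0 E (1 + (off + j)) = nth 0 (reg_hash p (nth 0 E 0) rs) j) ->
  cev E (cterm p (state_var off) (fld (encode_final (Some (existT _ b f))) 0)) =
  uhash p (nth 0 E 0) (val (eval rs f)).
Proof.
move=> E_al; rewrite fld_code /=; apply: cev_term => j.
rewrite cev_var /state_var -nth_reg_hash -!addnS !E_al //.
  by have := ltn_ord j; lia.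
by have := ltn_ord j; lia.
Qed.

(** The sort is the number of holes, so the hash determines it together with the forest. *)
Lemma ucf_tagged_inj b1 b2 (y1 : UCF Sigma b1) (y2 : UCF Sigma b2) :
  (forall x, uhash p x (val y1) = uhash p x (val y2)) ->
  existT (UCF Sigma) b1 y1 = existT (UCF Sigma) b2 y2.
Proof.
have holes1 b (y : UCF Sigma b) : holes (val y) <= 1.
  exact: leq_trans (eq_leq (eqP (valP y))) (leq_b1 b).
move=> /(uhash_inj p_prime p_big (holes1 _ y1) (holes1 _ y2)) y12.
have b12 : b1 = b2.
  have inj_b (a b : bool) : a = b :> nat -> a = b by case: a b => [] [].
  by apply: inj_b; rewrite -(eqP (valP y1)) -(eqP (valP y2)); congr holes.
by subst b2; congr existT; apply: val_inj.
Qed.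

Lemma pair_systemP : vanishing S <->
  forall t v1 v2, semantics M1 t v1 -> semantics M2 t v2 -> v1 = v2.
Proof.
have finalE (q1 : state M1) (q2 : state M2) rs1 rs2 b1 (f1 : term Sigma (reg_sort q1) b1)
    b2 (f2 : term Sigma (reg_sort q2) b2) x :
    let E := x :: reg_hash p x rs1 ++ reg_hash p x rs2 in
    cev E (cterm p (state_var 0) (fld (encode_final (Some (existT _ b1 f1))) 0)) =
      uhash p x (val (eval rs1 f1)) /\
    cev E (cterm p (state_var (2 * n1)) (fld (encode_final (Some (existT _ b2 f2))) 0)) =
      uhash p x (val (eval rs2 f2)).
  move=> E; split; apply: cev_final => j jn; rewrite add1n.
    rewrite -[LHS]/(nth 0 (reg_hash p x rs1 ++ reg_hash p x rs2) j).
    by rewrite nth_cat size_reg_hash jn.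
  rewrite -[LHS]/(nth 0 (reg_hash p x rs1 ++ reg_hash p x rs2) (2 * n1 + j)).
  by rewrite nth_cat size_reg_hash ltnNge leq_addr addKn.
have finalsE : dl S 2 = flatten [seq flatten [seq pair_final p (2 * n1) q1 q2
      (nth 0 (dl (encode M1) 4) q1) (nth 0 (dl (encode M2) 4) q2)
    | q2 <- iota 0 (size (dl (encode M2) 4))] | q1 <- iota 0 (size (dl (encode M1) 4))].
  by rewrite dl_code /= CodeSeq.codeK nreg_encode.
have final_nth (M : automaton Sigma Gamma) (q : state M) : nth 0 (dl (encode M) 4) (enum_rank q) = encode_final (final q).
  by rewrite finals_encode (nth_map_enum_rank (fun q => encode_final (final q))).
have final_lt (M : automaton Sigma Gamma) (q : state M) : enum_rank q < size (dl (encode M) 4).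
  by rewrite finals_encode size_map -cardE.
split=> [van t _ _ [q1 [rs1 [b1 [f1 [run1 fin1 ->]]]]] [q2 [rs2 [b2 [f2 [run2 fin2 ->]]]]]|].
  apply: ucf_tagged_inj => x.
  have h1 : hashed_run p M1 t (enum_rank q1) (fun x => reg_hash p x rs1) by exists q1, rs1.
  have h2 : hashed_run p M2 t (enum_rank q2) (fun x => reg_hash p x rs2) by exists q2, rs2.
  have /= [f1E f2E] := finalE q1 q2 rs1 rs2 b1 f1 b2 f2 x.
  have mem_final f : f \in pair_final p (2 * n1) (enum_rank q1) (enum_rank q2)
      (encode_final (final q1)) (encode_final (final q2)) -> f \in dl S 2.
    move=> f_q; rewrite finalsE; apply/flatten_mapP; exists (enum_rank q1 : nat).
      by rewrite mem_iota final_lt.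
    apply/flatten_mapP; exists (enum_rank q2 : nat); first by rewrite mem_iota final_lt.
    by rewrite !final_nth.
  have van_pair := van _ _ (pair_reach h1 h2).
  rewrite -f1E -f2E /cev; congr (_, _).
    have := van_pair (code [:: code [:: nat_of_ord (enum_rank q1); nat_of_ord (enum_rank q2)];
      fld (cterm p (state_var 0) (fld (encode_final (final q1)) 0)) 0;
      fld (cterm p (state_var (2 * n1)) (fld (encode_final (final q2)) 0)) 0]).
    rewrite !fld_code fin1 fin2; apply=> //; apply: mem_final.
    by rewrite /pair_final ifF ?fin1 ?fin2 ?encode_final_eq0 // !fld_code inE eqxx.
  have := van_pair (code [:: code [:: nat_of_ord (enum_rank q1); nat_of_ord (enum_rank q2)];
      fld (cterm p (state_var 0) (fld (encode_final (final q1)) 0)) 1;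
      fld (cterm p (state_var (2 * n1)) (fld (encode_final (final q2)) 0)) 1]).
  rewrite !fld_code fin1 fin2; apply=> //; apply: mem_final.
  by rewrite /pair_final ifF ?fin1 ?fin2 ?encode_final_eq0 // !fld_code !inE eqxx orbT.
move=> same Q rho /pair_reach_inv[t [_ [_ [rho1 [rho2 [-> [q1 [rs1 [run1 -> rho1E]]]
  [q2 [rs2 [run2 -> rho2E]]] rhoE]]]]]] f.
rewrite finalsE => /flatten_mapP[n' _ /flatten_mapP[n'' _]].
set g1 := nth _ _ n'; set g2 := nth _ _ n''; rewrite /pair_final; cbv zeta; case: ifP => // /norP[g10 g20].
move=> f_mem fQ x; have {fQ} [q1E q2E] : n' = enum_rank q1 /\ n'' = enum_rank q2.
  have fE : fld f 0 = code [:: n'; n''].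
    by move: f_mem; rewrite !inE => /orP[] /eqP->; rewrite fld_code.
  by move: fQ; rewrite fE => /code_inj[-> ->].
move: f_mem g10 g20; rewrite /g1 /g2 q1E q2E !final_nth.
case fin1 : (final q1) => [[b1 f1]|//]; case fin2 : (final q2) => [[b2 f2]|//] f_mem _ _.
have v12 : existT (UCF Sigma) b1 (eval rs1 f1) = existT (UCF Sigma) b2 (eval rs2 f2).
  by apply: (same t); [exists q1, rs1, b1, f1 | exists q2, rs2, b2, f2].
have hashE := congr1 (fun v : {b : bool & UCF Sigma b} => uhash p x (val (projT2 v))) v12.
have /= [f1E f2E] := finalE q1 q2 rs1 rs2 b1 f1 b2 f2 x.
move: hashE; rewrite /= -f1E -f2E /cev => -[e0 e1].
rewrite rhoE rho1E rho2E; move: f_mem e0 e1; rewrite !inE => /orP[] /eqP ->; by rewrite !fld_code.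
Qed.

End PairSystem.

(** * Comparison of domains *)

Section BooleanPairs.

Definition truth (b : bool) : nat * nat := (nat_of_bool (~~ b), nat_of_bool b).

Lemma aff_comp_truth b c : aff_comp (truth b) (truth c) = truth (b || c).
Proof. by case: b c => [] []. Qed.

Lemma cev_swap_truth E P b : cev E P = truth b -> cev E (cswap P) = truth (~~ b).
Proof. by rewrite cev_swap => ->; case: b. Qed.

Lemma cev_foldr_or E (T : eqType) (l : seq T) (c d : pred T) (F : T -> nat) :
  (forall y, y \in l -> c y -> cev E (F y) = truth (d y)) ->
  cev E (foldr (fun y acc => if c y then ccomp (F y) acc else acc) (cconst 1 0) l)
    = truth (has (fun y => c y && d y) l).
Proof.
elim: l => [|y l IHl] lE /=; first by rewrite cev_const.
have {}IHl := IHl (fun z zl => lE z (@mem_behead _ (y :: l) z zl)).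
have := lE y (mem_head _ _).
by case: (c y) => [/(_ isT) yE|_] //; rewrite cev_comp IHl yE aff_comp_truth.
Qed.

End BooleanPairs.

Section DomainSystem.

Variables (Sigma : finType) (Gamma : signature) (p : nat).
Variables M1 M2 : automaton Sigma Gamma.
Implicit Types (t : ranked_tree Gamma) (M : automaton Sigma Gamma).

Local Notation n := #|state M2|.
Local Notation m := (2 * n).
Local Notation S := (domain_system (encode M1) (encode M2)).

Definition reachable M t q := `[< exists rho, hashed_run p M t q rho >].

Lemma size_finals M : size (dl (encode M) 4) = #|state M|.
Proof. by rewrite finals_encode size_map -cardE. Qed.

Lemma reachable_lt M t q : reachable M t q -> q < #|state M|.
Proof. by move=> /asboolP[rho [q0 [rs [_ -> _]]]]. Qed.

Lemma reachableP M t q : reflect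
  (exists r, [/\ List.In r (rules M), tree_symbol t = rule_symbol r,
     q = fld (encode_rule r) 2 & forall i, i < rank (rule_symbol r) ->
       reachable M (child t i) (nth 0 (dl (encode_rule r) 1) i)])
  (reachable M t q).
Proof.
apply: (iffP (asboolP _)) => [[rho /hashed_run_inv[r [rM tr qr [rhos runs _]]]]|].
  by exists r; split=> // i ir; apply/asboolP; exists (rhos i); apply: runs.
move=> [r [rM tr -> kids]]; set k := rank (rule_symbol r) in kids.
have /choice[rhos runs] : forall i, exists rho, i < k ->
    hashed_run p M (child t i) (nth 0 (dl (encode_rule r) 1) i) rho.
  move=> i; have [/kids/asboolP[rho run_i]|] := ltnP i k; first by exists rho.
  by exists (fun=> [::]).
pose E x := x :: flatten [seq rhos i x | i <- iota 0 k].
exists (fun x => [seq ev (E x) u | u <- cupdates p (2 * nreg M) 0 (encode_rule r)]).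
apply: (hashed_run_intro (rhos := rhos)) => // x; exists (2 * nreg M), 0, (E x); split=> //.
split=> // i j ik jn; rewrite /E add1n -[LHS]/(nth 0 (flatten _) (i * (2 * nreg M) + j)).
by rewrite (nth_flatten_env (m := 2 * nreg M)) // => i' /runs/hashed_run_size.
Qed.

Definition reach_values t : seq nat := flatten
  [seq [:: (truth (reachable M2 t q)).1; (truth (reachable M2 t q)).2] | q <- iota 0 n].

Lemma size_reach_values t : size (reach_values t) = m.
Proof. by rewrite flatten_pairs_size size_iota. Qed.

Lemma nth_reach_values t q : q < n ->
  (nth 0 (reach_values t) (2 * q), nth 0 (reach_values t) (2 * q).+1) = truth (reachable M2 t q).
Proof.
move=> qn; have [-> ->] := nth_flatten_pairs (fun q => (truth (reachable M2 t q)).1)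
  (fun q => (truth (reachable M2 t q)).2) (iota 0 n) q.
by rewrite !(nth_map 0) ?size_iota // nth_iota // -surjective_pairing.
Qed.

Definition reach_env t x := x :: flatten
  [seq reach_values (child t i) | i <- iota 0 (rank (tree_symbol t))].

Lemma cev_child_var t x i q : i < rank (tree_symbol t) -> q < n ->
  cev (reach_env t x) (cvar (child_var m 0 (code [:: i; q]))) =
  truth (reachable M2 (child t i) q).
Proof.
move=> ir qn; rewrite cev_var /child_var !fld_code -nth_reach_values //.
have nthE j : j < m -> nth 0 (reach_env t x) (1 + i * m + (0 + j)) = nth 0 (reach_values (child t i)) j.
  move=> jm; rewrite -[LHS]/(nth 0 (flatten _) (i * m + j)).
  by rewrite (nth_flatten_env (m := m)) // => i' _; apply: size_reach_values.
have lt2 a b : a < b -> 2 * a < 2 * b /\ (2 * a).+1 < 2 * b by lia.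
have succE : (1 + i * m + (0 + 2 * q)).+1 = 1 + i * m + (0 + (2 * q).+1) by rewrite !addnS.
have [lt_q lt_q1] := lt2 _ _ qn.
by rewrite -[nth 0 [:: i; q] 0]/i -[nth 0 [:: i; q] 1]/q succE !nthE.
Qed.

Lemma cev_call t x r : List.In r (rules M2) -> tree_symbol t = rule_symbol r ->
  cev (reach_env t x) (call m (encode_rule r)) =
  truth (all (fun i => reachable M2 (child t i) (nth 0 (dl (encode_rule r) 1) i))
           (iota 0 (rank (rule_symbol r)))).
Proof.
move=> rM tr; rewrite /call size_sources.
(* De Morgan: [call] expresses a conjunction over the children by disjunction and negation. *)
rewrite -[all _ _]negbK -has_predC; apply: cev_swap_truth.
apply: (@cev_foldr_or _ _ _ xpredT
   (fun i => ~~ reachable M2 (child t i) (nth 0 (dl (encode_rule r) 1) i))).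
move=> i; rewrite mem_iota /= => ir _; apply: cev_swap_truth; apply: cev_child_var.
  by rewrite tr.
by rewrite -[i]/(nat_of_ord (Ordinal ir)) nth_sources.
Qed.

Lemma cev_chas t x r1 q : fld r1 0 = enum_rank (tree_symbol t) ->
  cev (reach_env t x) (chas m (encode M2) r1 q) = truth (reachable M2 t q).
Proof.
move=> r1t; rewrite /chas rules_encode.
pose kids r2 := all (fun i => reachable M2 (child t i) (nth 0 (dl r2 1) i))
  (iota 0 (rank (tree_symbol t))).
rewrite (@cev_foldr_or _ _ _ _ kids) => [|_ /mem_map_In[r rM ->] /andP[]]; last first.
  rewrite symbol_encode_rule r1t => /eqP/enum_rank_nat_inj rt _.
  by rewrite cev_call // /kids rt.
congr truth; apply/hasP/reachableP => [[_ /mem_map_In[r rM ->] /andP[/andP[]]]|].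
  rewrite symbol_encode_rule r1t => /eqP/enum_rank_nat_inj rt /eqP qr /allP kids_r.
  by exists r; split=> // i ir; apply: kids_r; rewrite mem_iota -rt.
move=> [r [rM tr -> kids_r]]; exists (encode_rule r); first exact: In_map_mem.
rewrite symbol_encode_rule r1t tr !eqxx; apply/allP => i.
by rewrite mem_iota tr; apply: kids_r.
Qed.

Lemma cev_accept t x : cev (x :: reach_values t) (caccept (encode M2)) =
  truth (has (fun q => (nth 0 (dl (encode M2) 4) q != 0) && reachable M2 t q) (iota 0 n)).
Proof.
rewrite -(@cev_foldr_or (x :: reach_values t) _ _ _ _ (fun q => cvar (state_var 0 q))).
  rewrite /caccept size_finals; congr cev; elim: (iota 0 n) => //= q l ->.
  by case: eqP.
move=> q; rewrite mem_iota /= => qn _.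
by rewrite cev_var /state_var -nth_reach_values.
Qed.

Definition domain_rule r1 := code [:: fld r1 2; fld r1 1;
  code (flatten [seq decode (chas m (encode M2) r1 q) | q <- iota 0 n])].

Lemma domain_system_size : fld S 0 = m.
Proof. by rewrite fld_code /= size_finals. Qed.

Lemma domain_system_rules : dl S 1 = [seq domain_rule (encode_rule r) | r <- rules M1].
Proof. by rewrite dl_code /= CodeSeq.codeK rules_encode -map_comp size_finals. Qed.

Lemma map_decode_chas E r1 q : [seq ev E u | u <- decode (chas m (encode M2) r1 q)]
  = [:: (cev E (chas m (encode M2) r1 q)).1; (cev E (chas m (encode M2) r1 q)).2].
Proof.
suff [a [b ->]] : exists a b, chas m (encode M2) r1 q = code [:: a; b].
  by rewrite CodeSeq.codeK /cev !fld_code.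
rewrite /chas; elim: (dl _ _) => [|r l IHl] /=; first by exists (econst 1), (econst 0).
by case: ifP => // _; do 2!eexists.
Qed.

(** One step of the subset construction: the states reachable on [t] are determined by the symbol of
    [t] and the reachable states of its children. *)
Lemma domain_rule_updates t x (r : rule Sigma Gamma (@reg_sort _ _ M1)) :
  tree_symbol t = rule_symbol r ->
  updates m (domain_rule (encode_rule r)) (reach_env t x) = reach_values t.
Proof.
move=> tr; pose F q := decode (chas m (encode M2) (encode_rule r) q).
have dl2 : dl (domain_rule (encode_rule r)) 2 = flatten [seq F q | q <- iota 0 n].
  by rewrite dl_code /= CodeSeq.codeK.
have F_E E q : [seq ev E u | u <- F q] = [:: (cev E (chas m (encode M2) (encode_rule r) q)).1;
    (cev E (chas m (encode M2) (encode_rule r) q)).2] by apply: map_decode_chas.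
rewrite updates_map dl2; last first.
  rewrite (flatten_env_size (m := 2)) 1?mulnC // => q _.
  by rewrite -(size_map (ev [::])) F_E.
rewrite map_flatten -map_comp; congr flatten; apply: eq_map => q /=.
by rewrite F_E cev_chas // symbol_encode_rule tr.
Qed.

Lemma domain_reach t q rho : hashed_run p M1 t q rho -> reach S q (fun=> reach_values t).
Proof.
elim/ranked_tree_child_ind: t q rho => t IH q rho /hashed_run_inv[r [rM tr -> [rhos runs _]]].
have srcs : dl (domain_rule (encode_rule r)) 1 = dl (encode_rule r) 1.
  by rewrite /dl fld_code.
have -> : fld (encode_rule r) 2 = fld (domain_rule (encode_rule r)) 0 by rewrite [RHS]fld_code.
apply: (Reach (rhos := fun i _ => reach_values (child t i))).
- by rewrite domain_system_rules; apply: (In_map_mem (fun r => domain_rule (encode_rule r))).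
- by rewrite srcs size_sources => i ir; apply: IH (runs i ir); rewrite tr.
move=> x; rewrite srcs size_sources domain_system_size -tr.
by rewrite -(domain_rule_updates x tr).
Qed.

Lemma domain_reach_inv q rho : reach S q rho ->
  exists2 t, reachable M1 t q & forall x, rho x = reach_values t.
Proof.
elim=> {q rho} R rhos rho; rewrite domain_system_rules => /mem_map_In[r rM ->].
have srcs : dl (domain_rule (encode_rule r)) 1 = dl (encode_rule r) 1.
  by rewrite /dl fld_code.
rewrite srcs size_sources domain_system_size fld_code [nth _ _ _]/= => _ IH rhoE.
have /choice[ts tsP] (i : 'I_(rank (rule_symbol r))) : exists t,
    reachable M1 t (nth 0 (dl (encode_rule r) 1) i) /\ forall x, rhos i x = reach_values t.
  by have [t] := IH i (ltn_ord i); exists t.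
have t_child i (ir : i < rank (rule_symbol r)) : child (RNode ts) i = ts (Ordinal ir).
  by rewrite -[i]/(nat_of_ord (Ordinal ir)) child_RNode.
exists (RNode ts).
  apply/reachableP; exists r; split=> // i ir; rewrite t_child.
  exact: (tsP (Ordinal ir)).1.
move=> x; rewrite rhoE -(@domain_rule_updates (RNode ts) x r) // /reach_env.
congr (updates _ _ (_ :: flatten _)); apply/eq_in_map => i; rewrite mem_iota /= => ir.
by rewrite t_child -((tsP (Ordinal ir)).2 x).
Qed.

Lemma accepts_reachable M t : (exists v, semantics M t v) <->
  exists q, nth 0 (dl (encode M) 4) q != 0 /\ reachable M t q.
Proof.
have final_nth (q : state M) : nth 0 (dl (encode M) 4) (enum_rank q) = encode_final (final q).
  by rewrite finals_encode (nth_map_enum_rank (fun q => encode_final (final q))).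
split=> [[v [q [rs [b [f [run_t fin_q _]]]]]]|[q' [fq' /asboolP[rho [q [rs [run_t q'E _]]]]]]].
  exists (enum_rank q); rewrite final_nth fin_q encode_final_eq0; split=> //.
  by apply/asboolP; exists (fun x => reg_hash p x rs), q, rs.
move: fq'; rewrite q'E final_nth encode_final_eq0 negbK; case fin_q: (final q) => [[b f]|//] _.
by exists (existT _ b (eval rs f)), q, rs, b, f.
Qed.

Lemma domain_systemP : vanishing S <->
  forall t, (exists v, semantics M1 t v) -> exists v, semantics M2 t v.
Proof.
have finalsE : dl S 2 = flatten [seq if nth 0 (dl (encode M1) 4) q1 == 0 then [::]
      else [:: code [:: q1; fld (caccept (encode M2)) 0; econst 0]]
    | q1 <- iota 0 (size (dl (encode M1) 4))].
  by rewrite dl_code /= CodeSeq.codeK.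
have acceptE t x : ev (x :: reach_values t) (fld (caccept (encode M2)) 0) = 0 <->
    exists v, semantics M2 t v.
  have := cev_accept t x; set b := has _ _; rewrite /cev => -[-> _].
  rewrite accepts_reachable; split=> [/eqP|[q [fq qt]]].
    rewrite eqb0 negbK => /hasP[q _ /andP[fq qt]]; by exists q.
  apply/eqP; rewrite eqb0 negbK; apply/hasP; exists q; last by rewrite fq.
  by rewrite mem_iota (reachable_lt qt).
split=> [van t /accepts_reachable[q [fq /asboolP[rho run_t]]]|dom q rho].
  apply/(acceptE t 0).
  have := van _ _ (domain_reach run_t) (code [:: q; fld (caccept (encode M2)) 0; econst 0]).
  rewrite !fld_code => /(_ _ erefl 0); rewrite [nth _ _ 1]/= [nth _ _ 2]/= ev_const; apply.
  rewrite finalsE; apply/flatten_mapP; exists q.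
    by rewrite mem_iota size_finals (@reachable_lt M1 t) //; apply/asboolP; exists rho.
  by rewrite (negPf fq) inE.
move=> /domain_reach_inv[t qt rhoE] f; rewrite finalsE => /flatten_mapP[q' _].
case: ifP => // fq'; rewrite inE => /eqP-> ; rewrite !fld_code /= => qq x.
rewrite rhoE ev_const; apply/acceptE; apply: dom; apply/accepts_reachable.
by exists q; rewrite -qq fq' qq.
Qed.

End DomainSystem.

(** * The decision procedures *)

Theorem corollary8 (Sigma : finType) :
  (exists f : 1.-tuple nat -> nat, recursive f /\
     forall (Gamma : signature) (M : automaton Sigma Gamma),
       decides (f [tuple encode M]) (functional M)) /\
  (exists g : 2.-tuple nat -> nat, recursive g /\
     forall (Gamma : signature) (M1 M2 : automaton Sigma Gamma),
       functional M1 -> functional M2 ->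
       decides (g [tuple encode M1; encode M2]) (equivalent M1 M2)).
Proof.
(* The prime depends on the alphabet alone, hence one procedure serves all signatures and
   automata. *)
have [p p_big p_prime] := prime_above #|Sigma|.+1.
have [D [rD decD]] := vanishing_decidable.
have rD_pair : RF (fun u => D (pair_system p (hd u) (tl u))).
  by apply: (RF_comp rD); apply: RF_pair_system; [apply: RF_hd | apply: RF_tl].
have rD_dom12 : RF (fun u => D (domain_system (hd u) (tl u))).
  by apply: (RF_comp rD); apply: RF_domain_system; [apply: RF_hd | apply: RF_tl].
have rD_dom21 : RF (fun u => D (domain_system (tl u) (hd u))).
  by apply: (RF_comp rD); apply: RF_domain_system; [apply: RF_tl | apply: RF_hd].
split.
  exists (fun t => D (pair_system p (nth 0 t 0) (nth 0 t 0))); split.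
    have := RF_comp rD_pair (RF_pcons RF_id RF_id).
    by move/recursive_ext; apply=> t; rewrite hd_pcons tl_pcons.
  move=> Gamma M; have [D1 D0] := decD (pair_system p (encode M) (encode M)).
  split=> [fM|nfM]; [apply: D1 | apply: D0].
    by apply/pair_systemP => // t v1 v2; apply: fM.
  by move/(pair_systemP p_prime p_big) => fM; apply: nfM => t v1 v2; apply: fM.
(* The three verdicts are 0 or 1, so that their product is the conjunction. *)
pose G u := D (pair_system p (hd u) (tl u)) * (D (domain_system (hd u) (tl u))
  * D (domain_system (tl u) (hd u))).
have rG : RF G by apply: RF_mul => //; apply: RF_mul.
exists (fun t => G (pcons (nth 0 t 0) (nth 0 t 1))); split.
  exact: recursive_comp1 rG (recursive_comp2 R2_pcons (recursive_nth 2 0) (recursive_nth 2 1)).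
move=> Gamma M1 M2 fM1 fM2; rewrite /= /G hd_pcons tl_pcons.
set e1 := encode M1; set e2 := encode M2.
(* Equal graphs amount to equal domains and equal values on common inputs; functionality is what
   lets any two values on a common input be compared. *)
have eqP' : equivalent M1 M2 <-> [/\ vanishing (pair_system p e1 e2),
    vanishing (domain_system e1 e2) & vanishing (domain_system e2 e1)].
  have sysP := pair_systemP p_prime p_big M1 M2.
  have [dom12P dom21P] := (domain_systemP p M1 M2, domain_systemP p M2 M1).
  split=> [eqM|[/sysP same /dom12P d12 /dom21P d21]].
    split; [apply/sysP => t v1 v2 M1v1 M2v2 | apply/dom12P => t [v M1v] | apply/dom21P => t [v M2v]].
    - by apply: fM2 M2v2; apply/eqM.
    - by exists v; apply/eqM.
    - by exists v; apply/eqM.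
  move=> t v; split=> [M1v|M2v].
    by have [v' M2v'] := d12 t (ex_intro _ v M1v); rewrite (same t v v').
  by have [v' M1v'] := d21 t (ex_intro _ v M2v); rewrite -(same t v' v).
have [Dp1 Dp0] := decD (pair_system p e1 e2).
have [D121 D120] := decD (domain_system e1 e2).
have [D211 D210] := decD (domain_system e2 e1).
split=> [/eqP'[/Dp1-> /D121-> /D211->] //|neq].
have [vp|/Dp0->//] := pselect (vanishing (pair_system p e1 e2)).
have [v12|/D120->] := pselect (vanishing (domain_system e1 e2)); last by rewrite muln0.
have [v21|/D210->] := pselect (vanishing (domain_system e2 e1)); last by rewrite !muln0.
by case: neq; apply/eqP'.
Qed.
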